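(* For $\varepsilon\in[0,1)$, the first-order coefficient $c_1(\varepsilon)$ of the Casimir energy of a film with Dirichlet-Dirichlet boundary conditions in the massless $g\phi^4_{4-\varepsilon}$ theory, i.e. the number $c_1(\varepsilon)$ determined, for any plate separation $L>0$, by $$L^{-3+2\varepsilon}\,c_1(\varepsilon)=\frac18\left[\int_0^L\Bigl\{D_L(z)^2-D(z)^2-D(L-z)^2\Bigr\}\,dz-2\int_L^\infty D(z)^2\,dz\right],$$ where $D_L$ and $D$ are the subtracted Dirichlet propagators at coincident points defined in the context, is given by $$c_1(\varepsilon)=\frac12\,(4\pi)^{-4+\varepsilon}\,\Gamma\Bigl(1-\frac{\varepsilon}{2}\Bigr)^2\Bigl[\zeta(2-\varepsilon)^2+(1-\cos\pi\varepsilon)\,B(3-2\varepsilon,-1+\varepsilon)\,\zeta(3-2\varepsilon)\Bigr],$$ where at $\varepsilon=0$ the second term in the square brackets is understood as its limit for $\varepsilon\to0$.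
   Context: Put $C=\frac14\pi^{-2+\varepsilon/2}\,\Gamma(1-\frac{\varepsilon}{2})$. The subtracted Dirichlet propagator in half-space at coincident points is $D(z)=-C\,(2z)^{-2+\varepsilon}$ for $z>0$, and the subtracted Dirichlet-Dirichlet film propagator at coincident points is $$D_L(z)=C\,(2L)^{-2+\varepsilon}\bigl[2\zeta(2-\varepsilon)-\zeta(2-\varepsilon,z/L)-\zeta(2-\varepsilon,1-z/L)\bigr],\qquad 0<z<L,$$ where $\zeta(a,x)=\sum_{k\ge0}(k+x)^{-a}$ ($\Re(a)>1$) is the Hurwitz zeta function and $\zeta(s)$ the Riemann zeta function. $B(x,y)=\Gamma(x)\Gamma(y)/\Gamma(x+y)$ is the beta function (extended meromorphically through gamma functions). The integral over $(0,L)$ is of the combined integrand in braces. The separation of the two parallel plates is $L$, and $d=4-\varepsilon$ is the space dimension. *)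

(* Defs.v *)
From HB Require Import structures.
From mathcomp Require Import all_boot all_order all_algebra.
From mathcomp Require Import all_classical all_reals all_analysis.

Set Implicit Arguments.
Unset Strict Implicit.
Unset Printing Implicit Defensive.

Import Order.TTheory GRing.Theory Num.Theory.
Import numFieldNormedType.Exports.

Local Open Scope classical_set_scope.
Local Open Scope ring_scope.

Section SpecialFunctions.
Context {R : realType}.
Implicit Types s x y a : R.

(* Convergent for 0 < s. *)
Definition Gamma_integral s : R :=
  \int[lebesgue_measure]_(t in `]0, +oo[) (t `^ (s - 1) * expR (- t)).

(* For s <= 0 the functional equation gives the meromorphic continuation
   Gamma s = Gamma (s + n) / (s (s + 1) ... (s + n - 1)), used here with the
   least n such that 0 < s + n.  At the poles s = 0, -1, -2, ... one factor of
   the denominator vanishes and the value is 0 by convention. *)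
Definition Gamma s : R :=
  if 0 < s then Gamma_integral s
  else let n := (Num.truncn (- s)).+1 in
       Gamma_integral (s + n%:R) / \prod_(i < n) (s + i%:R).

Definition Beta x y : R := Gamma x * Gamma y / Gamma (x + y).

(* Both zeta functions are given by their series, for exponents > 1. *)
Definition hurwitz_zeta a x : R :=
  limn (series (fun k : nat => (k%:R + x) `^ (- a))).

Definition riemann_zeta s : R :=
  limn (series (fun k : nat => k.+1%:R `^ (- s))).

End SpecialFunctions.

Section Film.
Context {R : realType}.
Implicit Types eps L z : R.

Definition propagator_const eps : R :=
  4^-1 * pi `^ (- 2 + eps / 2) * Gamma (1 - eps / 2).

(* Propagators are subtracted (their free part is removed) and taken at
   coincident points. *)
Definition half_space_propagator eps z : R :=
  - propagator_const eps * (2 * z) `^ (- 2 + eps).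

Definition film_propagator eps L z : R :=
  propagator_const eps * (2 * L) `^ (- 2 + eps) *
  (2 * riemann_zeta (2 - eps) - hurwitz_zeta (2 - eps) (z / L)
   - hurwitz_zeta (2 - eps) (1 - z / L)).

Definition film_integrand eps L z : R :=
  film_propagator eps L z ^+ 2 - half_space_propagator eps z ^+ 2
  - half_space_propagator eps (L - z) ^+ 2.

Definition first_order_energy eps L : R :=
  8^-1 *
  (\int[lebesgue_measure]_(z in `]0, L[) film_integrand eps L z
   - 2 * \int[lebesgue_measure]_(z in `]L, +oo[)
           (half_space_propagator eps z ^+ 2)).

Definition second_term eps : R :=
  (1 - cos (pi * eps)) * Beta (3 - 2 * eps) (- 1 + eps)
  * riemann_zeta (3 - 2 * eps).

Definition c1_formula eps : R :=
  2^-1 * (4 * pi) `^ (- 4 + eps) * Gamma (1 - eps / 2) ^+ 2 *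
  (riemann_zeta (2 - eps) ^+ 2
   + (if eps == 0 then lim (second_term e @[e --> (0 : R)^'])
      else second_term eps)).

End Film.

(* Main.v *)
(* With s = 2 - eps = 1 + u and t = z / L, half of the film integral reduces by
   the symmetry t <-> 1 - t to the integral over (0, 1/2) of
   2 t^-s E + E^2, E = Q - 2 zeta(s), Q = sum_(n >= 1) (n + t)^-s + (n - t)^-s,
   minus that of (1 - t)^-2s.  By convexity E >= 0, so only nonnegative terms are
   ever summed or integrated.  Unfolding (1/2, +oo) as the translates and
   reflections of (0, 1/2) gives int Q = 2^u / u, and the products occurring in
   Q^2 and t^-s E group by the distance k of the two lattice points; by scaling,
   each group is k^(1-2s) times a k-independent finite part plus a multiple of
   k^-s, and summing over k yields zeta(2s-1) and zeta(s).  The finite part of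
   |x|^-s |x + 1|^-s is found by integration by parts down to convergent beta
   integrals, combined by means of the reflection formula; the latter comes from
   the recursion for int_0^(pi/2) cos(a x) cos(x)^n dx.  As eps -> 0 the second
   term is O(eps): the double zero of 1 - cos(pi eps) beats the simple pole of
   Gamma(-1 + eps). *)
Require Import Defs.
From HB Require Import structures.
From mathcomp Require Import all_boot all_order all_algebra.
From mathcomp Require Import all_classical all_reals all_analysis.
From mathcomp Require Import measurable_realfun ring lra.

Set Implicit Arguments.
Unset Strict Implicit.
Unset Printing Implicit Defensive.

Import Order.TTheory GRing.Theory Num.Theory.
Import numFieldNormedType.Exports.

Local Open Scope classical_set_scope.
Local Open Scope ring_scope.

(** * Differentiation and improper integrals *)

(** The film propagator is proportional to -(t^-s + E). Squaring it produces t^-2s, which is not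
    integrable at 0; the half-space subtraction removes exactly this term, so it is cancelled
    pointwise before any integral is taken. What remains, 2 t^-s E + E^2, is harmless because E
    vanishes quadratically at 0. E^2 is reached through Q^2, and the terms linear in zeta(s) cancel:
    the k^-s parts of the groups sum to the cross term 4 zeta(s) times the integral of Q. Rescaling
    the group at distance k moves the fixed cutoff 1/2 to c = 1/(2k). The cutoff-dependent part of a
    group is a pure power c^-u, which is why its finite part is the same for all k. For eps = 0,
    that is u = 1, the auxiliary beta integrals diverge at 0 although the final value does not; that
    case uses explicit logarithmic antiderivatives. Identities with signs are stated with the
    negative terms moved to the other side, as equalities of nonnegative extended reals up to finite
    constants. Finiteness of each integral or series is then a conclusion rather than a premise. *)

Section Calculus.
Context {R : realType}.
Implicit Types (a b c p x y u l d : R) (f g F : R -> R).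

Lemma isdC a x : is_derive x 1 (fun=> a) 0.
Proof. exact: is_derive_cst. Qed.

Lemma isdI x : is_derive x 1 (fun y => y) 1.
Proof. exact: is_derive_id. Qed.

Lemma isdD f g x a b : is_derive x 1 f a -> is_derive x 1 g b ->
  is_derive x 1 (fun y => f y + g y) (a + b).
Proof. by move=> fa gb; exact: is_deriveD. Qed.

Lemma isdN f x a : is_derive x 1 f a -> is_derive x 1 (fun y => - f y) (- a).
Proof. by move=> fa; exact: is_deriveN. Qed.

Lemma isdM f g x a b : is_derive x 1 f a -> is_derive x 1 g b ->
  is_derive x 1 (fun y => f y * g y) (f x * b + a * g x).
Proof.
move=> fa gb; rewrite [a * _]mulrC.
exact: (@is_deriveM _ _ f g x 1 a b).
Qed.

Lemma isdX f x a n : is_derive x 1 f a ->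
  is_derive x 1 (fun y => f y ^+ n) (n%:R * f x ^+ n.-1 * a).
Proof.
move=> fa; elim: n => [|n IH].
  under eq_fun do rewrite expr0; rewrite !mul0r; exact: isdC.
under eq_fun do rewrite exprS.
have -> : n.+1%:R * f x ^+ n * a = f x * (n%:R * f x ^+ n.-1 * a) + a * f x ^+ n.
  case: n {IH} => [|n]; first by rewrite !expr0; ring.
  by rewrite /= exprS -natr1; ring.
exact: isdM.
Qed.

Lemma isd_comp f g x a b : is_derive (g x) 1 f a -> is_derive x 1 g b ->
  is_derive x 1 (fun y => f (g y)) (a * b).
Proof. exact: is_derive1_comp. Qed.

(** The derivative keeps the exponent p and divides by the base, so that after differentiation
    [ring] and [field] see a single power of each base. *)
Lemma isd_powR f x a p : 0 < f x -> is_derive x 1 f a ->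
  is_derive x 1 (fun y => f y `^ p) (p * (f x `^ p / f x) * a).
Proof.
move=> fx fa.
have -> : f x `^ p / f x = f x `^ (p - 1).
  by rewrite powRB ?powRr1 ?ltW ?(gt_eqF fx) ?implybT.
exact: (@is_derive1_comp _ (@powR R ^~ p) f x _ _ (is_derive1_powR p fx) fa).
Qed.

Lemma isd_cont f x a : is_derive x 1 f a -> {for x, continuous f}.
Proof.
by move=> [fx _]; apply: differentiable_continuous; exact/derivable1_diffP.
Qed.

Lemma isd_cvg_right F x d l : is_derive x 1 F d -> F x = l ->
  F y @[y --> x^'+] --> l.
Proof. by move=> /isd_cont cF <-; exact: cvg_at_right_filter. Qed.

Lemma isd_cvg_left F x d l : is_derive x 1 F d -> F x = l ->
  F y @[y --> x^'-] --> l.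
Proof. by move=> /isd_cont cF <-; exact: cvg_at_left_filter. Qed.

Lemma powRN_div x p : 0 < x -> x `^ (- (1 + p)) = x `^ (- p) / x.
Proof.
move=> x0; rewrite opprD addrC powRD; last by rewrite (gt_eqF x0) implybT.
by rewrite powR_inv1// ltW.
Qed.

End Calculus.

Ltac isd_step := first [exact: isdC | exact: isdI | apply: isdD | apply: isdN
  | apply: isdM | apply: isdX | (apply: isd_powR; [|]) ].

(** * Fundamental theorem of calculus on open and unbounded intervals; affine substitution *)

Section Ftc.
Context {R : realType}.
Implicit Types (a b c p x y u la lb : R) (f g F : R -> R).
Notation mu := (@lebesgue_measure R).

Lemma continuous_within_cc f a b :
  (forall x, a <= x <= b -> {for x, continuous f}) ->
  {within `[a, b], continuous f}.
Proof.
move=> cf; apply: continuous_in_subspaceT => x; rewrite inE/= in_itv/=.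
exact: cf.
Qed.

Lemma FTC_cc f F a b : a < b ->
  (forall x, a <= x <= b -> is_derive x 1 F (f x)) ->
  (forall x, a <= x <= b -> {for x, continuous f}) ->
  (\int[mu]_(x in `[a, b]) (f x)%:E = (F b)%:E - (F a)%:E)%E.
Proof.
move=> ab dF cf.
have cF x : a <= x <= b -> {for x, continuous F} by move=> /dF; exact: isd_cont.
apply: continuous_FTC2 => //.
- exact: continuous_within_cc.
- split.
  + by move=> x; rewrite in_itv/= => /andP[ax xb];
      case: (dF x) => //; rewrite !ltW.
  + by apply: cvg_at_right_filter; apply: cF; rewrite lexx ltW.
  + by apply: cvg_at_left_filter; apply: cF; rewrite lexx ltW.
- move=> x; rewrite in_itv/= => /andP[ax xb].
  by rewrite derive1E; have [] := dF x; rewrite ?ltW.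
Qed.

(** With f and g on opposite sides both integrals may be infinite, so the integral of f - g never
    has to make sense on the whole of D. On each compact subinterval the identity is finite;
    monotone convergence passes to the union. *)
Lemma ge0_FTC_exhaust (D : set R) f g F (a_ b_ : R^nat) la lb :
  D = \bigcup_n `[a_ n, b_ n]%classic ->
  (forall n, a_ n < b_ n) ->
  (forall m n, (m <= n)%N -> a_ n <= a_ m) ->
  (forall m n, (m <= n)%N -> b_ m <= b_ n) ->
  F (a_ n) @[n --> \oo] --> la -> F (b_ n) @[n --> \oo] --> lb ->
  (forall x, D x -> 0 <= f x) -> (forall x, D x -> 0 <= g x) ->
  (forall x, D x -> {for x, continuous f}) ->
  (forall x, D x -> {for x, continuous g}) ->
  (forall x, D x -> is_derive x 1 F (f x - g x)) ->
  (\int[mu]_(x in D) (f x)%:E + la%:E = \int[mu]_(x in D) (g x)%:E + lb%:E)%E.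
Proof.
move=> DE ab nia ndb Fa Fb f0 g0 cf cg dF.
pose I n : set R := `[a_ n, b_ n]%classic.
have ID n : I n `<=` D by rewrite DE => x Ix; exists n.
have ndI : {homo I : n m / (n <= m)%N >-> (n <= m)%O}.
  move=> n m nm; apply/subsetPset => x; rewrite /I/= !in_itv/= => /andP[ax xb].
  by rewrite (le_trans (nia _ _ nm) ax) (le_trans xb (ndb _ _ nm)).
have mI n (h : R -> R) : (forall x, D x -> {for x, continuous h}) ->
    measurable_fun (I n) (EFin \o h).
  move=> ch; apply/measurable_EFinP.
  apply: subspace_continuous_measurable_fun; first exact: measurable_itv.
  apply: continuous_within_cc => x xI; apply: ch; apply: (ID n).
  by rewrite /I/= in_itv.
have lim (h : R -> R) : (forall x, D x -> 0 <= h x) ->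
    (forall x, D x -> {for x, continuous h}) ->
    (\int[mu]_(x in I n) (h x)%:E @[n --> \oo] -->
     \int[mu]_(x in D) (h x)%:E)%E.
  move=> h0 ch; rewrite DE; apply: ge0_nondecreasing_set_cvg_integral => //.
  - by move=> n; exact: measurable_itv.
  - by move=> n; exact: mI.
  - by move=> n x /ID /h0; rewrite lee_fin.
have inth n (h : R -> R) : (forall x, D x -> {for x, continuous h}) ->
    mu.-integrable (I n) (EFin \o h).
  move=> ch; apply: continuous_compact_integrable; first exact: segment_compact.
  apply: continuous_within_cc => x xI; apply: ch; apply: (ID n).
  by rewrite /I/= in_itv.
have E n : (\int[mu]_(x in I n) (f x)%:E + (F (a_ n))%:E =
            \int[mu]_(x in I n) (g x)%:E + (F (b_ n))%:E)%E.
  have := @FTC_cc (fun x => f x - g x) F (a_ n) (b_ n) (ab n).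
  rewrite -/(I n).
  under eq_integral do rewrite EFinB.
  rewrite integralB//; [| exact: measurable_itv | exact: inth | exact: inth].
  have /fineK <- : (\int[mu]_(x in I n) (f x)%:E)%E \is a fin_num.
    by apply: integrable_fin_num; [exact: measurable_itv | exact: inth].
  have /fineK <- : (\int[mu]_(x in I n) (g x)%:E)%E \is a fin_num.
    by apply: integrable_fin_num; [exact: measurable_itv | exact: inth].
  rewrite -!EFinB -!EFinD => H; have {}H := H _ _; congr (_%:E).
  have : (((fine (\int[mu]_(x in I n) (f x)%:E)%E -
     fine (\int[mu]_(x in I n) (g x)%:E)%E)%R)%:E = (F (b_ n) - F (a_ n))%:E)%E.
    apply: H => x xI; have Dx : D x by apply: (ID n); rewrite /I/= in_itv.
      exact: dF.
    by apply: continuousB; [exact: cf|exact: cg].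
  by move=> H1; have {}H1 := EFin_inj H1; lra.
have l1 : ((\int[mu]_(x in I n) (f x)%:E + (F (a_ n))%:E) @[n --> \oo] -->
   \int[mu]_(x in D) (f x)%:E + la%:E)%E.
  by apply: cvgeD; [exact: fin_num_adde_defl | exact: lim |
    apply/fine_cvgP; split => //; near=> n].
have l2 : ((\int[mu]_(x in I n) (g x)%:E + (F (b_ n))%:E) @[n --> \oo] -->
   \int[mu]_(x in D) (g x)%:E + lb%:E)%E.
  by apply: cvgeD; [exact: fin_num_adde_defl | exact: lim |
    apply/fine_cvgP; split => //; near=> n].
move: l1; under eq_fun do rewrite E; move=> l1.
exact: (cvg_unique _ l1 l2).
Unshelve. all: end_near. Qed.

Lemma ge0_FTC_oo f g F a b la lb : a < b ->
  F x @[x --> a^'+] --> la -> F x @[x --> b^'-] --> lb ->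
  (forall x, a < x < b -> 0 <= f x) -> (forall x, a < x < b -> 0 <= g x) ->
  (forall x, a < x < b -> {for x, continuous f}) ->
  (forall x, a < x < b -> {for x, continuous g}) ->
  (forall x, a < x < b -> is_derive x 1 F (f x - g x)) ->
  (\int[mu]_(x in `]a, b[) (f x)%:E + la%:E =
   \int[mu]_(x in `]a, b[) (g x)%:E + lb%:E)%E.
Proof.
move=> ab Fa Fb f0 g0 cf cg dF.
have ba : 0 < b - a by rewrite subr_gt0.
(* The denominator n + 3 makes 2 * e n < b - a already for n = 0, so no interval degenerates. *)
pose e (n : nat) := (b - a) / (n.+3)%:R.
have e0 n : 0 < e n by rewrite divr_gt0.
have ele n m : (n <= m)%N -> e m <= e n.
  by move=> nm; apply: ler_wpM2l; [rewrite ltW|rewrite lef_pV2 ?posrE// ler_nat !ltnS].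
have e3 n : 2 * e n < b - a.
  rewrite /e mulrA ltr_pdivrMr// mulrC ltr_pM2l// ltr_nat//.
have ecvg : e n @[n --> \oo] --> (0 : R).
  rewrite -[X in _ --> X](mulr0 (b - a)); apply: cvgMr.
  have := @cvg_harmonic R; rewrite -(cvg_shiftn 2%N).
  by under eq_fun do rewrite /harmonic/= addn2.
apply: (@ge0_FTC_exhaust _ f g F (fun n => a + e n) (fun n => b - e n)) => //.
- apply/seteqP; split => [x|x [n _]]/=; rewrite !in_itv/=.
    move=> /andP[ax xb].
    have : \forall n \near \oo, e n < Num.min (x - a) (b - x).
      by apply: (cvgr_lt (0 : R)) => //; rewrite lt_min !subr_gt0 ax xb.
    case=> N _ /(_ N (leqnn N)); rewrite /= lt_min => /andP[h1 h2].
    by exists N => //=; rewrite in_itv/=; apply/andP; split; lra.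
  by have := e0 n; move=> ? /andP[? ?]; apply/andP; split; lra.
- by move=> n; have := e3 n; lra.
- by move=> m n /ele; lra.
- by move=> m n /ele; lra.
- move/cvg_at_rightP : Fa; apply; split => [n|]; first by rewrite ltrDl.
  by rewrite -[X in _ --> X]addr0; apply: cvgD => //; exact: cvg_cst.
- move/cvg_at_leftP : Fb; apply; split => [n|]; first by rewrite ltrBlDr ltrDl.
  by rewrite -[X in _ --> X]subr0; apply: cvgB => //; exact: cvg_cst.
Qed.

Lemma ge0_FTC_oy f g F a la lb :
  F x @[x --> a^'+] --> la -> F x @[x --> +oo] --> lb ->
  (forall x, a < x -> 0 <= f x) -> (forall x, a < x -> 0 <= g x) ->
  (forall x, a < x -> {for x, continuous f}) ->
  (forall x, a < x -> {for x, continuous g}) ->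
  (forall x, a < x -> is_derive x 1 F (f x - g x)) ->
  (\int[mu]_(x in `]a, +oo[) (f x)%:E + la%:E =
   \int[mu]_(x in `]a, +oo[) (g x)%:E + lb%:E)%E.
Proof.
move=> Fa Fb f0 g0 cf cg dF.
have hcvg : harmonic n @[n --> \oo] --> (0 : R) := @cvg_harmonic R.
have h0 n : (0 : R) < harmonic n by exact: harmonic_gt0.
(* [harmonic 0] is 1, so the right ends start at a + 2 to keep the first interval nondegenerate. *)
apply: (@ge0_FTC_exhaust _ f g F (fun n => a + harmonic n)
  (fun n => a + n.+2%:R)) => //.
- apply/seteqP; split => [x|x [n _]]/=; rewrite !in_itv/= andbT.
    move=> ax.
    have : \forall n \near \oo, harmonic n < x - a.
      by apply: (cvgr_lt (0 : R)) => //; rewrite subr_gt0.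
    case=> N _ hN; set M := maxn N (Num.truncn (x - a)).
    exists M => //=; rewrite in_itv/=; apply/andP; split.
      have : harmonic M < x - a := hN M (leq_maxl _ _).
      by move=> /ltW; rewrite lerBrDl.
    have : x - a < M.+2%:R.
      apply: lt_le_trans (truncnS_gt _) _; rewrite ler_nat ltnS.
      by rewrite (leq_trans (leq_maxr N _)).
    by lra.
  move=> /andP[h _]; apply: lt_le_trans h; rewrite ltrDl; exact: h0.
- move=> n; rewrite ltrD2l (@le_lt_trans _ _ 1)// ?ltr1n//.
  by rewrite /harmonic/= invf_le1// ?ler1n// ltr0n.
- move=> m n mn; rewrite lerD2l /harmonic/= lef_pV2 ?posrE ?ltr0n// ler_nat.
  by rewrite ltnS.
- by move=> m n mn; rewrite lerD2l ler_nat !ltnS.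
- move/cvg_at_rightP : Fa; apply; split => [n|]; first by rewrite ltrDl.
  by rewrite -[X in _ --> X]addr0; apply: cvgD => //; exact: cvg_cst.
- move/cvg_pinftyP : Fb; apply.
  apply: (cvg_comp _ _ _ (@cvg_addrl R a)).
  have := @cvgr_idn R; rewrite -(cvg_shiftn 2%N).
  by under eq_fun do rewrite addn2.
all: by move=> x /=; rewrite in_itv/= andbT; eauto.
Qed.



(** The pushforward of Lebesgue measure, scaled by |a|, gives ]c, d] its length, and these intervals
    determine the measure. A negative a only turns the preimage into an interval closed on the left,
    of the same length. *)
Lemma ge0_integral_affine (D : set R) (f : R -> \bar R) a b : a != 0 ->
  measurable D -> measurable_fun D f -> (forall x, D x -> (0 <= f x)%E) ->
  (\int[mu]_(x in D) f x =
   `|a|%:E * \int[mu]_(x in (fun y => a * y + b)%R @^-1` D) f (a * x + b)%R)%E.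
Proof.
move=> a0 mD mf f0.
pose phi : measurableTypeR R -> measurableTypeR R := fun y => a * y + b.
have mphi : measurable_fun setT phi.
  by apply: measurable_funD => //; apply: measurable_funM.
have an : 0 <= `|a|^-1 by rewrite invr_ge0.
have an0 : 0 <= `|a| by [].
rewrite -[in RHS](@ge0_integral_pushforward _ _ _ _ _ phi mphi mu D f)//; last first.
  by move=> y; rewrite inE; exact: f0.
rewrite -(@ge0_integral_mscale _ _ _ (pushforward mu phi) D mD (NngNum an0))//.
apply: eq_measure_integral => A mA AD.
apply: lebesgue_measure_unique => //= _ [[c d]] _ <-.
rewrite /mscale/= /pushforward.
have [a_gt|a_lt|a_eq] := ltgtP 0 a; last by rewrite a_eq eqxx in a0.
- have -> : phi @^-1` `]c, d]%classic = `]((c - b) / a), ((d - b) / a)]%classic.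
    apply/seteqP; split => x /=; rewrite !in_itv/= /phi ltr_pdivrMr// ler_pdivlMr//;
    by rewrite ltrBlDr lerBrDr mulrC.
  rewrite !lebesgue_measure_itv/= !lte_fin ltr_pM2r ?invr_gt0// ltrD2r.
  case: ifPn => _; last by rewrite mule0.
  by rewrite -!EFinD -EFinM gtr0_norm//; congr EFin; field; rewrite gt_eqF.
- have -> : phi @^-1` `]c, d]%classic = `[((d - b) / a), ((c - b) / a)[%classic.
    apply/seteqP; split => x /=; rewrite !in_itv/= /phi ler_ndivrMr// ltr_ndivlMr//;
    by rewrite ltrBlDr lerBrDr mulrC andbC.
  rewrite !lebesgue_measure_itv/= !lte_fin ltr_nM2r ?invr_lt0// ltrD2r.
  case: ifPn => _; last by rewrite mule0.
  by rewrite -!EFinD -EFinM ltr0_norm//; congr EFin; field; rewrite lt_eqF.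
Qed.

End Ftc.

(* Locked: unfolding the integral makes comparisons of distinct Gamma values
   very slow. *)
HB.lock Definition gam (R : realType) (s : R) : R := Gamma_integral s.

(** * Gamma and beta integrals *)
Section GammaFunction.
Context {R : realType}.
Implicit Types (a b c p x y u t v : R).
Notation mu := (@lebesgue_measure R).
Notation Gam := (@gam R).

Lemma powR_cvgy0 p : p < 0 -> x `^ p @[x --> +oo] --> (0 : R).
Proof.
move=> p0; apply/cvgr0Pnorm_lt => e e0; near=> x.
have x0 : 0 < x by near: x; exact: nbhs_pinfty_gt.
have ex : e `^ p^-1 < x by near: x; exact: nbhs_pinfty_gt.
rewrite ger0_norm ?powR_ge0//.
have : (e `^ p^-1) `^ (- p) < x `^ (- p).
  by apply: gt0_ltr_powR; rewrite ?oppr_gt0// nnegrE ?powR_ge0// ltW.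
rewrite -powRrM mulrN mulVf ?lt_eqF// powR_inv1 ?ltW// powRN.
by rewrite ltf_pV2// posrE powR_gt0.
Unshelve. all: end_near. Qed.

Lemma powR_expRN_cvgy p : x `^ p * expR (- x) @[x --> +oo] --> (0 : R).
Proof.
(* Since n >= p, bounding the exponential below by x^(n+1) / (n+1)! leaves a factor x^-1. *)
pose n := (Num.truncn p).+1.
have pn : p <= n%:R by rewrite ltW// truncnS_gt.
apply: (@squeeze_cvgr _ _ _ _ (fun=> 0) (fun x => (n.+1)`!%:R * x `^ (-1))); last 2 first.
- exact: cvg_cst.
- rewrite -[X in _ --> X](mulr0 (n.+1)`!%:R); apply: cvgMr.
  by apply: powR_cvgy0; rewrite ltrN10.
near=> x.
have x1 : 1 < x by near: x; exact: nbhs_pinfty_gt.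
have x0 : 0 < x by rewrite (lt_trans _ x1).
rewrite mulr_ge0 ?powR_ge0 ?expR_ge0//= powR_inv1 ?(ltW x0)//.
have h1 : x `^ p <= x ^+ n by rewrite -powR_mulrn ?(ltW x0)//; apply: ler_powR => //; exact: ltW.
have h2 : expR (- x) <= (n.+1)`!%:R / x ^+ n.+1.
  rewrite expRN -[leRHS]invrK lef_pV2 ?posrE ?invr_gt0 ?expR_gt0//; last first.
    by rewrite divr_gt0 ?exprn_gt0// ltr0n fact_gt0.
  rewrite invf_div (le_trans _ (@expR_ge1Dxn _ x n (ltW x0)))// lerDr ler01//.
apply: (@le_trans _ _ (x ^+ n * ((n.+1)`!%:R / x ^+ n.+1))).
  by apply: ler_pM; rewrite ?powR_ge0 ?expR_ge0.
rewrite le_eqVlt; apply/orP; left; apply/eqP; rewrite exprS; field.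
by rewrite gt_eqF//= expf_neq0// gt_eqF.
Unshelve. all: end_near. Qed.

Lemma powR_expRN_cvg0 p : 0 < p -> x `^ p * expR (- x) @[x --> 0^'+] --> (0 : R).
Proof.
move=> p0; apply: (@squeeze_cvgr _ _ _ _ (fun=> 0) (fun x => x `^ p)); last 2 first.
- exact: cvg_cst.
- exact: powR_cvg0.
near=> x; rewrite mulr_ge0 ?powR_ge0 ?expR_ge0//= ger_pMr.
  by rewrite -expR0 ler_expR oppr_le0; near: x; exact: nbhs_right_ge.
by rewrite powR_gt0.
Unshelve. all: end_near. Qed.

(** The gamma integral as an extended real, for use until its finiteness is known; [Gamma_integral]
    is its [fine] part. *)
Definition eGamma p : \bar R :=
  (\int[mu]_(t in `]0%R, +oo[) (t `^ (p - 1) * expR (- t))%:E)%E.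

Lemma isd_powR_expRN p x : 0 < x ->
  is_derive x 1 (fun t => t `^ p * expR (- t))
    (p * (x `^ (p - 1) * expR (- x)) - x `^ p * expR (- x)).
Proof.
move=> x0; have -> : p * (x `^ (p - 1) * expR (- x)) - x `^ p * expR (- x) =
   x `^ p * (expR (- x) * - 1) + (p * (x `^ p / x) * 1) * expR (- x).
  rewrite powRB ?powRr1 ?ltW ?(gt_eqF x0) ?implybT//; ring.
apply: isdM; last by apply: isd_powR => //; exact: isdI.
Qed.

Lemma gamma_integrand_cont p x : 0 < x -> {for x, continuous (fun t => t `^ p * expR (- t))}.
Proof. by move=> x0; exact: isd_cont (isd_powR_expRN p x0). Qed.

Lemma measurable_gamma_integrand p (D : set R) :
  measurable_fun D (fun t => (t `^ p * expR (- t))%:E).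
Proof.
apply/measurable_EFinP; apply: measurable_funTS; apply: measurable_funM.
  exact: measurable_powR.
apply: continuous_measurable_fun => x; apply: (@isd_cont _ _ x (expR (- x) * - 1)).
Qed.

Lemma gamma_integrand_ge0 p x : 0 <= x `^ p * expR (- x).
Proof. by rewrite mulr_ge0 ?powR_ge0 ?expR_ge0. Qed.

Lemma eGammaS p : 0 < p -> eGamma (p + 1) = (p%:E * eGamma p)%E.
Proof.
move=> p0.
have E : ((\int[mu]_(t in `]0%R, +oo[) (p * (t `^ (p - 1) * expR (- t)))%:E + 0%:E)%E =
  (\int[mu]_(t in `]0%R, +oo[) (t `^ p * expR (- t))%:E + 0%:E)%E).
  apply: (@ge0_FTC_oy _ _ _ (fun t => t `^ p * expR (- t))).
  - exact: powR_expRN_cvg0.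
  - exact: powR_expRN_cvgy.
  - by move=> x _; rewrite mulr_ge0 ?gamma_integrand_ge0 ?ltW.
  - by move=> x _; rewrite gamma_integrand_ge0.
  - by move=> x x0; apply: continuousM; [exact: cst_continuous|exact: gamma_integrand_cont].
  - by move=> x x0; exact: gamma_integrand_cont.
  - by move=> x x0; exact: isd_powR_expRN.
move: E; rewrite !adde0 /eGamma addrK => <-.
under eq_integral do rewrite EFinM.
  rewrite ge0_integralZl_EFin ?ltW//.
- by move=> x _; rewrite lee_fin gamma_integrand_ge0.
- exact: measurable_gamma_integrand.
Qed.

Lemma eGamma1 : eGamma 1 = 1%E.
Proof.
have : ((eGamma 1 + (-1)%:E)%E = (\int[mu]_(t in `]0%R, +oo[) (0 : R)%:E + 0%:E)%E).
  2: { rewrite integral0 adde0; case: (eGamma 1) => [r||]//.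
       by rewrite -EFinD => H; have {}H := EFin_inj H; congr EFin; lra. }
apply: (@ge0_FTC_oy _ _ _ (fun t => - expR (- t))).
- apply: cvgN; rewrite -[X in _ --> X]expR0 -[X in _ --> expR X]oppr0.
  apply: cvg_at_right_filter; apply: (@continuous_comp _ _ _ -%R expR).
    exact: oppr_continuous.
  exact: continuous_expR.
- rewrite -oppr0; apply: cvgN; exact: cvgr_expR.
- by move=> x _; exact: gamma_integrand_ge0.
- by [].
- by move=> x x0; exact: gamma_integrand_cont.
- by move=> x x0; exact: cst_continuous.
- move=> x x0; rewrite subrr powRr0 mul1r subr0.
  have -> : expR (- x) = - (expR (- x) * - 1) by ring.
  by apply: isdN; apply: (@isd_comp _ expR); apply: isdN; exact: isdI.
Qed.

Lemma eGamma_nat n : eGamma n.+1%:R = (n`!%:R)%:E.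
Proof.
elim: n => [|n IH]; first by rewrite eGamma1.
by rewrite -natr1 eGammaS ?ltr0n// IH factS natrM EFinM.
Qed.

Lemma eGamma_ge0 p : (0 <= eGamma p)%E.
Proof. by apply: integral_ge0 => x _; rewrite lee_fin gamma_integrand_ge0. Qed.

(** Finiteness is shown at p + 1, where t^p <= 1 + t^n for an integer n >= p and the integer values
    are factorials; the functional equation carries it back to p. *)
Lemma eGamma_fin p : 0 < p -> eGamma p \is a fin_num.
Proof.
move=> p0; rewrite ge0_fin_numE ?eGamma_ge0//.
have : (eGamma (p + 1) < +oo)%E.
  pose n := (Num.truncn p).+1.
  have pn : p <= n%:R by rewrite ltW// truncnS_gt.
  apply: (@le_lt_trans _ _ (eGamma 1 + eGamma n.+1%:R)%E); last first.
    by rewrite eGamma1 eGamma_nat -EFinD ltry.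
  rewrite /eGamma -ge0_integralD//; last 4 first.
  - by move=> x _; rewrite lee_fin gamma_integrand_ge0.
  - exact: measurable_gamma_integrand.
  - by move=> x _; rewrite lee_fin gamma_integrand_ge0.
  - exact: measurable_gamma_integrand.
  apply: ge0_le_integral => //.
  - by move=> x _; rewrite lee_fin gamma_integrand_ge0.
  - exact: measurable_gamma_integrand.
  - by apply: emeasurable_funD; exact: measurable_gamma_integrand.
  move=> x; rewrite /= in_itv/= andbT => x0; rewrite -EFinD lee_fin -mulrDl.
  rewrite ler_wpM2r ?expR_ge0// subrr addrK -natr1 addrK powRr0.
  have [x1|x1] := leP x 1.
    apply: (@le_trans _ _ 1); last by rewrite lerDl powR_ge0.
    by rewrite -[leRHS](powRr0 x); apply: ger_powR; rewrite ?x0// ltW.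
  apply: (@le_trans _ _ (x `^ n%:R)); last by rewrite lerDr.
  by apply: ler_powR => //; exact: ltW.
rewrite eGammaS//; have := eGamma_ge0 p; case: (eGamma p) => [r||]//.
  by move=> _ _; rewrite ltry.
by rewrite gt0_muley// lte_fin.
Qed.

Lemma eGammaE p : 0 < p -> eGamma p = (Gam p)%:E.
Proof. by move=> p0; rewrite gam.unlock /Gamma_integral /Rintegral fineK// eGamma_fin. Qed.

Lemma GamS p : 0 < p -> Gam (p + 1) = p * Gam p.
Proof.
by move=> p0; apply: EFin_inj; rewrite EFinM -!eGammaE ?addr_gt0// eGammaS.
Qed.

Lemma Gam1 : Gam 1 = 1.
Proof. by apply: EFin_inj; rewrite -eGammaE ?eGamma1. Qed.

Lemma Gam_gt0 p : 0 < p -> 0 < Gam p.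
Proof.
move=> p0; rewrite -lte_fin -eGammaE//.
(* On [1, 2], 0 <= ln t <= 1 gives t^(p - 1) >= exp(-|p - 1|), and exp(-t) >= exp(-2). *)
pose c := expR (- `|p - 1|) * expR (- 2).
apply: (@lt_le_trans _ _ (\int[mu]_(t in `[1%R, 2%R]) (cst c%:E t))%E).
  rewrite integral_cst//= lebesgue_measure_itv/= lte_fin ltr1n.
  by rewrite -EFinD -EFinM lte_fin mulr_gt0 ?mulr_gt0 ?expR_gt0// subr_gt0 ltr1n.
apply: (@le_trans _ _ (\int[mu]_(t in `[1%R, 2%R]) (t `^ (p - 1) * expR (- t))%:E)%E).
  apply: ge0_le_integral => //.
  - by move=> x _; rewrite lee_fin mulr_ge0 ?expR_ge0.
  - exact: measurable_gamma_integrand.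
  move=> x; rewrite /= in_itv/= => /andP[x1 x2]; rewrite lee_fin.
  have x0 : 0 < x by rewrite (lt_le_trans _ x1).
  apply: ler_pM; rewrite ?expR_ge0//; last by rewrite ler_expR lerN2.
  rewrite /powR gt_eqF// ler_expR.
  have l0 : 0 <= ln x by exact: ln_ge0.
  have l1 : ln x <= 1.
    by have := @le_ln1Dx R (x - 1); rewrite subrKC; lra.
  apply: (@le_trans _ _ (- (`|p - 1| * ln x))).
    by rewrite lerN2 ler_piMr.
  by rewrite -mulNr ler_wpM2r// lerNl -normrN ler_norm.
apply: ge0_subset_integral => //.
- exact: measurable_gamma_integrand.
- by move=> x _; rewrite lee_fin gamma_integrand_ge0.
- by move=> x; rewrite /= !in_itv/= andbT => /andP[x1 _]; rewrite (lt_le_trans _ x1).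
Qed.


(* The tangent-line inequality x^u <= (1 - u) + u x at x = t / c. *)
Lemma powR_tangent u c t : 0 <= u <= 1 -> 0 < c -> 0 < t ->
  t `^ u <= (1 - u) * c `^ u + u * (c `^ u / c) * t.
Proof.
move=> /andP[u0 u1] c0 t0; set w := c `^ u.
pose y := ln (t / c).
have tc : t / c = expR y by rewrite lnK// posrE divr_gt0.
have -> : t `^ u = w * expR (u * y).
  have -> : t = c * (t / c) by rewrite mulrC divfK// gt_eqF.
  rewrite powRM ?ltW ?divr_gt0//; congr (_ * _).
  by rewrite /powR gt_eqF// divr_gt0.
have -> : (1 - u) * w + u * (w / c) * t = w * ((1 - u) + u * (t / c)) by ring.
rewrite ler_pM2l ?powR_gt0// tc.
have -> : 1 - u + u * expR y =
  expR (u * y) * ((1 - u) * expR (- (u * y)) + u * expR ((1 - u) * y)).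
  rewrite mulrDr mulrCA -expRD subrr expR0 mulr1 mulrCA -expRD.
  by rewrite mulrBl mul1r subrKC.
rewrite ler_peMr ?expR_ge0//.
have h1 := expR_ge1Dx (- (u * y)); have h2 := expR_ge1Dx ((1 - u) * y).
apply: (@le_trans _ _ ((1 - u) * (1 + - (u * y)) + u * (1 + (1 - u) * y))).
  by rewrite le_eqVlt; apply/orP; left; apply/eqP; ring.
by apply: lerD; rewrite ler_wpM2l ?subr_ge0.
Qed.

(** One half of Wendel's inequality: the tangent of t^u at t = x, integrated against the gamma
    weight. Gam(x + 1) = x Gam(x) collapses the two resulting terms into one. *)
Lemma Gam_shift_le u x : 0 <= u <= 1 -> 0 < x -> Gam (x + u) <= Gam x * x `^ u.
Proof.
move=> u01 x0; have /andP[u0 u1] := u01.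
have w0 : 0 <= x `^ u by exact: powR_ge0.
rewrite -lee_fin EFinM -!eGammaE// ?ltr_wpDr//.
have ge0 : x != 0 by rewrite gt_eqF.
have -> : (eGamma x * (x `^ u)%:E =
   ((1 - u) * x `^ u)%:E * eGamma x + (u * (x `^ u / x))%:E * eGamma (x + 1))%E.
  rewrite eGammaS// !eGammaE// -!EFinM -EFinD; congr EFin; field.
  by rewrite gt_eqF.
have k1 : 0 <= (1 - u) * x `^ u by rewrite mulr_ge0// subr_ge0.
have k2 : 0 <= u * (x `^ u / x) by rewrite !mulr_ge0// invr_ge0 ltW.
rewrite /eGamma -!ge0_integralZl_EFin//; last first.
- exact: measurable_gamma_integrand.
- by move=> t _; rewrite lee_fin gamma_integrand_ge0.
- exact: measurable_gamma_integrand.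
- by move=> t _; rewrite lee_fin gamma_integrand_ge0.
rewrite -ge0_integralD//; last 4 first.
- by move=> t _; rewrite -EFinM lee_fin mulr_ge0// gamma_integrand_ge0.
- by apply: emeasurable_funM => //; exact: measurable_gamma_integrand.
- by move=> t _; rewrite -EFinM lee_fin mulr_ge0// gamma_integrand_ge0.
- by apply: emeasurable_funM => //; exact: measurable_gamma_integrand.
apply: ge0_le_integral => //.
- by move=> t _; rewrite lee_fin gamma_integrand_ge0.
- exact: measurable_gamma_integrand.
- by apply: emeasurable_funD; apply: emeasurable_funM => //; exact: measurable_gamma_integrand.
move=> t; rewrite /= in_itv/= andbT => t0.
rewrite -!EFinM -EFinD lee_fin.
have -> : t `^ (x + u - 1) = t `^ (x - 1) * t `^ u.
  by rewrite -powRD ?(gt_eqF t0) ?implybT//; congr powR; ring.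
have -> : t `^ (x + 1 - 1) = t `^ (x - 1) * t.
  by rewrite -[X in _ * X](@powRr1 _ t) ?ltW// -powRD ?(gt_eqF t0) ?implybT//; congr powR; ring.
have -> : (1 - u) * x `^ u * (t `^ (x - 1) * expR (- t)) +
  u * (x `^ u / x) * (t `^ (x - 1) * t * expR (- t)) =
  t `^ (x - 1) * ((1 - u) * x `^ u + u * (x `^ u / x) * t) * expR (- t) by ring.
rewrite ler_wpM2r ?expR_ge0// ler_wpM2l ?powR_ge0//.
exact: powR_tangent.
Qed.

Lemma weighted_sum_fin (e1 e2 e3 : \bar R) a b c (l : R) :
  e1 = c%:E -> e2 = a%:E -> e3 = b%:E ->
  (2%:E * e1 <= l%:E * e2 + (l^-1)%:E * e3)%E -> 2 * c <= l * a + l^-1 * b.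
Proof. by move=> -> -> ->; rewrite -!EFinM -EFinD lee_fin. Qed.

(** The last step of a weighted Cauchy-Schwarz argument; the weight l = c / a already gives the
    bound. *)
Lemma sqr_le_of_weighted a b c : 0 < c -> 0 < a -> 0 < b ->
  (forall l : R, 0 < l -> 2 * c <= l * a + l^-1 * b) -> c ^+ 2 <= a * b.
Proof.
move=> c0 a0 b0 /(_ (c / a)); rewrite divr_gt0// => /(_ isT).
have -> : c / a * a + (c / a)^-1 * b = c + a * b / c by field; rewrite !gt_eqF.
by rewrite mulr_natl mulr2n lerD2l ler_pdivlMr// expr2.
Qed.

(** Log-convexity of the gamma function. Under the integral it is 2 <= w + 1/w with w = l t^u, for
    every weight l > 0. *)
Lemma Gam_midpoint u x : 0 <= u < x -> Gam x ^+ 2 <= Gam (x + u) * Gam (x - u).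
Proof.
move=> /andP[u0 ux].
have x0 : 0 < x by exact: le_lt_trans ux.
have xp : 0 < x + u by rewrite ltr_wpDr.
have xm : 0 < x - u by rewrite subr_gt0.
have gp := Gam_gt0 xp; have gm := Gam_gt0 xm.
have key (l : R) : 0 < l -> 2 * Gam x <= l * Gam (x + u) + l^-1 * Gam (x - u).
  move=> l0; have l0' := ltW l0.
  have li : 0 <= l^-1 by rewrite invr_ge0.
  apply: (weighted_sum_fin (eGammaE x0) (eGammaE xp) (eGammaE xm)).
  have two0 : 0 <= 2 :> R by [].
  rewrite /eGamma -(ge0_integralZl_EFin _ _ _ _ two0)//; last first.
  - exact: measurable_gamma_integrand.
  - by move=> t _; rewrite lee_fin gamma_integrand_ge0.
  rewrite -(ge0_integralZl_EFin _ _ _ _ l0')//; last first.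
  - exact: measurable_gamma_integrand.
  - by move=> t _; rewrite lee_fin gamma_integrand_ge0.
  rewrite -(ge0_integralZl_EFin _ _ _ _ li)//; last first.
  - exact: measurable_gamma_integrand.
  - by move=> t _; rewrite lee_fin gamma_integrand_ge0.
  rewrite -ge0_integralD//; last 4 first.
  - by move=> t _; rewrite -EFinM lee_fin mulr_ge0// gamma_integrand_ge0.
  - by apply: emeasurable_funM => //; exact: measurable_gamma_integrand.
  - by move=> t _; rewrite -EFinM lee_fin mulr_ge0// gamma_integrand_ge0.
  - by apply: emeasurable_funM => //; exact: measurable_gamma_integrand.
  apply: ge0_le_integral => //.
  - by move=> t _; rewrite -EFinM lee_fin mulr_ge0// gamma_integrand_ge0.
  - by apply: emeasurable_funM => //; exact: measurable_gamma_integrand.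
  - by apply: emeasurable_funD; apply: emeasurable_funM => //; exact: measurable_gamma_integrand.
  move=> t; rewrite /= in_itv/= andbT => t0.
  rewrite -!EFinM -EFinD lee_fin !mulrA -mulrDl ler_wpM2r ?expR_ge0//.
  have -> : t `^ (x + u - 1) = t `^ (x - 1) * t `^ u.
    by rewrite -powRD ?(gt_eqF t0) ?implybT//; congr powR; ring.
  have -> : t `^ (x - u - 1) = t `^ (x - 1) * t `^ (- u).
    by rewrite -powRD ?(gt_eqF t0) ?implybT//; congr powR; ring.
  rewrite !mulrA ![_ * t `^ (x - 1)]mulrC -!mulrA -mulrDr ler_wpM2l ?powR_ge0//.
  rewrite powRN -invfM; set w := l * _.
  have w0 : 0 < w by rewrite mulr_gt0// powR_gt0.
  rewrite -subr_ge0; have -> : w + w^-1 - 2 = (w - 1) ^+ 2 / w.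
    by field; rewrite gt_eqF.
  by rewrite divr_ge0 ?sqr_ge0// ltW.
exact: (sqr_le_of_weighted (Gam_gt0 x0) gp gm key).
Qed.

(** A squeeze: log-convexity bounds the ratio below by 1, and [Gam_shift_le] with steps u and 1 - u
    bounds it above by ((n+2)/(n+1))^u <= 1 + 1/(n+1). *)
Lemma Gam_ratio_cvg u : 0 <= u <= 1 ->
  Gam (n.+2%:R + u) * Gam (n.+2%:R - u) / Gam n.+2%:R ^+ 2 @[n --> \oo] --> (1 : R).
Proof.
move=> u01; have /andP[u0 u1] := u01.
apply: (@squeeze_cvgr _ _ _ _ (fun=> 1) (fun n => 1 + n.+1%:R^-1)); last 2 first.
- exact: cvg_cst.
- rewrite -[X in _ --> X](addr0 1); apply: cvgD; first exact: cvg_cst.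
  exact: cvg_harmonic.
near=> n.
have np : (0 : R) < n.+2%:R by rewrite ltr0n.
have n1 : (0 : R) < n.+1%:R by rewrite ltr0n.
have nu : u < n.+2%:R by rewrite (le_lt_trans u1)// ltr1n.
have nup : 0 < n.+2%:R + u by rewrite ltr_wpDr.
have num : 0 < n.+2%:R - u by rewrite subr_gt0.
have gup := ltW (Gam_gt0 nup); have gum := ltW (Gam_gt0 num).
have g0 : 0 < Gam n.+2%:R by exact: Gam_gt0.
rewrite ler_pdivlMr ?exprn_gt0// mul1r Gam_midpoint ?u0 ?nu//=.
rewrite ler_pdivrMr ?exprn_gt0//.
have h1 := @Gam_shift_le u n.+2%:R u01 (ltr0Sn _ _).
have h2 : Gam (n.+2%:R - u) <= Gam n.+2%:R * n.+1%:R `^ (- u).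
  have := @Gam_shift_le (1 - u) n.+1%:R; rewrite subr_ge0 u1 lerBlDr lerDl u0.
  move=> /(_ isT (ltr0Sn _ _)); rewrite addrA natr1.
  move=> /le_trans; apply; rewrite powRD; last by rewrite pnatr_eq0 implybT.
  have -> : Gam n.+2%:R = n.+1%:R * Gam n.+1%:R by rewrite -(GamS n1) natr1.
  by rewrite (powRr1 (ltW n1)) mulrA [Gam _ * _]mulrC.
apply: (@le_trans _ _ ((Gam n.+2%:R * n.+2%:R `^ u) * (Gam n.+2%:R * n.+1%:R `^ (- u)))).
  exact: (ler_pM gup gum h1 h2).
have -> : Gam n.+2%:R * n.+2%:R `^ u * (Gam n.+2%:R * n.+1%:R `^ (- u)) =
  (n.+2%:R / n.+1%:R) `^ u * Gam n.+2%:R ^+ 2.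
  rewrite powRM ?invr_ge0// powRN -powR_inv1 ?powR_ge0// -powR_inv1// !(powRAC _ _ u).
  by rewrite powR_inv1 ?powR_ge0//; ring.
apply: ler_wpM2r; first exact: (exprn_ge0 _ (ltW g0)).
have -> : 1 + n.+1%:R^-1 = n.+2%:R / n.+1%:R :> R by rewrite -[n.+2%:R]natr1; field.
apply: ler1_powR => //; rewrite ler_pdivlMr ?ltr0n// mul1r ler_nat//.
Unshelve. all: end_near. Qed.

End GammaFunction.

(** * Euler's beta integral over the half line *)

Section BetaIntegral.
Context {R : realType}.
Implicit Types (a b c p x y u t v : R).
Notation mu := (@lebesgue_measure R).
Notation Gam := (@gam R).

Lemma tonelli_set (D : set R) (h : R -> R -> R) : measurable D ->
  measurable_fun setT (fun z : R * R => h z.1 z.2) -> (forall x y, 0 <= h x y) ->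
  (\int[mu]_(x in D) \int[mu]_(y in D) (h x y)%:E =
   \int[mu]_(y in D) \int[mu]_(x in D) (h x y)%:E)%E.
Proof.
move=> mD mh h0.
pose k (z : measurableTypeR R * measurableTypeR R) : \bar R :=
  (\1_D z.1 * \1_D z.2 * h z.1 z.2)%:E.
have i0 x : (0 : R) <= \1_D x by rewrite indicE.
have k0 z : (0 <= k z)%E by rewrite lee_fin !mulr_ge0.
have m1 : measurable_fun setT (fun z : measurableTypeR R * measurableTypeR R => \1_D z.1 : R).
  by apply: (@measurableT_comp _ _ _ _ _ _ (\1_D : R -> R)) => //; exact: measurable_indic.
have m2 : measurable_fun setT (fun z : measurableTypeR R * measurableTypeR R => \1_D z.2 : R).
  by apply: (@measurableT_comp _ _ _ _ _ _ (\1_D : R -> R)) => //; exact: measurable_indic.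
have mk : measurable_fun setT k.
  apply/measurable_EFinP; apply: measurable_funM => //.
  by apply: measurable_funM.
have mhx x : measurable_fun setT (h x) := measurableT_comp mh (pair1_measurable x).
have mhy y : measurable_fun setT (h ^~ y) := measurableT_comp mh (pair2_measurable y).
have := @fubini_tonelli _ _ (measurableTypeR R) (measurableTypeR R) R mu mu k mk k0.
have E (g : R -> \bar R) : (\int[mu]_(x in D) g x = \int[mu]_x ((\1_D x)%:E * g x))%E.
  rewrite integral_mkcond epatch_indic; apply: eq_integral => x _ /=.
  by rewrite muleC.
have mD' : measurable (D : set (measurableTypeR R)) by [].
rewrite [X in X = _ -> _](_ : _ = (\int[mu]_(x in D) \int[mu]_(y in D) (h x y)%:E)%E); last first.
  rewrite E; apply: eq_integral => x _.
  rewrite E -ge0_integralZl_EFin//; last first.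
  - apply: emeasurable_funM; first by apply/measurable_EFinP; exact: measurable_indic.
    by apply/measurable_EFinP; exact: mhx.
  - by move=> y _; rewrite mule_ge0// lee_fin.
  by apply: eq_integral => y _; rewrite -!EFinM /k mulrA.
move=> ->; rewrite [RHS]E; apply: eq_integral => y _.
rewrite E -ge0_integralZl_EFin//; last first.
- apply: emeasurable_funM; first by apply/measurable_EFinP; exact: measurable_indic.
  by apply/measurable_EFinP; exact: mhy.
- by move=> x _; rewrite mule_ge0// lee_fin.
by apply: eq_integral => x _; rewrite -!EFinM /k mulrA [\1_D y * _]mulrC.
Qed.

Lemma ge0_integral_scale_0y (f : R -> \bar R) c : 0 < c ->
  measurable_fun (`]0, +oo[%classic : set R) f -> (forall x, 0 < x -> (0 <= f x)%E) ->
  (\int[mu]_(x in `]0%R, +oo[) f x =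
   c%:E * \int[mu]_(x in `]0%R, +oo[) f (c * x)%R)%E.
Proof.
move=> c0 mf f0.
rewrite (@ge0_integral_affine _ _ f c 0)//; last 2 first.
- by rewrite gt_eqF.
- by move=> x; rewrite /= in_itv/= andbT; exact: f0.
rewrite gtr0_norm//; congr (_ * _)%E.
have -> : (fun y => c * y + 0) @^-1` `]0, +oo[%classic = `]0, +oo[%classic :> set R.
  by apply/seteqP; split => x /=; rewrite !in_itv/= !andbT addr0 pmulr_rgt0.
by under eq_integral do rewrite addr0.
Qed.

(** The integral of t^(a+b-1) v^(b-1) exp(-t (1 + v)) over the quadrant is taken in both orders:
    rescaling v by t yields the product of two gammas, rescaling t by 1 + v yields Gam(a + b) times
    the beta integral. *)
Lemma Beta_integral a b : 0 < a -> 0 < b ->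
  (\int[mu]_(v in `]0%R, +oo[) (v `^ (b - 1) * (1 + v) `^ (- (a + b)))%:E =
   (Gam a * Gam b / Gam (a + b))%:E)%E.
Proof.
move=> a0 b0.
have ab0 : 0 < a + b by rewrite addr_gt0.
pose D : set R := `]0, +oo[%classic.
have mD : measurable D by exact: measurable_itv.
pose h t v := t `^ (a + b - 1) * (v `^ (b - 1) * expR (- (t * (1 + v)))).
have h0 t v : 0 <= h t v by rewrite !mulr_ge0 ?powR_ge0 ?expR_ge0.
have mh : measurable_fun setT (fun z : R * R => h z.1 z.2).
  apply: measurable_funM.
    by apply: (@measurableT_comp _ _ _ _ _ _ (fun x : R => x `^ (a + b - 1))) => //; exact: measurable_powR.
  apply: measurable_funM.
    by apply: (@measurableT_comp _ _ _ _ _ _ (fun x : R => x `^ (b - 1))) => //; exact: measurable_powR.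
  apply: (@measurableT_comp _ _ _ _ _ _ (@expR R)); first exact: measurable_expR.
  by apply: measurableT_comp => //; apply: measurable_funM => //; apply: measurable_funD.
have mscale c p : measurable_fun (`]0, +oo[%classic : set R)
    (fun x : R => ((c * x) `^ p * expR (- (c * x)))%:E).
  apply: measurable_funTS.
  apply: (@measurableT_comp _ _ _ _ _ _ (fun s : R => (s `^ p * expR (- s))%:E)).
    exact: measurable_gamma_integrand.
  by apply: measurable_funM.
have := tonelli_set mD mh h0.
have -> : (\int[mu]_(x in D) \int[mu]_(y in D) (h x y)%:E = eGamma a * eGamma b)%E.
  rewrite muleC /eGamma -/D -ge0_integralZl//; last 3 first.
  - exact: measurable_gamma_integrand.
  - by move=> x _; rewrite lee_fin gamma_integrand_ge0.
  - exact: eGamma_ge0.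
  apply: eq_integral => t; rewrite inE /D/= in_itv/= andbT => t0.
  rewrite -/(eGamma b) /eGamma (@ge0_integral_scale_0y _ t)//; last 2 first.
  - exact: measurable_gamma_integrand.
  - by move=> x _; rewrite lee_fin gamma_integrand_ge0.
  have tt : 0 <= t `^ (a - 1) * expR (- t) * t.
    by rewrite !mulr_ge0 ?powR_ge0 ?expR_ge0// ltW.
  rewrite muleC muleA -EFinM -(ge0_integralZl_EFin _ _ _ _ tt); last 3 first.
  - exact: measurable_itv.
  - by move=> x _; rewrite lee_fin gamma_integrand_ge0.
  - exact: mscale.
  apply: eq_integral => v; rewrite inE /D/= in_itv/= andbT => v0.
  rewrite -EFinM /h; congr EFin.
  rewrite powRM ?(ltW t0) ?(ltW v0)//.
  rewrite mulrDr mulr1 opprD expRD.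
  have -> : a + b - 1 = (a - 1) + (b - 1) + 1 by ring.
  rewrite 2?powRD ?(gt_eqF t0) ?implybT//.
  rewrite (powRr1 (ltW t0)).
  ring.
have -> : (\int[mu]_(y in D) \int[mu]_(x in D) (h x y)%:E =
  eGamma (a + b) * \int[mu]_(v in D) (v `^ (b - 1) * (1 + v) `^ (- (a + b)))%:E)%E.
  rewrite -ge0_integralZl//; last 3 first.
  - apply/measurable_EFinP; apply: measurable_funM; first by apply: measurable_funTS; exact: measurable_powR.
    apply: measurable_funTS; apply: (@measurableT_comp _ _ _ _ _ _ (fun x : R => x `^ (- (a + b)))); first exact: measurable_powR.
    by apply: measurable_funD.
  - by move=> x _; rewrite lee_fin mulr_ge0 ?powR_ge0.
  - exact: eGamma_ge0.
  apply: eq_integral => v; rewrite inE /D/= in_itv/= andbT => v0.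
  have v1 : 0 < 1 + v by rewrite addr_gt0.
  rewrite /eGamma (@ge0_integral_scale_0y _ (1 + v))//; last 2 first.
  - exact: measurable_gamma_integrand.
  - by move=> x _; rewrite lee_fin gamma_integrand_ge0.
  have vv : 0 <= v `^ (b - 1) * (1 + v) `^ (- (a + b)) * (1 + v).
    by rewrite !mulr_ge0 ?powR_ge0// ltW.
  rewrite muleC muleA -EFinM -(ge0_integralZl_EFin _ _ _ _ vv); last 3 first.
  - exact: measurable_itv.
  - by move=> x _; rewrite lee_fin gamma_integrand_ge0.
  - exact: mscale.
  apply: eq_integral => t; rewrite inE /D/= in_itv/= andbT => t0.
  rewrite -EFinM /h; congr EFin.
  rewrite powRM ?(ltW t0) ?(ltW v1)// [t * _]mulrC.
  have -> : - (a + b) = - (1 + (a + b - 1)) by ring.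
  by rewrite powRN_div// powRN; field; rewrite !gt_eqF ?powR_gt0.
rewrite !eGammaE//; case: (\int[mu]_(x in D) _)%E => [r||].
- rewrite -!EFinM => E; have {}E := EFin_inj E; congr EFin.
  by rewrite E mulrAC divff ?mul1r// gt_eqF// Gam_gt0.
- by rewrite gt0_muley// lte_fin Gam_gt0.
- by rewrite gt0_muleNy// lte_fin Gam_gt0.
Qed.

End BetaIntegral.

(** * Reflection formula for the gamma function *)
Section WallisCosine.
Context {R : realType}.
Implicit Types (a b c p x y u t v : R).
Notation mu := (@lebesgue_measure R).
Notation Gam := (@gam R).

Definition cosint a n : \bar R :=
  (\int[mu]_(x in `]0%R, (pi / 2)%R[) (cos (a * x) * cos x ^+ n)%:E)%E.

Lemma is_derive_cosM a x : is_derive x 1 (fun y => cos (a * y)) (- sin (a * x) * a).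
Proof.
have -> : - sin (a * x) * a = - sin (a * x) * (a * 1 + 0 * x) by ring.
exact: (isd_comp (is_derive_cos (a * x)) (isdM (isdC a x) (isdI x))).
Qed.

Lemma is_derive_sinM a x : is_derive x 1 (fun y => sin (a * y)) (cos (a * x) * a).
Proof.
have -> : cos (a * x) * a = cos (a * x) * (a * 1 + 0 * x) by ring.
exact: (isd_comp (is_derive_sin (a * x)) (isdM (isdC a x) (isdI x))).
Qed.

Lemma cosM_ge0 a x : 0 <= a <= 1 -> 0 < x < pi / 2 -> 0 <= cos (a * x).
Proof.
move=> /andP[a0 a1] /andP[x0 x1]; apply: cos_ge0_pihalf.
have h1 : 0 <= a * x by rewrite mulr_ge0// ltW.
have h2 : a * x <= x by rewrite ler_piMl// ltW.
by apply/andP; split; lra.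
Qed.

Lemma cos_pos x : 0 < x < pi / 2 -> 0 < cos x.
Proof.
by move=> /andP[x0 x1]; apply: cos_gt0_pihalf; apply/andP; split; lra.
Qed.

Lemma cont_cosint a n x : {for x, continuous (fun x => cos (a * x) * cos x ^+ n)}.
Proof.
apply: continuousM; first exact: isd_cont (is_derive_cosM a x).
exact: (isd_cont (isdX n (is_derive_cos x))).
Qed.

Lemma measurable_cosint a n (D : set R) :
  measurable_fun D (fun x => (cos (a * x) * cos x ^+ n)%:E).
Proof.
apply/measurable_EFinP; apply: measurable_funTS.
by apply: continuous_measurable_fun => x; exact: cont_cosint.
Qed.

Lemma cosint_ge0 a n : 0 <= a <= 1 -> (0 <= cosint a n)%E.
Proof.
move=> a01; apply: integral_ge0 => x; rewrite /= in_itv/= => xI.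
by rewrite lee_fin mulr_ge0 ?cosM_ge0// exprn_ge0// ltW// cos_pos.
Qed.

Let pihalf_gt0 : 0 < pi / 2 :> R. Proof. by rewrite divr_gt0// pi_gt0. Qed.

(** Two integrations by parts at once: the combined boundary function vanishes at 0 through its
    sines and at pi / 2 through its cosines. The bound a <= 1 keeps cos(a x) nonnegative on the
    interval. *)
Lemma cosint_rec a n : 0 <= a <= 1 ->
  ((n.+2%:R ^+ 2 - a ^+ 2)%:E * cosint a n.+2 =
   (n.+2%:R * n.+1%:R)%:E * cosint a n)%E.
Proof.
move=> a01; have /andP[a0 a1] := a01.
have c0 : 0 <= n.+2%:R ^+ 2 - a ^+ 2 :> R.
  rewrite subr_ge0 ler_pXn2r ?nnegrE// (le_trans a1)// ler1n//.
have c1 : 0 <= n.+2%:R * n.+1%:R :> R by [].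
rewrite /cosint -!ge0_integralZl_EFin//; last first.
- exact: measurable_cosint.
- by move=> x; rewrite /= in_itv/= => xI; rewrite lee_fin mulr_ge0 ?cosM_ge0// exprn_ge0// ltW// cos_pos.
- exact: measurable_cosint.
- by move=> x; rewrite /= in_itv/= => xI; rewrite lee_fin mulr_ge0 ?cosM_ge0// exprn_ge0// ltW// cos_pos.
rewrite -[LHS]adde0 -[RHS]adde0.
have dF x : is_derive x 1 (fun x => n.+2%:R * (cos (a * x) * cos x ^+ n.+1 * sin x)
   - a * (sin (a * x) * cos x ^+ n.+2))
   ((n.+2%:R ^+ 2 - a ^+ 2) * (cos (a * x) * cos x ^+ n.+2) -
    n.+2%:R * n.+1%:R * (cos (a * x) * cos x ^+ n)).
  have -> : ((n.+2%:R ^+ 2 - a ^+ 2) * (cos (a * x) * cos x ^+ n.+2) -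
    n.+2%:R * n.+1%:R * (cos (a * x) * cos x ^+ n)) =
   (n.+2%:R * (cos (a * x) * cos x ^+ n.+1 * cos x +
     (cos (a * x) * (n.+1%:R * cos x ^+ n * - sin x) +
      (- sin (a * x) * a) * cos x ^+ n.+1) * sin x) +
      0 * (cos (a * x) * cos x ^+ n.+1 * sin x))
   + - (a * (sin (a * x) * (n.+2%:R * cos x ^+ n.+1 * - sin x) +
       (cos (a * x) * a) * cos x ^+ n.+2) + 0 * (sin (a * x) * cos x ^+ n.+2)).
    have E := sin2cos2 x.
    have -> : n.+2%:R = n.+1%:R + 1 :> R by rewrite natr1.
    rewrite !exprS.
    apply/eqP; rewrite -subr_eq0; apply/eqP.
    transitivity (n.+1%:R * (n.+1%:R + 1) * cos (a * x) * cos x ^+ n * (sin x ^+ 2 - (1 - cos x ^+ 2))); first by ring.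
    by rewrite E subrr mulr0.
  have dX k := isdX k (is_derive_cos x).
  exact: (isdD (isdM (isdC _ x) (isdM (isdM (is_derive_cosM a x) (dX n.+1)) (is_derive_sin x)))
    (isdN (isdM (isdC a x) (isdM (is_derive_sinM a x) (dX n.+2))))).
apply: (@ge0_FTC_oo _ _ _ (fun x => n.+2%:R * (cos (a * x) * cos x ^+ n.+1 * sin x)
   - a * (sin (a * x) * cos x ^+ n.+2))) => //.
- by apply: (isd_cvg_right (dF 0)); rewrite sin0 !mulr0 sin0 mul0r mulr0 subr0.
- by apply: (isd_cvg_left (dF (pi / 2))); rewrite cos_pihalf !expr0n/= !(mulr0, mul0r) subr0.
- move=> x xI; rewrite mulr_ge0// mulr_ge0 ?cosM_ge0// exprn_ge0// ltW// cos_pos//.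
- move=> x xI; rewrite mulr_ge0// mulr_ge0 ?cosM_ge0// exprn_ge0// ltW// cos_pos//.
- by move=> x _; apply: continuousM; [exact: cst_continuous|exact: cont_cosint].
- by move=> x _; apply: continuousM; [exact: cst_continuous|exact: cont_cosint].
Qed.

Lemma cosint0 a : 0 < a <= 1 -> cosint a 0 = (sin (a * (pi / 2)) / a)%:E.
Proof.
move=> /andP[a0 a1]; rewrite /cosint.
under eq_integral do rewrite expr0 mulr1.
rewrite -[LHS]adde0.
have -> : (sin (a * (pi / 2)) / a)%:E =
  (\int[mu]_(x in `]0%R, (pi / 2)%R[) (0:R)%:E + (sin (a * (pi / 2)) / a)%:E)%E.
  by rewrite integral0 add0e.
have dF x : is_derive x 1 (fun x => a^-1 * sin (a * x)) (cos (a * x) - 0).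
  have -> : cos (a * x) - 0 = a^-1 * (cos (a * x) * a) + 0 * sin (a * x).
    by field; rewrite gt_eqF.
  exact: (isdM (isdC _ x) (is_derive_sinM a x)).
apply: (@ge0_FTC_oo _ _ _ (fun x => a^-1 * sin (a * x))) => //.
- by apply: (isd_cvg_right (dF 0)); rewrite mulr0 sin0 mulr0.
- by apply: (isd_cvg_left (dF (pi / 2))); rewrite mulrC.
- by move=> x xI; rewrite cosM_ge0// (ltW a0).
- by move=> x _; exact: isd_cont (is_derive_cosM a x).
- by move=> x _; exact: cst_continuous.
Qed.

Lemma cosint00 : cosint 0 0 = (pi / 2)%:E.
Proof.
rewrite /cosint.
under eq_integral do rewrite expr0 mulr1 mul0r cos0.
rewrite integral_cst//= lebesgue_measure_itv/= lte_fin pihalf_gt0.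
by rewrite -EFinD subr0 -EFinM mul1r.
Qed.

(** Partial products of sin(pi u) / (pi u). *)
Definition euler_prod u n : R := \prod_(k < n) (1 - u ^+ 2 / k.+1%:R ^+ 2).

Lemma cosint_fin a n : 0 <= a <= 1 -> cosint a n \is a fin_num.
Proof.
move=> a01; rewrite ge0_fin_numE ?cosint_ge0//.
apply: (@le_lt_trans _ _ (cosint 0 0)); last by rewrite cosint00 ltry.
apply: ge0_le_integral => //.
- by move=> x; rewrite /= in_itv/= => xI; rewrite lee_fin mulr_ge0 ?cosM_ge0// exprn_ge0// ltW// cos_pos.
- exact: measurable_cosint.
- exact: measurable_cosint.
move=> x; rewrite /= in_itv/= => xI; rewrite lee_fin mul0r cos0 expr0 mul1r.
have := cosM_ge0 a01 xI; have := cos_le1 (a * x) => h1 h2.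
apply: mulr_ile1 => //; first by rewrite exprn_ge0// ltW// cos_pos.
Qed.

Definition rcosint a n : R := fine (cosint a n).

Lemma rcosint_rec a n : 0 <= a <= 1 ->
  (n.+2%:R ^+ 2 - a ^+ 2) * rcosint a n.+2 = n.+2%:R * n.+1%:R * rcosint a n.
Proof.
move=> a01; apply: EFin_inj; rewrite /rcosint 2!EFinM !fineK ?cosint_fin//.
exact: cosint_rec.
Qed.

Lemma rcosint0_gt0 n : 0 < rcosint 0 (2 * n).
Proof.
elim: n => [|n IH]; first by rewrite muln0 /rcosint cosint00.
have -> : (2 * n.+1)%N = (2 * n).+2 by rewrite mulnS.
have := @rcosint_rec 0 (2 * n); rewrite lexx ler01 expr0n/= subr0 => /(_ isT) H.
have : 0 < (2 * n).+2%:R ^+ 2 * rcosint 0 (2 * n).+2.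
  by rewrite H mulr_gt0.
by rewrite pmulr_rgt0.
Qed.

(** Dividing the recursions for a = 2u and a = 0 over even indices yields one factor 1 - u^2/(n+1)^2
    per step. The start compares sin(pi u) / (2u) with pi / 2. *)
Lemma rcosint_prod u n : 0 < u <= 2^-1 ->
  rcosint (2 * u) (2 * n) * euler_prod u n * (pi * u) = rcosint 0 (2 * n) * sin (pi * u).
Proof.
move=> /andP[u0 u1].
have a01 : 0 < 2 * u <= 1 by apply/andP; split; lra.
elim: n => [|n IH].
  rewrite muln0 /rcosint cosint00 cosint0// /euler_prod big_ord0/= mulr1.
  have -> : 2 * u * (pi / 2) = pi * u by field.
  by field; rewrite gt_eqF.
have -> : (2 * n.+1)%N = (2 * n).+2 by rewrite mulnS.
have a01' : 0 <= 2 * u <= 1 by apply/andP; split; lra.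
have h1 := rcosint_rec (2 * n) a01'.
have := @rcosint_rec 0 (2 * n); rewrite lexx ler01 expr0n/= subr0 => /(_ isT) h2.
rewrite /euler_prod big_ord_recr/= -/(euler_prod u n).
have E : (2 * n).+2%:R = 2 * n.+1%:R :> R by rewrite -natrM mulnS.
have n0 : n.+1%:R != 0 :> R by [].
apply: (@mulfI _ ((2 * n).+2%:R ^+ 2)); first by rewrite expf_neq0.
transitivity (((2 * n).+2%:R ^+ 2 - (2 * u) ^+ 2) * rcosint (2 * u) (2 * n).+2 * euler_prod u n * (pi * u)).
  by rewrite E; field.
rewrite h1; transitivity ((2 * n).+2%:R ^+ 2 * rcosint 0 (2 * n).+2 * sin (pi * u)); last by ring.
by rewrite h2 -!mulrA -IH; ring.
Qed.

Lemma nondecr_of_derive (f df : R -> R) a b x y :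
  (forall z, a <= z <= b -> is_derive z 1 f (df z)) ->
  (forall z, a < z < b -> 0 <= df z) -> a <= x -> x <= y -> y <= b -> f x <= f y.
Proof.
move=> dF df0; apply: ger0_derive1_ndecr => [z|z|].
- by rewrite in_itv/= => /andP[az zb]; have [] := dF z; rewrite ?ltW.
- rewrite in_itv/= => /andP[az zb]; rewrite derive1E.
  by have [_ ->] := dF z (introT andP (conj (ltW az) (ltW zb))); rewrite df0 ?az.
- by apply: continuous_within_cc => z /dF; exact: isd_cont.
Qed.

Lemma xcos_le_sin x : 0 <= x <= pi / 2 -> x * cos x <= sin x.
Proof.
move=> /andP[x0 x1].
pose f y : R := sin y - y * cos y.
have df y : is_derive y 1 f (y * sin y).
  have -> : y * sin y = cos y + - (y * - sin y + 1 * cos y) by ring.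
  exact: (isdD (is_derive_sin y) (isdN (isdM (isdI y) (is_derive_cos y)))).
have h : f 0 <= f x.
  apply: (nondecr_of_derive (fun z _ => df z) _ (lexx 0) x0 x1) => z /andP[z0 z1].
  rewrite mulr_ge0// ?sin_ge0_pi ?(ltW z0)//=; apply: (le_trans (ltW z1)).
  by rewrite ler_piMr// ?pi_ge0// invf_le1// ler1n.
by move: h; rewrite /f sin0 mul0r subr0 subr_ge0.
Qed.

Lemma one_sub_cos_le y : 0 <= y -> 1 - cos y <= y ^+ 2 / 2.
Proof.
move=> y0.
have sinx (z : R) : 0 <= z -> sin z <= z.
  move=> z0; pose g (t : R) : R := t - sin t.
  have dg t : is_derive t 1 g (1 - cos t).
    exact: (isdD (isdI t) (isdN (is_derive_sin t))).
  have h : g 0 <= g z.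
    apply: (nondecr_of_derive (fun t _ => dg t) _ (lexx 0) z0 (lexx z)) => t _.
    by rewrite subr_ge0 cos_le1.
  by move: h; rewrite /g sin0 subr0 subr_ge0.
pose f (t : R) : R := t * t * 2^-1 + cos t.
have df t : is_derive t 1 f (t - sin t).
  have -> : t - sin t = (t * t * 0 + (t * 1 + 1 * t) * 2^-1) + - sin t by field.
  exact: (isdD (isdM (isdM (isdI t) (isdI t)) (isdC _ t)) (is_derive_cos t)).
have h : f 0 <= f y.
  apply: (nondecr_of_derive (fun t _ => df t) _ (lexx 0) y0 (lexx y)) => t /andP[t0 _].
  by rewrite subr_ge0 sinx// ltW.
by move: h; rewrite /f cos0 !mul0r add0r expr2; lra.
Qed.

(** Pointwise (1 - cos(a x)) cos(x)^2 <= a^2/2 (x cos x)^2 <= a^2/2 sin(x)^2, since x cos x <= sin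
    x. Multiplied by cos(x)^n and integrated, this bounds the defect of [rcosint a] from [rcosint 0]
    at n + 2 by a multiple of the drop of the Wallis integral from n to n + 2. *)
Lemma cosint_close a n : 0 <= a <= 1 ->
  (1 + a ^+ 2 / 2) * rcosint 0 n.+2 <= rcosint a n.+2 + a ^+ 2 / 2 * rcosint 0 n.
Proof.
move=> a01; have /andP[a0 a1] := a01.
have c0 : 0 <= 1 + a ^+ 2 / 2 by rewrite addr_ge0// divr_ge0// sqr_ge0.
have c1 : 0 <= a ^+ 2 / 2 by rewrite divr_ge0// sqr_ge0.
have z01 : 0 <= (0 : R) <= 1 by rewrite lexx ler01.
rewrite -lee_fin EFinD !EFinM /rcosint !fineK ?cosint_fin//.
have ge0 k b x : 0 <= b <= 1 -> 0 < x < pi / 2 -> 0 <= cos (b * x) * cos x ^+ k.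
  by move=> b01 xI; rewrite mulr_ge0 ?cosM_ge0// exprn_ge0// ltW// cos_pos.
have ge0' k b (x : R) : 0 <= b <= 1 -> `]0, (pi / 2)[%classic x -> (0 <= (cos (b * x) * cos x ^+ k)%:E)%E.
  by move=> b01; rewrite /= in_itv/= => xI; rewrite lee_fin ge0.
rewrite /cosint -(ge0_integralZl_EFin _ _ _ _ c0); last 3 first.
- exact: measurable_itv.
- by move=> x xI; exact: ge0'.
- exact: measurable_cosint.
rewrite -(ge0_integralZl_EFin _ _ _ _ c1); last 3 first.
- exact: measurable_itv.
- by move=> x xI; exact: ge0'.
- exact: measurable_cosint.
rewrite -ge0_integralD//; last 4 first.
- by move=> x xI; exact: ge0'.
- exact: measurable_cosint.
- by move=> x xI; rewrite mule_ge0//; exact: ge0'.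
- by apply: emeasurable_funM => //; exact: measurable_cosint.
apply: ge0_le_integral => //.
- by move=> x xI; rewrite mule_ge0//; exact: ge0'.
- by apply: emeasurable_funM => //; exact: measurable_cosint.
- apply: emeasurable_funD; first exact: measurable_cosint.
  by apply: emeasurable_funM => //; exact: measurable_cosint.
move=> x; rewrite /= in_itv/= => xI; have /andP[x0 x1] := xI.
rewrite -!EFinM -EFinD lee_fin mul0r cos0 !mul1r.
have k0 : 0 <= cos x ^+ n by rewrite exprn_ge0// ltW// cos_pos.
have h1 := one_sub_cos_le (mulr_ge0 a0 (ltW x0)).
have h2 : (x * cos x) ^+ 2 <= sin x ^+ 2.
  rewrite ler_pXn2r ?nnegrE//.
  - by apply: xcos_le_sin; rewrite !ltW.
  - by rewrite mulr_ge0 ?(ltW x0)// ltW// cos_pos.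
  - by rewrite sin_ge0_pi// (ltW x0)/= (le_trans (ltW x1))// ler_piMr// ?pi_ge0// invf_le1// ler1n.
have h3 : (1 - cos (a * x)) * cos x ^+ 2 <= a ^+ 2 / 2 * (1 - cos x ^+ 2).
  rewrite -sin2cos2; apply: (@le_trans _ _ ((a * x) ^+ 2 / 2 * cos x ^+ 2)).
    by rewrite ler_wpM2r ?sqr_ge0.
  have -> : (a * x) ^+ 2 / 2 * cos x ^+ 2 = a ^+ 2 / 2 * (x * cos x) ^+ 2 by ring.
  by rewrite ler_wpM2l.
rewrite [cos x ^+ n.+2]exprS [cos x ^+ n.+1]exprS -subr_ge0.
have -> : cos (a * x) * (cos x * (cos x * cos x ^+ n)) + a ^+ 2 / 2 * cos x ^+ n -
  (1 + a ^+ 2 / 2) * (cos x * (cos x * cos x ^+ n)) =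
  cos x ^+ n * (a ^+ 2 / 2 * (1 - cos x ^+ 2) - (1 - cos (a * x)) * cos x ^+ 2) by ring.
by rewrite mulr_ge0// subr_ge0.
Qed.

Lemma cosint_le a n : 0 <= a <= 1 -> rcosint a n <= rcosint 0 n.
Proof.
move=> a01; have z01 : 0 <= (0 : R) <= 1 by rewrite lexx ler01.
rewrite -lee_fin /rcosint !fineK ?cosint_fin//; apply: ge0_le_integral => //.
- by move=> x; rewrite /= in_itv/= => xI; rewrite lee_fin mulr_ge0 ?cosM_ge0// exprn_ge0// ltW// cos_pos.
- exact: measurable_cosint.
- exact: measurable_cosint.
move=> x; rewrite /= in_itv/= => xI; rewrite lee_fin mul0r cos0 ler_wpM2r ?cos_le1//.
by rewrite exprn_ge0// ltW// cos_pos.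
Qed.

Lemma cosint_ratio_cvg a : 0 <= a <= 1 ->
  rcosint a (2 * n.+1) / rcosint 0 (2 * n.+1) @[n --> \oo] --> (1 : R).
Proof.
move=> a01; have /andP[a0 a1] := a01.
apply: (@squeeze_cvgr _ _ _ _ (fun n => 1 - a ^+ 2 / 2 * n.+1%:R^-1) (fun=> 1)); last 2 first.
- rewrite -[X in _ --> X]subr0; apply: cvgB; first exact: cvg_cst.
  rewrite -[X in _ --> X](mulr0 (a ^+ 2 / 2)); apply: cvgMr; exact: cvg_harmonic.
- exact: cvg_cst.
near=> n; have p0 := rcosint0_gt0 n.+1; have p1 := rcosint0_gt0 n.
rewrite ler_pdivlMr// ler_pdivrMr// mul1r cosint_le// andbT.
have h1 := cosint_close (2 * n) a01.
have h2 := @rcosint_rec 0 (2 * n); move: h2; rewrite lexx ler01 expr0n/= subr0 => /(_ isT).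
have E : (2 * n.+1)%N = (2 * n).+2 by rewrite mulnS.
move: p0; rewrite E => p0 h2.
set X := rcosint 0 (2 * n).+2 in h1 h2 p0 *; set Y := rcosint 0 (2 * n) in h1 h2 p1 *.
have N1 : (0:R) < (2 * n).+1%:R by [].
have N2 : (0:R) < (2 * n).+2%:R by [].
(* The Wallis recursion (2n+2) X = (2n+1) Y turns the drop into a fraction 1/(2n+1) of X, so the
   relative defect is O(1/n). *)
have YX : Y - X = X / (2 * n).+1%:R.
  have : (2 * n).+2%:R * X = (2 * n).+1%:R * Y.
    by apply: (@mulfI _ (2 * n).+2%:R); [rewrite gt_eqF|rewrite mulrA -expr2 h2 mulrA].
  have -> : (2 * n).+2%:R = (2 * n).+1%:R + 1 :> R by rewrite natr1.
  move=> H; apply: (@mulfI _ (2 * n).+1%:R); first by rewrite gt_eqF.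
  rewrite mulrBr -H mulrDl mul1r [X in X - _]addrC addrK mulrCA divff ?mulr1// gt_eqF//.
have h3 : X / (2 * n).+1%:R <= X / n.+1%:R.
  by rewrite ler_pM2l// lef_pV2 ?posrE// ler_nat ltnS leq_pmull.
have c1 : 0 <= a ^+ 2 / 2 by rewrite divr_ge0// sqr_ge0.
have h4 : a ^+ 2 / 2 * (Y - X) <= a ^+ 2 / 2 * (X / n.+1%:R) by rewrite ler_wpM2l// YX.
have -> : (1 - a ^+ 2 / 2 / n.+1%:R) * X = X - a ^+ 2 / 2 * (X / n.+1%:R) by ring.
by move: h1 h4; move: (X / n.+1%:R) => Z; lra.
Unshelve. all: end_near. Qed.

(** [rcosint_prod] divided by a ratio of cosine integrals that tends to 1. *)
Lemma sin_euler_product u : 0 < u <= 2^-1 ->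
  euler_prod u n.+1 * (pi * u) @[n --> \oo] --> sin (pi * u).
Proof.
move=> uI; have /andP[u0 u1] := uI.
have a01 : 0 <= 2 * u <= 1 by apply/andP; split; lra.
have : (rcosint (2 * u) (2 * n.+1) / rcosint 0 (2 * n.+1))^-1 * sin (pi * u) @[n --> \oo] --> 1^-1 * sin (pi * u).
  by apply: cvgMl; apply: cvgV; [rewrite oner_eq0|exact: cosint_ratio_cvg].
rewrite invr1 mul1r; apply: cvg_trans; apply: near_eq_cvg.
have := cosint_ratio_cvg a01 => /(cvgr_gt 1)/(_ 0 ltr01) H.
near=> n; have p0 := rcosint0_gt0 n.+1.
have q0 : 0 < rcosint (2 * u) (2 * n.+1).
  have : 0 < rcosint (2 * u) (2 * n.+1) / rcosint 0 (2 * n.+1) by near: n.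
  by rewrite pmulr_lgt0// invr_gt0.
rewrite invf_div mulrAC -(rcosint_prod _ uI); field.
by rewrite gt_eqF.
Unshelve. all: end_near. Qed.

(** Each step contributes (n+1+u)(n+1-u): a factor of the product times (n+1)^2, and the squares
    build up the squared factorial. *)
Lemma Gam_euler_prod u n : 0 < u < 1 ->
  Gam (n.+1%:R + u) * Gam (n.+1%:R - u) =
  Gam (1 + u) * Gam (1 - u) * euler_prod u n * Gam n.+1%:R ^+ 2.
Proof.
move=> /andP[u0 u1]; elim: n => [|n IH].
  by rewrite /euler_prod big_ord0 Gam1 expr1n !mulr1.
have n0 : (0 : R) < n.+1%:R by [].
have h1 : 0 < n.+1%:R + u by rewrite addr_gt0.
have h2 : 0 < n.+1%:R - u by rewrite subr_gt0 (lt_le_trans u1)// ler1n.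
have -> : n.+2%:R + u = (n.+1%:R + u) + 1 by rewrite -natr1; ring.
have -> : n.+2%:R - u = (n.+1%:R - u) + 1 by rewrite -natr1; ring.
rewrite (GamS h1) (GamS h2) -[in RHS]natr1 (GamS n0).
rewrite /euler_prod big_ord_recr/= -/(euler_prod u n).
transitivity ((n.+1%:R + u) * (n.+1%:R - u) * (Gam (n.+1%:R + u) * Gam (n.+1%:R - u))).
  by ring.
by rewrite IH; field; rewrite gt_eqF.
Qed.

(** The ratio in [Gam_ratio_cvg] tends to 1; telescoped, it is Gam(1 + u) Gam(1 - u) times a partial
    sine product. Comparing the limits settles u <= 1/2, and the symmetry between u and 1 - u the
    rest. *)
Lemma Gam_reflection u : 0 < u < 1 -> Gam u * Gam (1 - u) * sin (pi * u) = pi.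
Proof.
have half v : 0 < v <= 2^-1 -> Gam v * Gam (1 - v) * sin (pi * v) = pi.
  move=> vI; have /andP[v0 v1] := vI.
  have v01 : 0 < v < 1 by apply/andP; split; lra.
  have v01' : 0 <= v <= 1 by apply/andP; split; lra.
  have h1 := Gam_ratio_cvg v01'.
  have h2 : (Gam (1 + v) * Gam (1 - v) * (euler_prod v n.+1 * (pi * v)) @[n --> \oo] -->
    Gam (1 + v) * Gam (1 - v) * sin (pi * v)).
    by apply: cvgMr; exact: sin_euler_product.
  have h3 : (Gam (1 + v) * Gam (1 - v) * (euler_prod v n.+1 * (pi * v)) @[n --> \oo] --> 1 * (pi * v)).
    have h4 : (Gam (n.+2%:R + v) * Gam (n.+2%:R - v) / Gam n.+2%:R ^+ 2 * (pi * v) @[n --> \oo] --> 1 * (pi * v)).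
      by apply: cvgMl; exact: h1.
    apply: cvg_trans h4; apply: near_eq_cvg; near=> n.
    rewrite (Gam_euler_prod n.+1 v01); field.
    by rewrite gt_eqF// Gam_gt0.
  have E : Gam (1 + v) * Gam (1 - v) * sin (pi * v) = 1 * (pi * v).
    exact: (cvg_unique _ h2 h3).
  have E2 : Gam (1 + v) = v * Gam v by rewrite addrC GamS.
  apply: (@mulfI _ v); first by rewrite gt_eqF.
  by rewrite [RHS]mulrC -[RHS]mul1r -E E2; ring.
move=> /andP[u0 u1]; have [uh|uh] := leP u 2^-1; first by apply: half; rewrite u0.
have := half (1 - u); rewrite subKr => /(_ _) H.
rewrite [Gam u * _]mulrC -[RHS]H; last by apply/andP; split; lra.
by congr (_ * _); rewrite mulrBr mulr1 -[RHS]opprK -sinN opprB sinB sinpi cospi; ring.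
Unshelve. all: end_near. Qed.

(* Both sides carry the value pi u (1 - 2 u) / sin (pi u); the form without
   division also covers u = 1/2. *)
Lemma Gam_cos_identity u : 0 < u < 1 ->
  (1 - 2 * u) * (Gam (1 - u) * Gam (1 + u)) =
  cos (pi * u) * (Gam (1 + 2 * u) * Gam (2 - 2 * u)).
Proof.
move=> uI; have /andP[u0 u1] := uI.
have R1 := Gam_reflection uI.
have E1 : Gam (1 + u) = u * Gam u by rewrite addrC GamS.
have s0 : sin (pi * u) != 0.
  rewrite gt_eqF// sin_gt0_pi// mulr_gt0 ?pi_gt0//=.
  by rewrite gtr_pMr ?pi_gt0.
have S2 : sin (pi * (2 * u)) = 2 * sin (pi * u) * cos (pi * u).
  have -> : pi * (2 * u) = (pi * u) + (pi * u) by ring.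
  by rewrite sinD; ring.
apply: (mulIf s0); rewrite E1.
have -> : (1 - 2 * u) * (Gam (1 - u) * (u * Gam u)) * sin (pi * u) =
  (1 - 2 * u) * u * pi by rewrite -[in RHS]R1; ring.
have [uh|uh|uh] := ltgtP u 2^-1.
- have u2 : 0 < 2 * u by rewrite mulr_gt0.
  have u3 : 0 < 1 - 2 * u by lra.
  have := @Gam_reflection (2 * u); rewrite u2 S2 => R2.
  have -> : Gam (1 + 2 * u) = 2 * u * Gam (2 * u) by rewrite addrC GamS.
  have -> : Gam (2 - 2 * u) = (1 - 2 * u) * Gam (1 - 2 * u).
    by rewrite -GamS//; congr gam; ring.
  rewrite -[in LHS]R2; first by ring.
  by rewrite -subr_gt0.
- have w0 : 0 < 2 * u - 1 by lra.
  have w1 : 2 * u - 1 < 1 by lra.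
  have := @Gam_reflection (2 * u - 1); rewrite w0 w1 => /(_ isT).
  have -> : sin (pi * (2 * u - 1)) = - (2 * sin (pi * u) * cos (pi * u)).
    by rewrite mulrBr mulr1 sinB sinpi cospi -S2; ring.
  have -> : 1 - (2 * u - 1) = 2 - 2 * u by ring.
  have -> : Gam (1 + 2 * u) = 2 * u * ((2 * u - 1) * Gam (2 * u - 1)).
    have w2 : 0 < 2 * u - 1 + 1 by rewrite subrK mulr_gt0.
    have -> : 1 + 2 * u = 2 * u - 1 + 1 + 1 by ring.
    by rewrite (GamS w2) (GamS w0) subrK.
  by move=> R2; rewrite -[in LHS]R2; ring.
- rewrite uh divff// subrr !mul0r cos_pihalf !mul0r//.
Qed.

End WallisCosine.

(** * Finite part of the two-center integral *)
Section FinitePart.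
Context {R : realType}.
Implicit Types (a b c p x y u t v s k : R).
Notation mu := (@lebesgue_measure R).
Notation Gam := (@gam R).

Lemma cntC a x : {for x, continuous (fun _ : R => a)}.
Proof. exact: cst_continuous. Qed.

Lemma cntI x : {for x, continuous (fun y : R => y)}.
Proof. by move=> ?; exact. Qed.

Lemma cntD (f g : R -> R) x : {for x, continuous f} -> {for x, continuous g} ->
  {for x, continuous (fun y => f y + g y)}.
Proof. by move=> cf cg; exact: continuousD. Qed.

Lemma cntN (f : R -> R) x : {for x, continuous f} -> {for x, continuous (fun y => - f y)}.
Proof. by move=> cf; exact: continuousN. Qed.

Lemma cntM (f g : R -> R) x : {for x, continuous f} -> {for x, continuous g} ->
  {for x, continuous (fun y => f y * g y)}.
Proof. by move=> cf cg; exact: continuousM. Qed.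

Lemma cntP (f : R -> R) p x : 0 < f x -> {for x, continuous f} ->
  {for x, continuous (fun y => f y `^ p)}.
Proof.
move=> f0 cf; apply: (@continuous_comp _ _ _ f (fun y => y `^ p)) => //.
exact: isd_cont (is_derive1_powR p f0).
Qed.

(** Midpoint convexity of x^-s by the arithmetic-geometric mean: the product of the two right-hand
    terms is (k^2 - t^2)^-s >= k^(-2s). *)
Lemma ge0_sum_powRN s k t : 0 <= s -> 0 <= t < k ->
  2 * k `^ (- s) <= (k + t) `^ (- s) + (k - t) `^ (- s).
Proof.
move=> s0 /andP[t0 tk]; have k0 : 0 < k by exact: le_lt_trans tk.
have h1 : 0 < k + t by rewrite ltr_wpDr.
have h2 : 0 < k - t by rewrite subr_gt0.
set a := (k + t) `^ _; set b := (k - t) `^ _.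
have a0 : 0 < a by exact: powR_gt0.
have b0 : 0 < b by exact: powR_gt0.
have ab : (k `^ (- s)) ^+ 2 <= a * b.
  rewrite /a /b -powRM ?(ltW h1) ?(ltW h2)// expr2 -powRM ?(ltW k0)// !powRN.
  rewrite lef_pV2 ?posrE ?powR_gt0 ?mulr_gt0//.
  apply: ge0_ler_powR => //; rewrite ?nnegrE ?mulr_ge0 ?(ltW h1) ?(ltW h2) ?(ltW k0)//.
  have -> : (k + t) * (k - t) = k * k - t ^+ 2 by ring.
  by rewrite gerBl sqr_ge0.
rewrite -(@ler_pXn2r _ 2%N) ?nnegrE ?mulr_ge0 ?powR_ge0 ?addr_ge0 ?(ltW a0) ?(ltW b0)//.
rewrite exprMn; apply: (@le_trans _ _ (2 ^+ 2 * (a * b))); first by rewrite ler_wpM2l.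
rewrite -subr_ge0; have -> : (a + b) ^+ 2 - 2 ^+ 2 * (a * b) = (a - b) ^+ 2 by ring.
exact: sqr_ge0.
Qed.

(* Cross terms of the squared lattice sum over t + Z: products of a term at x
   and a term at distance k on the same side (Fint) or on the opposite side
   (Gint), and the product of the singular term t^-s with the k-th pair of the
   excess (Nint). *)
Definition Fint s k : \bar R :=
  (\int[mu]_(x in `]2^-1%R, +oo[) (x `^ (- s) * (x + k) `^ (- s))%:E)%E.
Definition Gint s k : \bar R :=
  (\int[mu]_(x in `]2^-1%R, (k / 2)%R[) (x `^ (- s) * (k - x) `^ (- s))%:E)%E.
Definition Nint s k : \bar R :=
  (\int[mu]_(x in `]0%R, 2^-1%R[)
     (x `^ (- s) * ((k + x) `^ (- s) + (k - x) `^ (- s) - 2 * k `^ (- s)))%:E)%E.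

(* The same three integrals rescaled by k, with cutoff c = 1 / (2 k). *)
Definition F1 s c : \bar R :=
  (\int[mu]_(x in `]c, +oo[) (x `^ (- s) * (1 + x) `^ (- s))%:E)%E.
Definition G1 s c : \bar R :=
  (\int[mu]_(x in `]c, 2^-1%R[) (x `^ (- s) * (1 - x) `^ (- s))%:E)%E.
Definition N1 s c : \bar R :=
  (\int[mu]_(x in `]0%R, c[)
     (x `^ (- s) * ((1 + x) `^ (- s) + (1 - x) `^ (- s) - 2))%:E)%E.

Lemma measurable_powR_affine a b p (D : set R) :
  measurable_fun D (fun x : R => (a * x + b) `^ p).
Proof.
apply: measurable_funTS; apply: (@measurableT_comp _ _ _ _ _ _ (fun s : R => s `^ p)).
  exact: measurable_powR.
by apply: measurable_funD => //; apply: measurable_funM.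
Qed.

Lemma measurable_powR_shift k p (D : set R) :
  measurable_fun D (fun x : R => (k + x) `^ p).
Proof.
by under eq_fun do rewrite addrC -[X in X + k]mul1r; exact: measurable_powR_affine.
Qed.

Lemma measurable_powR_shiftr k p (D : set R) :
  measurable_fun D (fun x : R => (x + k) `^ p).
Proof.
by under eq_fun do rewrite -[X in X + k]mul1r; exact: measurable_powR_affine.
Qed.

Lemma measurable_powR_refl k p (D : set R) :
  measurable_fun D (fun x : R => (k - x) `^ p).
Proof.
by under eq_fun do rewrite addrC -mulN1r; exact: measurable_powR_affine.
Qed.

Lemma measurable_powRl p (D : set R) : measurable_fun D (fun x : R => x `^ p).
Proof. by apply: measurable_funTS; exact: measurable_powR. Qed.

Lemma n_integrand_ge0 s k x : 0 <= s -> 0 <= x < k ->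
  0 <= (k + x) `^ (- s) + (k - x) `^ (- s) - 2 * k `^ (- s).
Proof. by move=> s0 xk; rewrite subr_ge0 ge0_sum_powRN. Qed.

Lemma scale_kernel_int (D D' : set R) (f g : R -> R) k p :
  0 < k -> measurable D -> measurable_fun D f ->
  (forall x, D x -> 0 <= f x) -> (forall x, D' x -> 0 <= g x) ->
  (forall x, D (k * x) <-> D' x) -> measurable D' -> measurable_fun D' g ->
  (forall x, D' x -> f (k * x) = k `^ p * g x) ->
  (\int[mu]_(x in D) (f x)%:E = (k `^ (p + 1))%:E * \int[mu]_(x in D') (g x)%:E)%E.
Proof.
move=> k0 mD mf f0 g0 DD mD' mg fg.
rewrite (@ge0_integral_affine _ _ _ k 0)//; last 2 first.
- by rewrite gt_eqF.
- exact/measurable_EFinP.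
have -> : (fun y => k * y + 0) @^-1` D = D'.
  by apply/seteqP; split => x /=; rewrite addr0 DD.
rewrite gtr0_norm// addrC powRD; last by rewrite (gt_eqF k0) implybT.
rewrite (powRr1 (ltW k0)) EFinM -muleA; congr (_ * _)%E.
rewrite -ge0_integralZl_EFin//; last 2 first.
- exact/measurable_EFinP.
- exact: powR_ge0.
by apply: eq_integral => x; rewrite inE => xD; rewrite addr0 fg// EFinM.
Qed.

Lemma powR_mul_double k s : 0 < k -> k `^ (- s) * k `^ (- s) = k `^ (- (2 * s)).
Proof.
move=> k0; rewrite -powRD ?(gt_eqF k0) ?implybT//; congr powR; ring.
Qed.

Lemma Fint_scale s k : 0 < k ->
  Fint s k = ((k `^ (1 - 2 * s))%:E * F1 s (2 * k)^-1)%E.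
Proof.
move=> k0; have -> : 1 - 2 * s = - (2 * s) + 1 by ring.
apply: scale_kernel_int => //.
- by apply: measurable_funM; [exact: measurable_powRl|exact: measurable_powR_shiftr].
- by move=> x _; rewrite mulr_ge0 ?powR_ge0.
- by move=> x _; rewrite mulr_ge0 ?powR_ge0.
- by move=> x; rewrite /= !in_itv/= !andbT invfM -ltr_pdivrMl// mulrC.
- by apply: measurable_funM; [exact: measurable_powRl|exact: measurable_powR_shift].
move=> x; rewrite /= in_itv/= andbT => xc.
have x0 : 0 < x by apply: lt_trans xc; rewrite invr_gt0 mulr_gt0.
have -> : k * x + k = k * (1 + x) by ring.
rewrite !powRM ?(ltW k0) ?(ltW x0) ?addr_ge0 ?(ltW x0)// -powR_mul_double//; ring.
Qed.

Lemma Gint_scale s k : 0 < k ->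
  Gint s k = ((k `^ (1 - 2 * s))%:E * G1 s (2 * k)^-1)%E.
Proof.
move=> k0; have -> : 1 - 2 * s = - (2 * s) + 1 by ring.
apply: scale_kernel_int => //.
- by apply: measurable_funM; [exact: measurable_powRl|exact: measurable_powR_refl].
- by move=> x _; rewrite mulr_ge0 ?powR_ge0.
- by move=> x _; rewrite mulr_ge0 ?powR_ge0.
- by move=> x; rewrite /= !in_itv/= invfM -ltr_pdivrMl// ltr_pM2l// mulrC.
- by apply: measurable_funM; [exact: measurable_powRl|exact: measurable_powR_refl].
move=> x; rewrite /= in_itv/= => /andP[xc xh].
have x0 : 0 < x by apply: lt_trans xc; rewrite invr_gt0 mulr_gt0.
have -> : k - k * x = k * (1 - x) by ring.
rewrite !powRM ?(ltW k0) ?(ltW x0)//; first by rewrite -powR_mul_double//; ring.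
by rewrite subr_ge0 (le_trans (ltW xh))// invf_le1// ler1n.
Qed.

Lemma Nint_scale s k : 0 <= s -> 2^-1 < k ->
  Nint s k = ((k `^ (1 - 2 * s))%:E * N1 s (2 * k)^-1)%E.
Proof.
move=> s0 hk; have k0 : 0 < k by apply: lt_trans hk; rewrite invr_gt0.
have -> : 1 - 2 * s = - (2 * s) + 1 by ring.
have c1 : (2 * k)^-1 < 1 by rewrite invf_lt1 ?mulr_gt0// -ltr_pdivrMl// mulr1.
apply: scale_kernel_int => //.
- apply: measurable_funM; first exact: measurable_powRl.
  apply: measurable_funB => //; apply: measurable_funD; first exact: measurable_powR_shift.
  exact: measurable_powR_refl.
- move=> x; rewrite /= in_itv/= => /andP[x0 x1].
  by rewrite mulr_ge0 ?powR_ge0// n_integrand_ge0// (ltW x0) (lt_trans x1).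
- move=> x; rewrite /= in_itv/= => /andP[x0 x1].
  have := @n_integrand_ge0 s 1 x s0; rewrite powR1 mulr1 (ltW x0) (lt_trans x1 c1) => /(_ isT) h.
  by rewrite mulr_ge0 ?powR_ge0.
- by move=> x; rewrite /= !in_itv/= pmulr_rgt0// invfM -ltr_pdivlMl// mulrC.
- apply: measurable_funM; first exact: measurable_powRl.
  apply: measurable_funB => //; apply: measurable_funD; first exact: measurable_powR_shift.
  exact: measurable_powR_refl.
move=> x; rewrite /= in_itv/= => /andP[x0 x1].
have x2 : x < 1 by exact: lt_trans c1.
have -> : k - k * x = k * (1 - x) by ring.
have -> : k + k * x = k * (1 + x) by ring.
rewrite !powRM ?(ltW k0) ?(ltW x0) ?subr_ge0 ?(ltW x2) ?addr_ge0 ?(ltW x0)//.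
by rewrite -powR_mul_double//; ring.
Qed.

Let pN1 u x : 0 < x -> x `^ (- (1 + u)) = x `^ (- u) / x := @powRN_div R x u.

Lemma powRN2_div u x : 0 < x -> x `^ (- (2 + u)) = x `^ (- u) / x ^+ 2.
Proof.
move=> x0; have -> : - (2 + u) = - (1 + (1 + u)) by ring.
by rewrite !pN1// expr2 invfM mulrA.
Qed.

(* Derivatives of the boundary terms of the three integrations by parts; the
   exponent - (1 + u) is traded for - u. *)
Lemma isd_F_boundary u x : 0 < x ->
  is_derive x 1 (fun x => - (x `^ (- u) * (1 + x) `^ (- (1 + u))))
   (u * (x `^ (- (1 + u)) * (1 + x) `^ (- (1 + u))) +
    (1 + u) * (x `^ (- u) * (1 + x) `^ (- (2 + u)))).
Proof.
move=> x0; have x1 : 0 < 1 + x by rewrite addr_gt0.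
have -> : u * (x `^ (- (1 + u)) * (1 + x) `^ (- (1 + u))) +
    (1 + u) * (x `^ (- u) * (1 + x) `^ (- (2 + u))) =
  - (x `^ (- u) * (- (1 + u) * ((1 + x) `^ (- (1 + u)) / (1 + x)) * (0 + 1)) +
     (- u * (x `^ (- u) / x) * 1) * (1 + x) `^ (- (1 + u))).
  by rewrite powRN2_div// !pN1//; field; rewrite !gt_eqF.
exact: (isdN (isdM (isd_powR _ x0 (isdI x)) (isd_powR _ x1 (isdD (isdC 1 x) (isdI x))))).
Qed.

(** The factor 1 - 2x kills the boundary term at 1/2, and (1 - 2x)^2 = 1 - 4x(1 - x) reduces the
    derivative to two powers of x(1 - x). *)
Lemma isd_G_boundary u x : 0 < x < 1 ->
  is_derive x 1 (fun x => - ((x * (1 - x)) `^ (- u) * (1 - 2 * x)))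
   (u * (x `^ (- (1 + u)) * (1 - x) `^ (- (1 + u))) + 2 * (x * (1 - x)) `^ (- u)
    - 4 * u * (x * (1 - x)) `^ (- u)).
Proof.
move=> /andP[x0 x1]; have y0 : 0 < 1 - x by rewrite subr_gt0.
have p0 : 0 < x * (1 - x) by rewrite mulr_gt0.
have dp : is_derive x 1 (fun x => x * (1 - x)) (x * (0 - 1) + 1 * (1 - x)).
  exact: (isdM (isdI x) (isdD (isdC 1 x) (isdN (isdI x)))).
have dq : is_derive x 1 (fun x => 1 - 2 * x) (0 - (2 * 1 + 0 * x)).
  exact: (isdD (isdC 1 x) (isdN (isdM (isdC 2 x) (isdI x)))).
have -> : u * (x `^ (- (1 + u)) * (1 - x) `^ (- (1 + u))) + 2 * (x * (1 - x)) `^ (- u)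
    - 4 * u * (x * (1 - x)) `^ (- u) =
  - ((x * (1 - x)) `^ (- u) * (0 - (2 * 1 + 0 * x)) +
    (- u * ((x * (1 - x)) `^ (- u) / (x * (1 - x))) * (x * (0 - 1) + 1 * (1 - x))) * (1 - 2 * x)).
  rewrite -powRM ?(ltW x0) ?(ltW y0)// pN1//; field.
  by rewrite !gt_eqF.
exact: (isdN (isdM (@isd_powR _ (fun x => x * (1 - x)) x _ (- u) p0 dp) dq)).
Qed.

Lemma isd_quot_cvg0 (K : R -> R) (d : R) : is_derive (0 : R) 1 K d -> K 0 = 0 ->
  K x / x @[x --> 0^'+] --> d.
Proof.
move=> [dK <-] K0.
have : h^-1 *: (K (h *: 1 + 0) - K 0) @[h --> 0^'] --> 'D_1 K 0 by exact: dK.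
move=> H; have : h^-1 *: (K (h *: 1 + 0) - K 0) @[h --> 0^'+] --> 'D_1 K 0.
  exact: cvg_dnbhs_at_right H.
apply: cvg_trans; apply: near_eq_cvg; near=> x.
by rewrite K0 subr0 addr0 [x *: 1]mulr1 mulrC.
Unshelve. all: end_near. Qed.


(** The kernels left by the integrations by parts. For u < 1 both are integrable at 0, which the
    products of exponent 1 + u are not. *)
Definition Bker u x : R := x `^ (- u) * (1 + x) `^ (- (2 + u)).
Definition Pker u x : R := (x * (1 - x)) `^ (- u).

Lemma Bker_ge0 u x : 0 <= Bker u x.
Proof. by rewrite mulr_ge0 ?powR_ge0. Qed.

Lemma Pker_ge0 u x : 0 <= Pker u x. Proof. exact: powR_ge0. Qed.

Lemma cont_Pker u x : 0 < x < 1 -> {for x, continuous (Pker u)}.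
Proof.
move=> /andP[x0 x1]; apply: cntP; first by rewrite mulr_gt0// subr_gt0.
by apply: cntM; [exact: cntI|apply: cntD; [exact: cntC|apply: cntN; exact: cntI]].
Qed.

Lemma measurable_Bker u (D : set R) : measurable_fun D (fun x => (Bker u x)%:E).
Proof.
apply/measurable_EFinP; apply: measurable_funM; first exact: measurable_powRl.
exact: measurable_powR_shift.
Qed.

Lemma measurable_Pker u (D : set R) : measurable_fun D (fun x => (Pker u x)%:E).
Proof.
apply/measurable_EFinP; apply: measurable_funTS.
apply: (@measurableT_comp _ _ _ _ _ _ (fun s : R => s `^ (- u))).
  exact: measurable_powR.
by apply: measurable_funM => //; apply: measurable_funB.
Qed.

Definition Fker s x : R := x `^ (- s) * (1 + x) `^ (- s).
Definition Gker s x : R := x `^ (- s) * (1 - x) `^ (- s).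
Definition Nker s x : R := x `^ (- s) * ((1 + x) `^ (- s) + (1 - x) `^ (- s) - 2).

Lemma Fker_ge0 s x : 0 <= Fker s x. Proof. by rewrite mulr_ge0 ?powR_ge0. Qed.
Lemma Gker_ge0 s x : 0 <= Gker s x. Proof. by rewrite mulr_ge0 ?powR_ge0. Qed.
Lemma Nker_ge0 s x : 0 <= s -> 0 <= x < 1 -> 0 <= Nker s x.
Proof.
move=> s0 xI; rewrite mulr_ge0 ?powR_ge0//.
by have := @n_integrand_ge0 s 1 x s0 xI; rewrite powR1 mulr1.
Qed.

Lemma cont_1x x p : 0 < 1 + x -> {for x, continuous (fun x : R => (1 + x) `^ p)}.
Proof. by move=> x1; apply: cntP => //; apply: cntD; [exact: cntC|exact: cntI]. Qed.

Lemma cont_1Nx x p : x < 1 -> {for x, continuous (fun x : R => (1 - x) `^ p)}.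
Proof.
move=> x1; apply: cntP; first by rewrite subr_gt0.
by apply: cntD; [exact: cntC|apply: cntN; exact: cntI].
Qed.

Lemma cont_pow x p : 0 < x -> {for x, continuous (fun x : R => x `^ p)}.
Proof. by move=> x0; apply: cntP => //; exact: cntI. Qed.

Lemma cont_Bker u x : 0 < x -> {for x, continuous (Bker u)}.
Proof.
by move=> x0; apply: cntM; [exact: cont_pow|apply: cont_1x; rewrite addr_gt0].
Qed.

Lemma cont_Fker s x : 0 < x -> {for x, continuous (Fker s)}.
Proof.
by move=> x0; apply: cntM; [exact: cont_pow|apply: cont_1x; rewrite addr_gt0].
Qed.

Lemma cont_Gker s x : 0 < x < 1 -> {for x, continuous (Gker s)}.
Proof.
by move=> /andP[x0 x1]; apply: cntM; [exact: cont_pow|exact: cont_1Nx].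
Qed.

Lemma cont_Nker s x : 0 < x < 1 -> {for x, continuous (Nker s)}.
Proof.
move=> /andP[x0 x1]; apply: cntM; first exact: cont_pow.
apply: cntD; last by apply: cntN; exact: cntC.
by apply: cntD; [apply: cont_1x; rewrite addr_gt0|exact: cont_1Nx].
Qed.

Lemma measurable_Fker s (D : set R) : measurable_fun D (fun x => (Fker s x)%:E).
Proof.
apply/measurable_EFinP; apply: measurable_funM; first exact: measurable_powRl.
exact: measurable_powR_shift.
Qed.

Lemma measurable_Gker s (D : set R) : measurable_fun D (fun x => (Gker s x)%:E).
Proof.
apply/measurable_EFinP; apply: measurable_funM; first exact: measurable_powRl.
exact: measurable_powR_refl.
Qed.

Lemma measurable_Nker s (D : set R) : measurable_fun D (fun x => (Nker s x)%:E).
Proof.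
apply/measurable_EFinP; apply: measurable_funM; first exact: measurable_powRl.
apply: measurable_funB => //; apply: measurable_funD; first exact: measurable_powR_shift.
exact: measurable_powR_refl.
Qed.

Lemma ge0_integral_lin (D : set R) (f g : R -> R) a b : measurable D ->
  measurable_fun D (fun x => (f x)%:E) -> measurable_fun D (fun x => (g x)%:E) ->
  (forall x, D x -> 0 <= f x) -> (forall x, D x -> 0 <= g x) -> 0 <= a -> 0 <= b ->
  (\int[mu]_(x in D) (a * f x + b * g x)%:E =
   a%:E * \int[mu]_(x in D) (f x)%:E + b%:E * \int[mu]_(x in D) (g x)%:E)%E.
Proof.
move=> mD mf mg f0 g0 a0 b0.
under eq_integral do rewrite EFinD !EFinM.
rewrite ge0_integralD//; last 4 first.
- by move=> x Dx; rewrite mule_ge0// lee_fin ?f0.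
- by apply: emeasurable_funM.
- by move=> x Dx; rewrite mule_ge0// lee_fin ?g0.
- by apply: emeasurable_funM.
by rewrite !ge0_integralZl_EFin//.
Qed.

Lemma F1_by_parts u c : 0 < u -> 0 < c ->
  (u%:E * F1 (1 + u) c + (1 + u)%:E * \int[mu]_(x in `]c, +oo[) (Bker u x)%:E =
   (c `^ (- u) * (1 + c) `^ (- (1 + u)))%:E)%E.
Proof.
move=> u0 c0; have x0 (x : R) : c < x -> 0 < x by exact: lt_trans.
rewrite /F1 -ge0_integral_lin//; last 6 first.
- exact: measurable_Fker.
- exact: measurable_Bker.
- by move=> x _; exact: Fker_ge0.
- by move=> x _; exact: Bker_ge0.
- exact: ltW.
- by rewrite addr_ge0// ltW.
set w := c `^ _ * _.
have E : ((\int[mu]_(x in `]c, +oo[) (u * Fker (1 + u) x + (1 + u) * Bker u x)%:E + (- w)%:E)%E =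
  (\int[mu]_(x in `]c, +oo[) (0 : R)%:E + 0%:E)%E).
  apply: (@ge0_FTC_oy _ _ _ (fun x => - (x `^ (- u) * (1 + x) `^ (- (1 + u))))).
  - exact: isd_cvg_right (isd_F_boundary u c0) _.
  - rewrite -[X in _ --> X]oppr0; apply: cvgN.
    apply: (@squeeze_cvgr _ _ _ _ (fun=> 0) (fun x => x `^ (- u))); last 2 first.
    + exact: cvg_cst.
    + by apply: powR_cvgy0; rewrite oppr_lt0.
    near=> x; have y0 : 0 < x by near: x; exact: nbhs_pinfty_gt.
    rewrite mulr_ge0 ?powR_ge0//= ger_pMr ?powR_gt0//.
    rewrite -[leRHS](powRr0 (1 + x)); apply: ler_powR; first by rewrite lerDl ltW.
    by rewrite oppr_le0 addr_ge0// ltW.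
  - by move=> x _; rewrite addr_ge0// mulr_ge0 ?Fker_ge0 ?Bker_ge0 ?addr_ge0// ltW.
  - by [].
  - move=> x /x0 xp; apply: cntD; apply: cntM; [exact: cntC|exact: cont_Fker|exact: cntC|exact: cont_Bker].
  - by move=> x _; exact: cntC.
  - by move=> x /x0 xp; rewrite subr0; exact: isd_F_boundary.
move: E; rewrite integral0 adde0; case: integral => [r||]//.
by rewrite -EFinD => H; have {}H := EFin_inj H; congr EFin; lra.
Unshelve. all: end_near. Qed.

Lemma G1_by_parts u c : 0 < u -> 0 < c <= 2^-1 ->
  (u%:E * G1 (1 + u) c + 2%:E * \int[mu]_(x in `]c, 2^-1%R[) (Pker u x)%:E =
   (4 * u)%:E * \int[mu]_(x in `]c, 2^-1%R[) (Pker u x)%:E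
   + ((c * (1 - c)) `^ (- u) * (1 - 2 * c))%:E)%E.
Proof.
move=> u0 /andP[c0]; rewrite le_eqVlt => /orP[/eqP->|ch].
  (* The case c = 1/2, that is k = 1: the interval is empty and the boundary factor 1 - 2c is 0. *)
  rewrite /G1 set_itvoo0// !integral_set0 !mule0 !adde0.
  by rewrite divff// subrr mulr0 adde0.
have h1 : 2^-1 < 1 :> R by rewrite invf_lt1// ltr1n.
have x0 (x : R) : c < x < 2^-1 -> 0 < x < 1.
  by move=> /andP[x0 x1]; rewrite (lt_trans c0 x0) (lt_trans x1).
rewrite /G1 -ge0_integral_lin//; last 5 first.
- exact: measurable_Gker.
- exact: measurable_Pker.
- by move=> x _; exact: Gker_ge0.
- by move=> x _; exact: Pker_ge0.
- exact: ltW.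
rewrite -ge0_integralZl_EFin//; last 3 first.
- by move=> x _; rewrite lee_fin Pker_ge0.
- exact: measurable_Pker.
- by rewrite mulr_ge0// ltW.
set w := (c * (1 - c)) `^ (- u) * (1 - 2 * c).
have E : ((\int[mu]_(x in `]c, 2^-1%R[) (u * Gker (1 + u) x + 2 * Pker u x)%:E + (- w)%:E)%E =
  (\int[mu]_(x in `]c, 2^-1%R[) (4 * u * Pker u x)%:E + 0%:E)%E).
  apply: (@ge0_FTC_oo _ _ _ (fun x => - ((x * (1 - x)) `^ (- u) * (1 - 2 * x)))) => //.
  - by apply: (isd_cvg_right (isd_G_boundary u _) erefl); rewrite c0 (lt_trans ch).
  - apply: (isd_cvg_left (isd_G_boundary u _)); first by rewrite invr_gt0 h1 ltr0n.
    by rewrite divff// subrr mulr0 oppr0.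
  - by move=> x _; rewrite addr_ge0// mulr_ge0 ?Gker_ge0 ?Pker_ge0// ltW.
  - by move=> x _; rewrite !mulr_ge0 ?Pker_ge0// ltW.
  - move=> x /x0 xp; apply: cntD; apply: cntM; [exact: cntC|exact: cont_Gker|exact: cntC|exact: cont_Pker].
  - by move=> x /x0 xp; apply: cntM; [exact: cntC|exact: cont_Pker].
  - by move=> x /x0 xp; exact: isd_G_boundary.
move: E; rewrite adde0 => <-; rewrite -addeA -EFinD addNr adde0//.
Qed.

Lemma N1_by_parts u c : 0 < u < 1 -> 0 < c <= 2^-1 ->
  (u%:E * N1 (1 + u) c + (1 + u)%:E * \int[mu]_(x in `]0%R, c[) (Bker u x)%:E
     + 2%:E * \int[mu]_(x in `]0%R, c[) (Pker u x)%:E =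
   (4 * u)%:E * \int[mu]_(x in `]0%R, c[) (Pker u x)%:E
   + (2 * c `^ (- u) - c `^ (- u) * (1 + c) `^ (- (1 + u))
      - (c * (1 - c)) `^ (- u) * (1 - 2 * c))%:E)%E.
Proof.
move=> /andP[u0 u1] /andP[c0 ch].
have c1 : c < 1 by rewrite (le_lt_trans ch)// invf_lt1// ltr1n.
have x0 (x : R) : 0 < x < c -> 0 < x < 1.
  by move=> /andP[-> x1]; rewrite (lt_trans x1).
have u10 : 0 <= 1 + u by rewrite addr_ge0// ltW.
rewrite /N1 -ge0_integral_lin//; last 5 first.
- exact: measurable_Nker.
- exact: measurable_Bker.
- by move=> x; rewrite /= in_itv/= => /x0 /andP[/ltW y0 y1]; rewrite Nker_ge0 ?y0.
- by move=> x _; exact: Bker_ge0.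
- exact: ltW.
have mNB : measurable_fun `]0, c[ (fun x => (u * Nker (1 + u) x + (1 + u) * Bker u x)%:E).
  apply/measurable_EFinP; apply: measurable_funD; apply: measurable_funM => //.
    by have /measurable_EFinP := @measurable_Nker (1 + u) `]0, c[.
  by have /measurable_EFinP := @measurable_Bker u `]0, c[.
have NB0 x : 0 < x < c -> 0 <= u * Nker (1 + u) x + (1 + u) * Bker u x.
  move=> /x0 /andP[/ltW y0 y1].
  by rewrite addr_ge0// mulr_ge0 ?Bker_ge0 ?Nker_ge0 ?y0// ltW.
rewrite -[X in (X + 2%:E * _)%E]mul1e -ge0_integral_lin//; last 2 first.
- exact: measurable_Pker.
- by move=> x _; exact: Pker_ge0.
rewrite -ge0_integralZl_EFin//; last 3 first.
- by move=> x _; rewrite lee_fin Pker_ge0.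
- exact: measurable_Pker.
- by rewrite mulr_ge0// ltW.
pose W x := 2 * x `^ (- u) - x `^ (- u) * (1 + x) `^ (- (1 + u))
      - (x * (1 - x)) `^ (- u) * (1 - 2 * x).
rewrite -/(W c) -[LHS]adde0.
have dW x : 0 < x < 1 -> is_derive x 1 W
  (1 * (u * Nker (1 + u) x + (1 + u) * Bker u x) + 2 * Pker u x - 4 * u * Pker u x).
  move=> xI; have /andP[y0 y1] := xI.
  have -> : 1 * (u * Nker (1 + u) x + (1 + u) * Bker u x) + 2 * Pker u x - 4 * u * Pker u x =
    (2 * (- u * (x `^ (- u) / x) * 1) + 0 * x `^ (- u)) +
    (u * (x `^ (- (1 + u)) * (1 + x) `^ (- (1 + u))) +
    (1 + u) * (x `^ (- u) * (1 + x) `^ (- (2 + u)))) +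
    (u * (x `^ (- (1 + u)) * (1 - x) `^ (- (1 + u))) + 2 * (x * (1 - x)) `^ (- u)
    - 4 * u * (x * (1 - x)) `^ (- u)).
    by rewrite /Nker /Bker /Pker [x `^ (- (1 + u))]pN1//; ring.
  exact: (isdD (isdD (isdM (isdC 2 x) (isd_powR _ y0 (isdI x))) (isd_F_boundary u y0)) (isd_G_boundary u xI)).
apply: (@ge0_FTC_oo _ _ _ W) => //.
(* Each of the three terms of [W] diverges like x^-u at 0, but together W(x) = x^(1 - u) (K(x) / x),
   where K(0) = 0 and K is differentiable at 0; as u < 1 the limit is 0. *)
- pose K x := 2 - (1 + x) `^ (- (1 + u)) - (1 - x) `^ (- u) * (1 - 2 * x).
  have [d dK] : exists d, is_derive (0 : R) 1 K d.
    have z1 : 0 < 1 + 0 :> R by rewrite addr0.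
    have z2 : 0 < 1 - 0 :> R by rewrite subr0.
    eexists.
    exact: (isdD (isdD (isdC 2 0) (isdN (@isd_powR _ (fun x => 1 + x) 0 _ (- (1 + u)) z1 (isdD (isdC 1 0) (isdI 0)))))
      (isdN (isdM (@isd_powR _ (fun x => 1 - x) 0 _ (- u) z2 (isdD (isdC 1 0) (isdN (isdI 0))))
        (isdD (isdC 1 0) (isdN (isdM (isdC 2 0) (isdI 0))))))).
  have K0 : K 0 = 0 by rewrite /K addr0 subr0 !powR1 mulr0 subr0; ring.
  have H := isd_quot_cvg0 dK K0.
  have H2 : x `^ (1 - u) * (K x / x) @[x --> 0^'+] --> 0 * d.
    by apply: cvgM => //; apply: powR_cvg0; rewrite subr_gt0.
  rewrite mul0r in H2; apply: cvg_trans H2; apply: near_eq_cvg; near=> x.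
  have y0 : 0 < x by near: x; exact: nbhs_right_gt.
  have y1 : x < 1 by near: x; exact: nbhs_right_lt.
  rewrite /W /K powRM ?(ltW y0) ?subr_ge0 ?(ltW y1)//.
  rewrite powRD; last by rewrite (gt_eqF y0) implybT.
  by rewrite powRr1 ?(ltW y0)//; field; rewrite gt_eqF.
- by apply: (isd_cvg_left (dW _ _)) => //; rewrite c0.
- by move=> x xI; rewrite addr_ge0 ?mul1r ?NB0// mulr_ge0 ?Pker_ge0.
- by move=> x _; rewrite !mulr_ge0 ?Pker_ge0// ltW.
- move=> x /x0 xp; have /andP[xp0 _] := xp.
  apply: cntD; last by apply: cntM; [exact: cntC|exact: cont_Pker].
  apply: cntM; first exact: cntC.
  by apply: cntD; apply: cntM; [exact: cntC|exact: cont_Nker|exact: cntC|exact: cont_Bker].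
- by move=> x /x0 xp; apply: cntM; [exact: cntC|exact: cont_Pker].
- by move=> x /x0; exact: dW.
Unshelve. all: end_near. Qed.

End FinitePart.

(** * Values of the two auxiliary beta integrals *)

Section BetaSymmetric.
Context {R : realType}.
Implicit Types (a b c p x y u t v s k : R).
Notation mu := (@lebesgue_measure R).
Notation Gam := (@gam R).

(** The substitution x = v / (1 + v), mapping (0, +oo) onto (0, 1), in a form whose derivative is a
    single power. *)
Let phi v : R := 1 - (1 + v) `^ (- 1).
Let dphi v : R := (1 + v) `^ (- 2).

Let is_derive_phi v : 0 < 1 + v -> is_derive v 1 phi (dphi v).
Proof.
move=> v1; have -> : dphi v = 0 + - (- 1 * ((1 + v) `^ (- 1) / (1 + v)) * (0 + 1)).
  rewrite /dphi; have -> : - 2 = - (1 + 1) :> R by ring.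
  by rewrite powRN_div//; ring.
exact: (isdD (isdC 1 v) (isdN (isd_powR _ v1 (isdD (isdC 1 v) (isdI v))))).
Qed.

Let derive1_phi v : 0 < 1 + v -> phi^`()%classic v = dphi v.
Proof. by move=> v1; rewrite derive1E; have [_ ->] := is_derive_phi v1. Qed.

Let cont_dphi v : 0 < 1 + v -> {for v, continuous phi^`()%classic}.
Proof.
move=> v1; suff : phi^`()%classic x @[x --> v] --> phi^`()%classic v by [].
rewrite (derive1_phi v1).
have H : dphi x @[x --> v] --> dphi v by exact: cont_1x.
apply: cvg_trans H; apply: near_eq_cvg; near=> x.
rewrite derive1_phi//; have : -1 < x.
  by near: x; apply: lt_nbhsr; rewrite -subr_gt0 opprK addrC.
by rewrite -subr_gt0 opprK addrC.
Unshelve. all: end_near. Qed.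

Let phiE v : 0 < 1 + v -> phi v = v / (1 + v).
Proof.
move=> v1; rewrite /phi powR_inv1 ?(ltW v1)//; field.
by rewrite gt_eqF.
Qed.

Definition Vker u v : R := v `^ (- u) * (1 + v) `^ (- (2 - 2 * u)).

Let cov u a b : 0 < a -> a < b ->
  (\int[mu]_(x in `[phi a, phi b]) (Pker u x)%:E = \int[mu]_(v in `[a, b]) (Vker u v)%:E)%E.
Proof.
move=> a0 ab; have pos v : a <= v -> 0 < 1 + v.
  by move=> av; rewrite addr_gt0// (lt_le_trans a0).
have b0 : 0 < b by exact: lt_trans ab.
have phi0 v : a <= v -> 0 < phi v < 1.
  move=> av; rewrite phiE ?pos// divr_gt0 ?pos ?(lt_le_trans a0)//=.
  by rewrite ltr_pdivrMr ?pos// mul1r ltrDr.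
rewrite integration_by_substitution_increasing ?(ltW ab)//.
- apply: eq_integral => v; rewrite inE/= in_itv/= => /andP[av vb].
  have v0 : 0 < v by exact: lt_le_trans av.
  have v1 := pos v av.
  congr EFin; rewrite /= /GRing.mul/= derive1_phi// phiE// /Pker /Vker /dphi.
  have -> : v / (1 + v) * (1 - v / (1 + v)) = v * (1 + v) `^ (- 2).
    have -> : - 2 = - (1 + 1) :> R by ring.
    by rewrite powRN_div// powR_inv1 ?(ltW v1)//; field; rewrite gt_eqF.
  rewrite powRM ?powR_ge0 ?(ltW v0)// -powRrM -mulrA -powRD; last by rewrite (gt_eqF v1) implybT.
  by congr (_ * _ `^ _); ring.
- move=> x y; rewrite !in_itv/= => /andP[ax _] /andP[ay _] xy.
  rewrite !phiE ?pos// ltr_pdivrMr ?pos// mulrAC ltr_pdivlMr ?pos//.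
  rewrite -subr_gt0; have -> : y * (1 + x) - x * (1 + y) = y - x by ring.
  by rewrite subr_gt0.
- by move=> v; rewrite in_itv/= => /andP[av _]; apply: cont_dphi; rewrite pos// ltW.
- apply/cvg_ex; exists (phi^`()%classic a); apply: cvg_at_right_filter.
  by apply: cont_dphi; rewrite pos.
- apply/cvg_ex; exists (phi^`()%classic b); apply: cvg_at_left_filter.
  by apply: cont_dphi; rewrite pos// ltW.
- split.
  + by move=> v; rewrite in_itv/= => /andP[/ltW/pos/is_derive_phi[]].
  + exact: (isd_cvg_right (is_derive_phi (pos _ (lexx a))) erefl).
  + exact: (isd_cvg_left (is_derive_phi (pos _ (ltW ab))) erefl).
- apply: continuous_within_cc => x /andP[x0 x1]; apply: cont_Pker.
  have /andP[h1 _] := phi0 a (lexx a); have /andP[_ h2] := phi0 b (ltW ab).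
  by rewrite (lt_le_trans h1)// (le_lt_trans x1).
Qed.

Lemma measurable_Vker u (D : set R) : measurable_fun D (fun x => (Vker u x)%:E).
Proof.
apply/measurable_EFinP; apply: measurable_funM; first exact: measurable_powRl.
exact: measurable_powR_shift.
Qed.

Lemma Pint_Vint u :
  (\int[mu]_(x in `]0%R, 1%R[) (Pker u x)%:E = \int[mu]_(v in `]0%R, +oo[) (Vker u v)%:E)%E.
Proof.
(* These ends have the simple images 1/(n+3) and 1 - 1/(n+3) under [phi]. *)
pose a n : R := n.+2%:R^-1; pose b n : R := n.+2%:R.
have a0 n : 0 < a n by rewrite invr_gt0.
have a1 n : a n < 1 by rewrite invf_lt1// ltr1n.
have b1 n : 1 < b n by rewrite ltr1n.
have ab n : a n < b n by exact: lt_trans (b1 n).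
have b0 n : 0 < b n by rewrite (lt_trans _ (b1 n)).
have na m n : (m <= n)%N -> a n <= a m.
  by move=> mn; rewrite /a lef_pV2 ?posrE// ler_nat !ltnS.
have nb m n : (m <= n)%N -> b m <= b n.
  by move=> mn; rewrite /b ler_nat !ltnS.
have phia n : phi (a n) = n.+3%:R^-1.
  rewrite phiE ?addr_gt0// /a -[n.+3%:R]natr1; field.
  by rewrite !gt_eqF// !addr_gt0.
have phib n : phi (b n) = 1 - n.+3%:R^-1.
  rewrite phiE ?addr_gt0// /b -[n.+3%:R]natr1; field.
  by rewrite !gt_eqF// !addr_gt0.
have U1 : `]0, +oo[%classic = \bigcup_n `[a n, b n]%classic :> set R.
  apply/seteqP; split => [x|x [n _]]/=; rewrite !in_itv/= andbT; last first.
    by move=> /andP[h _]; exact: lt_le_trans h.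
  move=> x0; pose M := maxn (Num.truncn x) (Num.truncn x^-1).
  exists M => //=; rewrite in_itv/= /a /b -[X in _ <= X <= _]invrK lef_pV2 ?posrE ?invr_gt0//.
  have h1 : x < (Num.truncn x).+1%:R by exact: truncnS_gt.
  have h2 : x^-1 < (Num.truncn x^-1).+1%:R by exact: truncnS_gt.
  apply/andP; split.
    by apply: (le_trans (ltW h2)); rewrite ler_nat ltnS ltnW// ltnS leq_maxr.
  rewrite invrK; apply: (le_trans (ltW h1)).
  by rewrite ler_nat ltnS ltnW// ltnS leq_maxl.
have U2 : `]0, 1[%classic = \bigcup_n `[phi (a n), phi (b n)]%classic :> set R.
  apply/seteqP; split => [x|x [n _]]/=; rewrite !in_itv/=; last first.
    rewrite phia phib => /andP[h1 h2]; have h3 : 0 < n.+3%:R^-1 :> R by rewrite invr_gt0.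
    by move: (n.+3%:R^-1) h1 h2 h3 => w *; apply/andP; split; lra.
  move=> /andP[x0 x1]; have y0 : 0 < x / (1 - x) by rewrite divr_gt0// subr_gt0.
  have : `]0, +oo[%classic (x / (1 - x)) by rewrite /= in_itv/= andbT.
  rewrite U1 => -[n _]; rewrite /= in_itv/= => /andP[h1 h2]; exists n => //=.
  have z0 : 0 < 1 - x by rewrite subr_gt0.
  have xE : x = phi (x / (1 - x)).
    rewrite phiE ?addr_gt0//; field.
    by rewrite subrK oner_eq0 gt_eqF.
  have mono y z : 0 < y -> y <= z -> phi y <= phi z.
    move=> yp yz; have zp : 0 < z by exact: lt_le_trans yz.
    rewrite !phiE ?addr_gt0// ler_pdivrMr ?addr_gt0// mulrAC ler_pdivlMr ?addr_gt0//.
    rewrite -subr_ge0; have -> : z * (1 + y) - y * (1 + z) = z - y by ring.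
    by rewrite subr_ge0.
  by rewrite in_itv/= xE !mono.
have nphi m n : (m <= n)%N -> n.+3%:R^-1 <= m.+3%:R^-1 :> R.
  by move=> mn; rewrite lef_pV2 ?posrE// ler_nat !ltnS.
have l1 : (\int[mu]_(v in `[a n, b n]) (Vker u v)%:E @[n --> \oo] -->
   \int[mu]_(v in `]0%R, +oo[) (Vker u v)%:E)%E.
  rewrite U1; apply: ge0_nondecreasing_set_cvg_integral => //.
  - move=> n m nm; apply/subsetPset => x; rewrite /= !in_itv/= => /andP[ax xb].
    by rewrite (le_trans (na _ _ nm) ax) (le_trans xb (nb _ _ nm)).
  - by move=> n; exact: measurable_Vker.
  - by move=> n x _; rewrite lee_fin mulr_ge0 ?powR_ge0.
have l2 : (\int[mu]_(v in `[phi (a n), phi (b n)]) (Pker u v)%:E @[n --> \oo] -->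
   \int[mu]_(v in `]0%R, 1%R[) (Pker u v)%:E)%E.
  rewrite U2; apply: ge0_nondecreasing_set_cvg_integral => //.
  - move=> n m nm; apply/subsetPset => x; rewrite /= !in_itv/= !phia !phib => /andP[ax xb].
    have h := nphi _ _ nm.
    by move: (n.+3%:R^-1) (m.+3%:R^-1) ax xb h => w w' *; apply/andP; split; lra.
  - by move=> n; exact: measurable_Pker.
  - by move=> n x _; rewrite lee_fin Pker_ge0.
move: l2; under eq_fun do rewrite (cov _ (a0 _) (ab _)); move=> l2.
exact: (cvg_unique _ l2 l1).
Qed.

Lemma Pint_reflect u : (\int[mu]_(x in `]0%R, 1%R[) (Pker u x)%:E =
  2%:E * \int[mu]_(x in `]0%R, 2^-1%R[) (Pker u x)%:E)%E.
Proof.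
have h1 : 2^-1 < 1 :> R by rewrite invf_lt1// ltr1n.
have h0 : 0 < 2^-1 :> R by rewrite invr_gt0.
have -> : `]0, 1[%classic = `]0, 2^-1]%classic `|` `]2^-1, 1[%classic :> set R.
  by rewrite -itv_bndbnd_setU//= ?bnd_simp// ltW.
rewrite ge0_integral_setU//; last 3 first.
- exact: measurable_Pker.
- by move=> x _; rewrite lee_fin Pker_ge0.
- apply/disj_setPS => x [] /=; rewrite !in_itv/= => /andP[_ x1] /andP[x2 _].
  by move: (le_lt_trans x1 x2); rewrite ltxx.
have mP (D : set R) : measurable_fun D (Pker u).
  by have /measurable_EFinP := @measurable_Pker _ u D.
rewrite [X in (_ + X)%E](@ge0_integral_affine _ _ _ (-1) 1)//; last 2 first.
- exact: measurable_Pker.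
- by move=> x _; rewrite lee_fin Pker_ge0.
have -> : (fun y : R => -1 * y + 1) @^-1` `]2^-1, 1[%classic = `]0, 2^-1[%classic.
  apply/seteqP; split => x /=; rewrite !in_itv/= => /andP[x1 x2]; apply/andP; split; lra.
rewrite normrN1 mul1e.
have -> : (\int[mu]_(x in `]0%R, 2^-1%R[) (Pker u (-1 * x + 1))%:E =
  \int[mu]_(x in `]0%R, 2^-1%R[) (Pker u x)%:E)%E.
  apply: eq_integral => x _; congr EFin; rewrite /Pker; congr (_ `^ _); ring.
rewrite -integral_itv_bndo_bndc; last exact/measurable_EFinP.
by rewrite -[2%:E]/(2%:R%:E) mule_natl mule2n.
Qed.

Lemma Pint_beta u : 0 < u < 1 ->
  (2%:E * \int[mu]_(x in `]0%R, 2^-1%R[) (Pker u x)%:E =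
   (Gam (1 - u) ^+ 2 / Gam (2 - 2 * u))%:E)%E.
Proof.
move=> /andP[u0 u1]; rewrite -Pint_reflect Pint_Vint.
have v0 : 0 < 1 - u by rewrite subr_gt0.
have := Beta_integral v0 v0; rewrite -expr2.
have -> : 1 - u + (1 - u) = 2 - 2 * u by ring.
have -> : 1 - u - 1 = - u by ring.
by [].
Qed.

Lemma Bint_beta u : 0 < u < 1 ->
  ((1 + u)%:E * \int[mu]_(x in `]0%R, +oo[) (Bker u x)%:E =
   (Gam (1 + 2 * u) * Gam (1 - u) / Gam (1 + u))%:E)%E.
Proof.
move=> /andP[u0 u1].
have a0 : 0 < 1 + 2 * u by rewrite addr_gt0// mulr_gt0.
have b0 : 0 < 1 - u by rewrite subr_gt0.
have c0 : 0 < 1 + u by rewrite addr_gt0.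
have := Beta_integral a0 b0.
have -> : 1 + 2 * u + (1 - u) = 2 + u by ring.
have -> : 1 - u - 1 = - u by ring.
rewrite /Bker => ->; rewrite -EFinM; congr EFin.
have -> : 2 + u = 1 + u + 1 by ring.
by rewrite (GamS c0); field; rewrite !gt_eqF// Gam_gt0.
Qed.

End BetaSymmetric.

(** * Closed form of the sum of the three rescaled cross terms *)

Section FinitePartValue.
Context {R : realType}.
Implicit Types (a b c p x y u t v s k : R).
Notation mu := (@lebesgue_measure R).
Notation Gam := (@gam R).

(* The value of the finite part: half the regularized integral over the line of
   |x|^-s |x + 1|^-s with s = 1 + u.  At u = 1 it is 0 since 1 + cos pi = 0. *)
Definition fp_value u : R :=
  - (1 + cos (pi * u)) * (Gam (1 + 2 * u) * Gam (1 - u) / (u * Gam (1 + u))).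

Lemma integral_oo_split (f : R -> R) a c b : a < c -> c <= b ->
  measurable_fun (`]a, b[%classic : set R) f -> (forall x, a < x < b -> 0 <= f x) ->
  (\int[mu]_(x in `]a, b[) (f x)%:E =
   \int[mu]_(x in `]a, c[) (f x)%:E + \int[mu]_(x in `]c, b[) (f x)%:E)%E.
Proof.
move=> ac; rewrite le_eqVlt => /orP[/eqP <- _ _|cb mf f0].
  by rewrite (set_itvoo0 c) integral_set0 adde0.
have -> : `]a, b[%classic = `]a, c]%classic `|` `]c, b[%classic :> set R.
  by rewrite -itv_bndbnd_setU//= ?bnd_simp// ltW.
rewrite ge0_integral_setU//; last 3 first.
- rewrite -itv_bndbnd_setU//= ?bnd_simp ?(ltW ac) ?(ltW cb)//; exact/measurable_EFinP.
- move=> x; rewrite -itv_bndbnd_setU//= ?bnd_simp ?(ltW ac) ?(ltW cb)//.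
  by rewrite in_itv/= lee_fin; exact: f0.
- apply/disj_setPS => x [] /=; rewrite !in_itv/= => /andP[_ x1] /andP[x2 _].
  by move: (le_lt_trans x1 x2); rewrite ltxx.
rewrite -integral_itv_bndo_bndc//; apply/measurable_EFinP.
apply: measurable_funS mf => //.
by apply: subset_itvl; rewrite bnd_simp ltW.
Qed.

Lemma integral_oy_split (f : R -> R) a c : a < c ->
  measurable_fun (`]a, +oo[%classic : set R) f -> (forall x, a < x -> 0 <= f x) ->
  (\int[mu]_(x in `]a, +oo[) (f x)%:E =
   \int[mu]_(x in `]a, c[) (f x)%:E + \int[mu]_(x in `]c, +oo[) (f x)%:E)%E.
Proof.
move=> ac mf f0.
have -> : `]a, +oo[%classic = `]a, c]%classic `|` `]c, +oo[%classic :> set R.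
  by rewrite -itv_bndbnd_setU//= ?bnd_simp// ltW.
rewrite ge0_integral_setU//; last 3 first.
- rewrite -itv_bndbnd_setU//= ?bnd_simp ?(ltW ac)//; exact/measurable_EFinP.
- move=> x; rewrite -itv_bndbnd_setU//= ?bnd_simp ?(ltW ac)//.
  by rewrite in_itv/= andbT lee_fin; exact: f0.
- apply/disj_setPS => x [] /=; rewrite !in_itv/= => /andP[_ x1] /andP[x2 _].
  by move: (le_lt_trans x1 x2); rewrite ltxx.
rewrite -integral_itv_bndo_bndc//; apply/measurable_EFinP.
apply: measurable_funS mf => //.
by apply: subset_itvl; rewrite bnd_simp.
Qed.

(** Linear elimination over extended reals. The finite totals force the B and P parts to be finite,
    the three identities then force F, G and N to be finite, and what remains is real arithmetic. *)
Lemma ereal_combine (F G N B0 B1 P0 P1 : \bar R) u bet pp q1 q2 q3 :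
  0 < u ->
  (0 <= F)%E -> (0 <= G)%E -> (0 <= N)%E -> (0 <= B0)%E -> (0 <= B1)%E ->
  (0 <= P0)%E -> (0 <= P1)%E ->
  (u%:E * F + (1 + u)%:E * B1 = q1%:E)%E ->
  (u%:E * G + 2%:E * P1 = (4 * u)%:E * P1 + q2%:E)%E ->
  (u%:E * N + (1 + u)%:E * B0 + 2%:E * P0 = (4 * u)%:E * P0 + q3%:E)%E ->
  ((1 + u)%:E * (B0 + B1) = bet%:E)%E -> (2%:E * (P0 + P1) = pp%:E)%E ->
  (F + G + N = ((q1 + q2 + q3 - bet - (1 - 2 * u) * pp) / u)%:E)%E.
Proof.
move=> u0 F0 G0 N0 B00 B10 P00 P10 HF HG HN HB HP.
have u10 : 0 < 1 + u by rewrite addr_gt0.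
have finM r (e : \bar R) : 0 < r -> (0 <= e)%E -> (r%:E * e < +oo)%E -> e \is a fin_num.
  move=> r0; case: e => [e||]//; by rewrite gt0_muley ?lte_fin// ltxx.
have : (B0 + B1)%E \is a fin_num by apply: (finM (1 + u)) => //; [rewrite adde_ge0|rewrite HB ltry].
rewrite fin_numD => /andP[fB0 fB1].
have : (P0 + P1)%E \is a fin_num by apply: (finM 2) => //; [rewrite adde_ge0|rewrite HP ltry].
rewrite fin_numD => /andP[fP0 fP1].
move: HB HP HF HG HN; rewrite -(fineK fB0) -(fineK fB1) -(fineK fP0) -(fineK fP1).
move: (fine B0) (fine B1) (fine P0) (fine P1) => b0 b1 p0 p1.
rewrite -!EFinD -!EFinM => HB HP HF HG HN.
have fF : F \is a fin_num.
  apply: (finM u) => //; apply: (@le_lt_trans _ _ (u%:E * F + ((1 + u) * b1)%:E - ((1 + u) * b1)%:E)%E).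
    by rewrite addeK.
  by rewrite HF -EFinD ltry.
have fG : G \is a fin_num.
  apply: (finM u) => //; apply: (@le_lt_trans _ _ (u%:E * G + (2 * p1)%:E - (2 * p1)%:E)%E).
    by rewrite addeK.
  by rewrite HG -!EFinD ltry.
have fN : N \is a fin_num.
  apply: (finM u) => //; apply: (@le_lt_trans _ _ (u%:E * N + ((1 + u) * b0)%:E + (2 * p0)%:E - (2 * p0)%:E - ((1 + u) * b0)%:E)%E).
    by rewrite addeK// addeK.
  by rewrite HN -!EFinD ltry.
move: HF HG HN; rewrite -(fineK fF) -(fineK fG) -(fineK fN).
move: (fine F) (fine G) (fine N) => f g n; rewrite -!EFinM -!EFinD => HF HG HN.
have {}HB := EFin_inj HB; have {}HP := EFin_inj HP; have {}HF := EFin_inj HF.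
have {}HG := EFin_inj HG; have {}HN := EFin_inj HN.
congr EFin; apply: (@mulfI _ u); first by rewrite gt_eqF.
rewrite mulrCA divff ?mulr1 ?gt_eqF// -HB -HP.
by have := erefl (u * f); move: HF HG HN; rewrite !mulrDr; lra.
Qed.

(** The boundary terms of F and G at c cancel against those of N, leaving 2 c^-u. The beta integrals
    below and above c join into complete ones, so nothing else depends on c. [Gam_cos_identity]
    turns the second beta value into cos(pi u) times the first, whence the factor 1 + cos(pi u). *)
Lemma FGN_value_lt1 u c : 0 < u < 1 -> 0 < c <= 2^-1 ->
  (F1 (1 + u) c + G1 (1 + u) c + N1 (1 + u) c = (2 * c `^ (- u) / u + fp_value u)%:E)%E.
Proof.
move=> uI cI; have /andP[u0 u1] := uI; have /andP[c0 ch] := cI.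
have h1 : 2^-1 < 1 :> R by rewrite invf_lt1// ltr1n.
have ge0 (D : set R) (f : R -> R) : (forall x, D x -> 0 <= f x) -> (0 <= \int[mu]_(x in D) (f x)%:E)%E.
  by move=> f0; apply: integral_ge0 => x /f0; rewrite lee_fin.
have HB := Bint_beta uI.
rewrite (@integral_oy_split _ 0 c)// in HB; last 2 first.
- by have /measurable_EFinP := @measurable_Bker _ u (`]0, +oo[%classic : set R).
- by move=> x _; exact: Bker_ge0.
have HP := Pint_beta uI.
rewrite (@integral_oo_split _ 0 c)// in HP; last 2 first.
- by have /measurable_EFinP := @measurable_Pker _ u (`]0, 2^-1[%classic : set R).
- by move=> x _; exact: Pker_ge0.
rewrite (ereal_combine u0 _ _ _ _ _ _ _ (F1_by_parts u0 c0) (G1_by_parts u0 cI) (N1_by_parts uI cI) HB HP); last 7 first.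
- by apply: ge0 => x _; exact: Fker_ge0.
- by apply: ge0 => x _; exact: Gker_ge0.
- apply: ge0 => x; rewrite /= in_itv/= => /andP[x0 x1]; apply: Nker_ge0.
    by rewrite addr_ge0// ltW.
  by rewrite (ltW x0) (lt_trans x1)// (le_lt_trans ch).
- by apply: ge0 => x _; exact: Bker_ge0.
- by apply: ge0 => x _; exact: Bker_ge0.
- by apply: ge0 => x _; exact: Pker_ge0.
- by apply: ge0 => x _; exact: Pker_ge0.
congr EFin.
have g1 : Gam (1 + u) != 0 by rewrite gt_eqF// Gam_gt0// addr_gt0.
have g2 : Gam (2 - 2 * u) != 0.
  by rewrite gt_eqF// Gam_gt0// subr_gt0 gtr_pMr.
have -> : (1 - 2 * u) * (Gam (1 - u) ^+ 2 / Gam (2 - 2 * u)) =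
  cos (pi * u) * (Gam (1 + 2 * u) * Gam (1 - u) / Gam (1 + u)).
  transitivity ((1 - 2 * u) * (Gam (1 - u) * Gam (1 + u)) * Gam (1 - u) / Gam (2 - 2 * u) / Gam (1 + u)).
    by field; rewrite g1 g2.
  by rewrite Gam_cos_identity//; field; rewrite g1 g2.
rewrite /fp_value; field.
by rewrite g1 gt_eqF.
Qed.

Lemma FGN_value_1 c : 0 < c <= 2^-1 ->
  (F1 2 c + G1 2 c + N1 2 c = (2 * c `^ (- 1))%:E)%E.
Proof.
move=> /andP[c0 ch].
have h0 : 0 < 2^-1 :> R by rewrite invr_gt0.
have h1 : 2^-1 < 1 :> R by rewrite invf_lt1// ltr1n.
have c1 : c < 1 by rewrite (le_lt_trans ch).
have p2 x : 0 < x -> x `^ (- 2) = x^-1 ^+ 2.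
  by move=> x0; rewrite -[2%R]/(2%:R) powR_invn ?(ltW x0)// exprVn.
(* Partial fractions: [Q] and [S] are antiderivatives of x^-2 (1 + x)^-2 and x^-2 (1 - x)^-2. [Q]
   vanishes at infinity and [S] at 1/2. *)
pose Q x := - x^-1 - (1 + x)^-1 + 2 * (ln (1 + x) - ln x).
pose S x := - x^-1 + (1 - x)^-1 + 2 * (ln x - ln (1 - x)).
have dln (f : R -> R) x a : 0 < f x -> is_derive x 1 f a -> is_derive x 1 (fun y => ln (f y)) ((f x)^-1 * a).
  by move=> fx fa; exact: (isd_comp (is_derive1_ln fx) fa).
have dinv (f : R -> R) x a : 0 < f x -> is_derive x 1 f a -> is_derive x 1 (fun y => (f y)^-1) (- (f x)^-1 ^+ 2 * a).
  move=> fx fa; have := @is_deriveV _ f x a 1 (lt0r_neq0 fx) fa.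
  by rewrite exprVn.
have d1 x : is_derive x 1 (fun y : R => 1 + y) (0 + 1) by exact: (isdD (isdC 1 x) (isdI x)).
have d2 x : is_derive x 1 (fun y : R => 1 - y) (0 - 1) by exact: (isdD (isdC 1 x) (isdN (isdI x))).
have dQ x : 0 < x -> is_derive x 1 Q (Fker 2 x).
  move=> x0; have x1 : 0 < 1 + x by rewrite addr_gt0.
  have -> : Fker 2 x = - (- x^-1 ^+ 2 * 1) - (- (1 + x)^-1 ^+ 2 * (0 + 1)) +
    (2 * ((1 + x)^-1 * (0 + 1) - x^-1 * 1) + 0 * (ln (1 + x) - ln x)).
    by rewrite /Fker !p2//; field; rewrite !gt_eqF.
  exact: (isdD (isdD (isdN (dinv _ _ _ x0 (isdI x))) (isdN (dinv _ _ _ x1 (d1 x))))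
    (isdM (isdC 2 x) (isdD (dln _ _ _ x1 (d1 x)) (isdN (dln _ _ _ x0 (isdI x)))))).
have dS x : 0 < x < 1 -> is_derive x 1 S (Gker 2 x).
  move=> /andP[x0 y1]; have x1 : 0 < 1 - x by rewrite subr_gt0.
  have -> : Gker 2 x = - (- x^-1 ^+ 2 * 1) + (- (1 - x)^-1 ^+ 2 * (0 - 1)) +
    (2 * (x^-1 * 1 - (1 - x)^-1 * (0 - 1)) + 0 * (ln x - ln (1 - x))).
    by rewrite /Gker !p2//; field; rewrite !gt_eqF.
  exact: (isdD (isdD (isdN (dinv _ _ _ x0 (isdI x))) (dinv (fun y => 1 - y) x _ x1 (d2 x)))
    (isdM (isdC 2 x) (isdD (dln _ _ _ x0 (isdI x)) (isdN (dln (fun y => 1 - y) x _ x1 (d2 x)))))).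
have HF : (F1 2 c = (- Q c)%:E)%E.
  rewrite -[LHS]adde0 -[X in (_ + X)%E]/(0%:E).
  have E : ((\int[mu]_(x in `]c, +oo[) (Fker 2 x)%:E + (Q c)%:E)%E =
    (\int[mu]_(x in `]c, +oo[) (0 : R)%:E + 0%:E)%E).
    apply: (@ge0_FTC_oy _ _ _ Q).
    - exact: isd_cvg_right (dQ _ c0) erefl.
    - have i0 : x^-1 @[x --> +oo] --> (0 : R).
        have := @powR_cvgy0 R (-1); rewrite ltrN10 => /(_ isT).
        apply: cvg_trans; apply: near_eq_cvg; near=> x.
        by rewrite powR_inv1//; near: x; exact: nbhs_pinfty_ge.
      apply: (@squeeze_cvgr _ _ _ _ (fun x => - x^-1 - x^-1) (fun x => 2 * x^-1)); last 2 first.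
      + by rewrite -[X in _ --> X](subr0) -[X in _ --> X - _]oppr0; apply: cvgB => //; apply: cvgN.
      + by rewrite -[X in _ --> X](mulr0 2); apply: cvgMr.
      near=> x; have x0 : 0 < x by near: x; exact: nbhs_pinfty_gt.
      have x1 : 0 < 1 + x by rewrite addr_gt0.
      have l0 : ln x <= ln (1 + x) by rewrite ler_ln ?posrE// lerDr.
      have l1 : ln (1 + x) - ln x <= x^-1.
        have := @le_ln1Dx R x^-1; rewrite (lt_trans _ (_ : 0 < x^-1)) ?invr_gt0 ?ltrN10// => /(_ isT).
        have -> : 1 + x^-1 = (1 + x) / x by field; rewrite gt_eqF.
        by rewrite ln_div ?posrE.
      have i1 : (1 + x)^-1 <= x^-1 by rewrite lef_pV2 ?posrE// lerDr.
      have i2 : 0 < (1 + x)^-1 by rewrite invr_gt0.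
      have i3 : 0 < x^-1 by rewrite invr_gt0.
      by rewrite /Q; apply/andP; split; lra.
    - by move=> x _; exact: Fker_ge0.
    - by [].
    - by move=> x xc; apply: cont_Fker; exact: lt_trans xc.
    - by move=> x _; exact: cntC.
    - by move=> x xc; rewrite subr0; apply: dQ; exact: lt_trans xc.
  move: E; rewrite integral0 adde0 -/(F1 2 c) adde0; case: (F1 2 c) => [r||]//.
  by rewrite -EFinD => H; have {}H := EFin_inj H; congr EFin; lra.
have HG : (G1 2 c = (- S c)%:E)%E.
  have S0 : S 2^-1 = 0.
    rewrite /S; have -> : 1 - 2^-1 = 2^-1 :> R by field.
    by rewrite subrr mulr0 addr0 addNr.
  move: ch; rewrite le_eqVlt => /orP[/eqP->|ch].
    by rewrite /G1 set_itvoo0 integral_set0 S0 oppr0.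
  have E : ((\int[mu]_(x in `]c, 2^-1%R[) (Gker 2 x)%:E + (S c)%:E)%E =
    (\int[mu]_(x in `]c, 2^-1%R[) (0 : R)%:E + 0%:E)%E).
    apply: (@ge0_FTC_oo _ _ _ S) => //.
    - by apply: isd_cvg_right (dS _ _) erefl; rewrite c0.
    - by apply: isd_cvg_left (dS _ _) S0; rewrite h0.
    - by move=> x _; exact: Gker_ge0.
    - by move=> x /andP[xc x1]; apply: cont_Gker; rewrite (lt_trans c0) ?(lt_trans x1).
    - by move=> x _; exact: cntC.
    - by move=> x /andP[xc x1]; rewrite subr0; apply: dS; rewrite (lt_trans c0) ?(lt_trans x1).
  move: E; rewrite integral0 adde0 -/(G1 2 c); case: (G1 2 c) => [r||]//.
  by rewrite -EFinD => H; have {}H := EFin_inj H; congr EFin; lra.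
have HN : (N1 2 c = (Q c + S c + 2 * c^-1)%:E)%E.
  (* [T] is Q + S plus the antiderivative 2/x of -2 x^-2. The poles and the logarithms of x cancel,
     so [T] is differentiable across 0, where it vanishes. *)
  pose T x := - (1 + x)^-1 + (1 - x)^-1 + 2 * (ln (1 + x) - ln (1 - x)).
  have TE x : T x = Q x + S x + 2 * x^-1 by rewrite /T /Q /S; ring.
  have dT x : -1 < x < 1 -> is_derive x 1 T (- (- (1 + x)^-1 ^+ 2 * (0 + 1)) + (- (1 - x)^-1 ^+ 2 * (0 - 1)) +
    (2 * ((1 + x)^-1 * (0 + 1) - (1 - x)^-1 * (0 - 1)) + 0 * (ln (1 + x) - ln (1 - x)))).
    move=> /andP[x0 x1].
    have y0 : 0 < 1 + x by lra.
    have y1 : 0 < 1 - x by lra.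
    exact: (isdD (isdD (isdN (dinv _ _ _ y0 (d1 x))) (dinv (fun y => 1 - y) x _ y1 (d2 x)))
    (isdM (isdC 2 x) (isdD (dln _ _ _ y0 (d1 x)) (isdN (dln (fun y => 1 - y) x _ y1 (d2 x)))))).
  rewrite -TE -[RHS]add0e -[LHS]adde0 -[in RHS](@integral0 _ _ R mu `]0, c[%classic).
  apply: (@ge0_FTC_oo _ _ _ T) => //.
  - apply: isd_cvg_right (dT 0 _) _; first by rewrite ltr01 ltrN10.
    by rewrite /T addr0 subr0 subrr mulr0 addr0 addNr.
  - by apply: isd_cvg_left (dT c _) erefl; rewrite c1 (lt_trans _ c0)// ltrN10.
  - by move=> x /andP[x0 x1]; apply: Nker_ge0 => //; rewrite (ltW x0) (lt_trans x1).
  - by move=> x /andP[x0 x1]; apply: cont_Nker; rewrite x0 (lt_trans x1).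
  - by move=> x _; exact: cntC.
  - move=> x /andP[x0 x1]; have y1 : 0 < 1 - x by rewrite subr_gt0 (lt_trans x1).
    have y0 : 0 < 1 + x by rewrite addr_gt0.
    have := dT x; rewrite (lt_trans _ x0) ?ltrN10// (lt_trans x1 c1) => /(_ isT).
    have -> // : - (- (1 + x)^-1 ^+ 2 * (0 + 1)) + (- (1 - x)^-1 ^+ 2 * (0 - 1)) +
    (2 * ((1 + x)^-1 * (0 + 1) - (1 - x)^-1 * (0 - 1)) + 0 * (ln (1 + x) - ln (1 - x))) =
     Nker 2 x - 0.
    by rewrite /Nker !p2//; field; rewrite !gt_eqF.
rewrite HF HG HN -!EFinD powR_inv1 ?(ltW c0)//; congr EFin; ring.
Unshelve. all: end_near. Qed.

Lemma FGN_value u c : 0 < u <= 1 -> 0 < c <= 2^-1 ->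
  (F1 (1 + u) c + G1 (1 + u) c + N1 (1 + u) c = (2 * c `^ (- u) / u + fp_value u)%:E)%E.
Proof.
move=> /andP[u0]; rewrite le_eqVlt => /orP[/eqP->|u1] cI.
  by rewrite FGN_value_1// /fp_value mulr1 cospi subrr oppr0 mul0r divr1 addr0.
by apply: FGN_value_lt1; rewrite ?u0.
Qed.

Lemma FGN_int_value u k : 0 < u <= 1 -> 1 <= k ->
  (Fint (1 + u) k + Gint (1 + u) k + Nint (1 + u) k =
   (fp_value u * k `^ (- (1 + 2 * u)) + 2 * 2 `^ u / u * k `^ (- (1 + u)))%:E)%E.
Proof.
move=> uI k1; have /andP[u0 u1] := uI; have k0 : 0 < k by exact: lt_le_trans k1.
have s0 : 0 <= 1 + u by rewrite addr_ge0// ltW.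
have kh : 2^-1 < k by rewrite (lt_le_trans _ k1)// invf_lt1// ltr1n.
rewrite Fint_scale// Gint_scale// Nint_scale//.
have ge0 (D : set R) (f : R -> R) : (forall x, D x -> 0 <= f x) -> (0 <= \int[mu]_(x in D) (f x)%:E)%E.
  by move=> f0; apply: integral_ge0 => x /f0; rewrite lee_fin.
have c1 : (2 * k)^-1 < 1 by rewrite invf_lt1 ?mulr_gt0// -ltr_pdivrMl// mulr1.
have cI : 0 < (2 * k)^-1 <= 2^-1.
  by rewrite invr_gt0 mulr_gt0//= lef_pV2 ?posrE ?mulr_gt0// ler_peMr.
have F0 : (0 <= F1 (1 + u) (2 * k)^-1)%E by apply: ge0 => x _; exact: Fker_ge0.
have G0 : (0 <= G1 (1 + u) (2 * k)^-1)%E by apply: ge0 => x _; exact: Gker_ge0.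
have N0 : (0 <= N1 (1 + u) (2 * k)^-1)%E.
  apply: ge0 => x; rewrite /= in_itv/= => /andP[x0 x1]; apply: Nker_ge0 => //.
  by rewrite (ltW x0) (lt_trans x1).
rewrite -(ge0_muleDr _ F0 G0) -(ge0_muleDr _ (adde_ge0 F0 G0) N0).
rewrite (FGN_value uI cI) -EFinM; congr EFin.
have -> : 1 - 2 * (1 + u) = - (1 + 2 * u) by ring.
rewrite mulrDr addrC; congr (_ + _); first by rewrite mulrC.
have -> : (2 * k)^-1 `^ (- u) = 2 `^ u * k `^ u.
  by rewrite -powR_inv1 ?mulr_ge0 ?(ltW k0)// -powRrM mulrNN mul1r powRM// ltW.
have -> : k `^ (- (1 + u)) = k `^ (- (1 + 2 * u)) * k `^ u.
  by rewrite -powRD ?(gt_eqF k0) ?implybT//; congr powR; ring.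
by ring.
Qed.

End FinitePartValue.

(** * Lattice sums and unfolding *)
Section DoubleSeries.
Context {R : realType}.
Local Open Scope ereal_scope.

Lemma nneseries_shift (f : nat -> \bar R) N : (forall i, 0 <= f i) ->
  \sum_(0 <= m <oo) (if (N <= m)%N then f m else 0) = \sum_(0 <= k <oo) f (k + N)%N.
Proof.
move=> f0; rewrite nneseries_addn// (@nneseries_split _ _ 0 N); last first.
  by move=> k _; case: ifP.
rewrite add0n big_nat_cond big1 ?add0e; last first.
  by move=> i /andP[/andP[_ iN] _]; rewrite leqNgt iN.
rewrite [LHS](_ : _ = \sum_(N <= k <oo | (N <= k)%N) f k); last first.
  by rewrite [RHS]eseries_mkcond.
apply/congr_lim/funext => n; rewrite big_nat_cond [RHS]big_nat_cond.
by apply: eq_bigl => k; case: (N <= k)%N; rewrite ?andbF.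
Qed.

(** A Cauchy product grouped by k = n + m + 1. With a n at the lattice point n + 1 + t and b m at
    the point -(m + 1 - t), the points of group k are k + 1 apart; group 0 is empty. *)
Lemma nneseries_cauchy (a b : nat -> R) r : (forall n, 0 <= a n)%R -> (forall n, 0 <= b n)%R ->
  \sum_(0 <= n <oo) (b n)%:E = r%:E ->
  (\sum_(0 <= n <oo) (a n)%:E) * (\sum_(0 <= n <oo) (b n)%:E) =
  \sum_(0 <= k <oo) \sum_(0 <= n <oo) (if (n < k)%N then a n * b (k - n.+1)%N else 0)%R%:E.
Proof.
move=> a0 b0 Br.
rewrite (@nneseries_interchange _ (fun k n => (if (n < k)%N then a n * b (k - n.+1)%N else 0)%R%:E)); last first.
  by move=> i j; rewrite lee_fin; case: ifP => // _; rewrite mulr_ge0.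
rewrite Br muleC -nneseriesZl; last by move=> n _; rewrite lee_fin.
apply: eq_eseriesr => n _; rewrite muleC -Br -nneseriesZl; last by move=> k _; rewrite lee_fin.
transitivity (\sum_(0 <= k <oo) (if (n.+1 <= k)%N then (a n * b (k - n.+1)%N)%:E else 0)); last first.
  by apply: eq_eseriesr => k _; case: ifP.
rewrite (@nneseries_shift (fun k => (a n * b (k - n.+1)%N)%:E)); last first.
  by move=> k; rewrite lee_fin mulr_ge0.
by apply: eq_eseriesr => k _; rewrite addnK EFinM.
Qed.

Lemma nneseries_square (c : nat -> nat -> R) : (forall n m, 0 <= c n m)%R ->
  \sum_(0 <= n <oo) \sum_(0 <= m <oo) (c n m)%:E =
  \sum_(0 <= n <oo) (c n n)%:E +
  \sum_(0 <= k <oo) \sum_(0 <= n <oo) (c n (n + k.+1)%N)%:E +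
  \sum_(0 <= k <oo) \sum_(0 <= n <oo) (c (n + k.+1)%N n)%:E.
Proof.
move=> c0.
have e0 n m : 0 <= (c n m)%:E by rewrite lee_fin.
have -> : \sum_(0 <= n <oo) \sum_(0 <= m <oo) (c n m)%:E =
  \sum_(0 <= n <oo) \sum_(0 <= m <oo) (if (m <= n)%N then (c n m)%:E else 0) +
  \sum_(0 <= n <oo) \sum_(0 <= m <oo) (if (n.+1 <= m)%N then (c n m)%:E else 0).
  rewrite -nneseriesD; last 2 first.
  - by move=> n _ _; apply: nneseries_ge0 => m _ _; case: ifP.
  - by move=> n _ _; apply: nneseries_ge0 => m _ _; case: ifP.
  apply: eq_eseriesr => n _; rewrite -nneseriesD; last 2 first.
  - by move=> m _ _; case: ifP.
  - by move=> m _ _; case: ifP.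
  by apply: eq_eseriesr => m _; case: (leqP m n); rewrite ?adde0 ?add0e.
have -> : \sum_(0 <= n <oo) \sum_(0 <= m <oo) (if (n.+1 <= m)%N then (c n m)%:E else 0) =
  \sum_(0 <= k <oo) \sum_(0 <= n <oo) (c n (n + k.+1)%N)%:E.
  rewrite [RHS]nneseries_interchange//; apply: eq_eseriesr => n _.
  rewrite (@nneseries_shift (fun m => (c n m)%:E))//.
  by apply: eq_eseriesr => k _; rewrite addnS -addSn addnC.
rewrite nneseries_interchange; last by move=> i j; case: ifP.
rewrite -addeAC; congr (_ + _).
rewrite (@nneseries_interchange _ (fun k n => (c (n + k.+1)%N n)%:E))// -nneseriesD//; last first.
  by move=> n _ _; apply: nneseries_ge0.
apply: eq_eseriesr => m _.
rewrite (@nneseries_shift (fun n => (c n m)%:E))// nneseries_recl//.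
rewrite add0n; congr (_ + _).
rewrite -[LHS](@nneseries_addn _ (fun k => (c (k + m)%N m)%:E) 1)//.
by apply: eq_eseriesr => k _; rewrite addn1 addSn addnC addnS.
Qed.

End DoubleSeries.

Section Unfolding.
Context {R : realType}.
Implicit Types (a b c p x y u t v s : R).
Notation mu := (@lebesgue_measure R).

Lemma measurable_nneseries (D : set R) (f : nat -> R -> \bar R) : measurable D ->
  (forall n, measurable_fun D (f n)) -> (forall n x, D x -> 0 <= f n x)%E ->
  measurable_fun D (fun x => \sum_(0 <= n <oo) f n x)%E.
Proof. by move=> mD mf f0; apply: ge0_emeasurable_sum => // n x Dx _; exact: f0. Qed.

Lemma measurable_affine a b (h : R -> R) (D : set R) :
  measurable_fun setT h -> measurable_fun D (fun x => h (a * x + b)).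
Proof.
move=> mh; apply: measurable_funTS; apply: (@measurableT_comp _ _ _ _ _ _ h) => //.
by apply: measurable_funD => //; apply: measurable_funM.
Qed.

Lemma measurable_shift a (h : R -> R) (D : set R) :
  measurable_fun setT h -> measurable_fun D (fun x => h (a + x)).
Proof.
move=> /(@measurable_affine 1 a _ D); congr measurable_fun; apply/funext => x.
by rewrite mul1r addrC.
Qed.

Lemma measurable_refl a (h : R -> R) (D : set R) :
  measurable_fun setT h -> measurable_fun D (fun x => h (a - x)).
Proof.
move=> /(@measurable_affine (-1) a _ D); congr measurable_fun; apply/funext => x.
by rewrite mulN1r addrC.
Qed.

(* Translates and reflections of (0, 1/2) by the positive integers tile
   (1/2, +oo) up to a null set. *)
Lemma integral_unfold (h : R -> R) : measurable_fun setT h ->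
  (forall x, 0 <= h x) ->
  (\int[mu]_(t in `]0%R, 2^-1%R[) \sum_(0 <= n <oo) (h (n.+1%:R + t) + h (n.+1%:R - t))%:E =
   \int[mu]_(x in `]2^-1%R, +oo[) (h x)%:E)%E.
Proof.
move=> mh h0.
have mhE (D : set R) : measurable_fun D (fun x => (h x)%:E).
  by apply/measurable_EFinP; exact: measurable_funTS.
have hE0 (D : set R) x : D x -> (0 <= (h x)%:E)%E by move=> _; rewrite lee_fin.
have m1 n : measurable_fun (`]0, 2^-1[%classic : set R) (fun t => (h (n.+1%:R + t))%:E).
  by apply/measurable_EFinP; exact: measurable_shift.
have m2 n : measurable_fun (`]0, 2^-1[%classic : set R) (fun t => (h (n.+1%:R - t))%:E).
  by apply/measurable_EFinP; exact: measurable_refl.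
rewrite integral_nneseries//; last 2 first.
- by move=> n; apply/measurable_EFinP; apply: measurable_funD; [exact: measurable_shift|exact: measurable_refl].
- by move=> n x _; rewrite lee_fin addr_ge0.
have h20 : 0 < 2^-1 :> R by rewrite invr_gt0.
pose I n : set R := `[n%:R + 2^-1, n.+1%:R + 2^-1[%classic.
have UI : `[2^-1, +oo[%classic = \bigcup_n I n.
  apply/seteqP; split => [x|x [n _]]/=; rewrite /I/= !in_itv/= andbT; last first.
    by move=> /andP[h1 _]; apply: le_trans h1; rewrite lerDr.
  move=> xh; exists (Num.truncn (x - 2^-1)) => //=; rewrite in_itv/=.
  have := @truncn_itv R (x - 2^-1); rewrite subr_ge0 => /(_ xh).
  by rewrite lerBrDr ltrBlDr.
rewrite integral_itv_obnd_cbnd; last exact: mhE.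
have mI n : measurable (I n) by exact: measurable_itv.
rewrite UI ge0_integral_bigcup//; last 3 first.
- exact: mhE.
- by move=> x _; rewrite lee_fin.
- apply/trivIsetP => i j _ _; wlog : i j / (i < j)%N.
    move=> H ij; case: (ltngtP i j) ij => // ij ij'.
      by apply: H => //; rewrite neq_ltn ij.
    by rewrite setIC; apply: H => //; rewrite neq_ltn ij.
  move=> ij _; apply/seteqP; split => // x [] /=; rewrite /I/= !in_itv/= => /andP[_ h1] /andP[h2 _].
  have := le_lt_trans h2 h1; rewrite ltrD2r ltr_nat ltnS leqNgt ij//.
apply: eq_eseriesr => n _.
under eq_integral do rewrite EFinD.
rewrite ge0_integralD//; last 4 first.
- by move=> x _; rewrite lee_fin.
- exact: m1.
- by move=> x _; rewrite lee_fin.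
- exact: m2.
rewrite -(@integral_itv_obnd_cbnd _ (n%:R + 2^-1)); last exact: mhE.
rewrite [RHS](@integral_oo_split _ _ _ n.+1%:R)//; last 3 first.
- by rewrite -[n.+1%:R]natr1 ltrD2l invf_lt1// ltr1n.
- by rewrite lerDl ltW.
- exact: measurable_funTS.
rewrite [RHS]addeC; congr (_ + _)%E.
- rewrite [RHS](@ge0_integral_affine _ _ _ 1 n.+1%:R)//; last by move=> x _; rewrite lee_fin.
  rewrite normr1 mul1e.
  have -> : (fun y => 1 * y + n.+1%:R) @^-1` `]n.+1%:R, (n.+1%:R + 2^-1)[%classic = `]0, 2^-1[%classic :> set R.
    by apply/seteqP; split => x /=; rewrite !in_itv/= mul1r [x + _]addrC ltrDl ltrD2l.
  by apply: eq_integral => x _; rewrite mul1r addrC.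
- rewrite [RHS](@ge0_integral_affine _ _ _ (-1) n.+1%:R)//; last by move=> x _; rewrite lee_fin.
  rewrite normrN1 mul1e.
  have -> : (fun y => -1 * y + n.+1%:R) @^-1` `]n%:R + 2^-1, n.+1%:R[%classic = `]0, 2^-1[%classic :> set R.
    apply/seteqP; split => x /=; rewrite !in_itv/= -[n.+1%:R]natr1; move: (n%:R : R) => w;
    by move=> /andP[? ?]; apply/andP; split; lra.
  by apply: eq_integral => x _; rewrite mulN1r addrC.
Qed.

Lemma integral_pow_tail v c : 0 < v -> 0 < c ->
  (\int[mu]_(x in `]c, +oo[) (x `^ (- (1 + v)))%:E = (c `^ (- v) / v)%:E)%E.
Proof.
move=> v0 c0.
have dF x : 0 < x -> is_derive x 1 (fun x => - v^-1 * x `^ (- v)) (x `^ (- (1 + v)) - 0).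
  move=> x0; have -> : x `^ (- (1 + v)) - 0 = - v^-1 * (- v * (x `^ (- v) / x) * 1) + 0 * x `^ (- v).
    by rewrite powRN_div//; field; rewrite !gt_eqF.
  exact: (isdM (isdC _ x) (isd_powR _ x0 (isdI x))).
have E : (\int[mu]_(x in `]c, +oo[) (x `^ (- (1 + v)))%:E + (- v^-1 * c `^ (- v))%:E =
  \int[mu]_(x in `]c, +oo[) (0 : R)%:E + 0%:E)%E.
  apply: (@ge0_FTC_oy _ _ _ (fun x => - v^-1 * x `^ (- v))).
  - exact: isd_cvg_right (dF _ c0) erefl.
  - rewrite -[X in _ --> X](mulr0 (- v^-1)); apply: cvgMr.
    by apply: powR_cvgy0; rewrite oppr_lt0.
  - by move=> x _; exact: powR_ge0.
  - by [].
  - by move=> x xc; apply: cont_pow; exact: lt_trans xc.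
  - by move=> x _; exact: cntC.
  - by move=> x xc; apply: dF; exact: lt_trans xc.
move: E; rewrite integral0 adde0; case: integral => [r||]//.
rewrite -EFinD => H; have {}H := EFin_inj H; congr EFin.
by rewrite mulNr [v^-1 * _]mulrC in H; lra.
Qed.

End Unfolding.

(** * Zeta series and the regularised lattice sum *)

Section ZetaSeries.
Context {R : realType}.
Implicit Types (a b c p x y u t v s : R).
Notation mu := (@lebesgue_measure R).

Lemma nneseries_EFin (f : nat -> R) : (forall n, 0 <= f n) ->
  (\sum_(0 <= n <oo) (f n)%:E < +oo)%E ->
  (\sum_(0 <= n <oo) (f n)%:E = (limn (series f))%:E)%E.
Proof.
move=> f0 flt; rewrite -EFin_lim; last exact: nnseries_is_cvg.
by apply/congr_lim/funext => n; rewrite /= /series/= sumEFin.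
Qed.

(** With [below], the terms of the lattice sum over t + Z other than the one at t itself: starting
    at n + 1 leaves out the singular t^-s. *)
Definition above s t (n : nat) : R := (n.+1%:R + t) `^ (- s).
Definition below s t (n : nat) : R := (n.+1%:R - t) `^ (- s).

Lemma above_ge0 s t n : 0 <= above s t n. Proof. exact: powR_ge0. Qed.
Lemma below_ge0 s t n : 0 <= below s t n. Proof. exact: powR_ge0. Qed.

Let D : set R := `]0, 2^-1[%classic.
Let mD : measurable D. Proof. exact: measurable_itv. Qed.
Let D_lt t : D t -> 0 < t < 2^-1. Proof. by rewrite /D/= in_itv. Qed.
Let D_lt1 t : D t -> 0 < t < 1.
Proof.
by move=> /D_lt/andP[-> h]; rewrite (lt_trans h)// invf_lt1// ltr1n.
Qed.

Lemma measurable_pow p (E : set R) : measurable_fun E (fun x : R => x `^ p).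
Proof. by apply: measurable_funTS; exact: measurable_powR. Qed.

Lemma integral_above_below u : 0 < u ->
  (\int[mu]_(t in D) \sum_(0 <= n <oo) (above (1 + u) t n + below (1 + u) t n)%:E =
   (2 `^ u / u)%:E)%E.
Proof.
move=> u0; rewrite (@integral_unfold _ (fun x => x `^ (- (1 + u)))).
- rewrite integral_pow_tail// ?invr_gt0//; congr (_ / _)%:E.
  by rewrite -powR_inv1// -powRrM mulrNN mul1r.
- exact: measurable_pow.
- by move=> x; exact: powR_ge0.
Qed.

Lemma two_pow_le_above_below s t n : 0 <= s -> 0 <= t < 1 ->
  2 * n.+1%:R `^ (- s) <= above s t n + below s t n.
Proof.
move=> s0 /andP[t0 t1]; apply: ge0_sum_powRN => //.
by rewrite t0 (lt_le_trans t1)// ler1n.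
Qed.

Lemma measurable_ab s : measurable_fun D (fun t => (\sum_(0 <= n <oo) (above s t n + below s t n)%:E)%E).
Proof.
apply: measurable_nneseries => // [n|n x _]; last by rewrite lee_fin addr_ge0 ?powR_ge0.
apply/measurable_EFinP; apply: measurable_funD.
  exact: measurable_powR_shift.
exact: measurable_powR_refl.
Qed.

(** Convergence comes out of the unfolding: by convexity twice the series is at most the sum of
    [above] and [below] at every t in (0, 1/2), and that sum has a finite integral. *)
Lemma ezeta_lty u : 0 < u -> (\sum_(0 <= n <oo) (n.+1%:R `^ (- (1 + u)) : R)%:E < +oo)%E.
Proof.
move=> u0; set Z := (\sum_(0 <= n <oo) _)%E.
have s0 : 0 <= 1 + u by rewrite addr_ge0// ltW.
have : (\int[mu]_(t in D) cst (2%:E * Z) t < +oo)%E.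
  apply: (@le_lt_trans _ _ (2 `^ u / u)%:E); last by rewrite ltry.
  rewrite -integral_above_below//; apply: ge0_le_integral => //.
  - by move=> t _; rewrite mule_ge0// nneseries_ge0// => n _ _; rewrite lee_fin powR_ge0.
  - exact: measurable_ab.
  move=> t /D_lt1 /andP[t0 t1] /=; rewrite /Z -nneseriesZl; last by move=> n _; rewrite lee_fin powR_ge0.
  apply: lee_nneseries => n _; first by rewrite -EFinM lee_fin mulr_ge0 ?powR_ge0.
  by rewrite -EFinM lee_fin two_pow_le_above_below// (ltW t0).
rewrite integral_cst//= /D lebesgue_measure_itv/= lte_fin invr_gt0 ltr0n/= -EFinD subr0.
have : (0 <= Z)%E by apply: nneseries_ge0 => n _ _; rewrite lee_fin powR_ge0.
case: Z => [r||]//; first by move=> _ _; rewrite ltry.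
by rewrite gt0_muley ?lte_fin// gt0_mulye ?lte_fin ?invr_gt0.
Qed.

Lemma ezetaE u : 0 < u ->
  (\sum_(0 <= n <oo) (n.+1%:R `^ (- (1 + u)) : R)%:E = (riemann_zeta (1 + u))%:E)%E.
Proof.
by move=> u0; rewrite nneseries_EFin//; exact: ezeta_lty.
Qed.

Lemma powRN_le x y p : 0 <= p -> 0 < x -> x <= y -> y `^ (- p) <= x `^ (- p).
Proof.
move=> p0 x0 xy; have y0 := lt_le_trans x0 xy; rewrite !powRN lef_pV2 ?posrE ?powR_gt0 ?(lt_le_trans x0)//.
by apply: ge0_ler_powR; rewrite ?nnegrE ?(ltW x0) ?(ltW y0).
Qed.

Lemma above_lty u t : 0 < u -> 0 <= t -> (\sum_(0 <= n <oo) (above (1 + u) t n)%:E < +oo)%E.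
Proof.
move=> u0 t0; apply: le_lt_trans (ezeta_lty u0); apply: lee_nneseries => n _.
  by rewrite lee_fin above_ge0.
by rewrite lee_fin; apply: powRN_le => //; [rewrite addr_ge0// ltW|rewrite lerDl].
Qed.

Lemma hurwitz_series u x : 0 < u -> 0 < x ->
  (\sum_(0 <= k <oo) ((k%:R + x) `^ (- (1 + u)))%:E = (hurwitz_zeta (1 + u) x)%:E)%E.
Proof.
move=> u0 x0; rewrite nneseries_EFin// => [n|]; first exact: powR_ge0.
rewrite nneseries_recl//; last by move=> k _; rewrite lee_fin powR_ge0.
rewrite -(@nneseries_addn _ (fun k => ((k%:R + x) `^ (- (1 + u)))%:E) 1); last first.
  by move=> k; rewrite lee_fin powR_ge0.
rewrite lte_add_pinfty ?ltry//.
under eq_eseriesr do rewrite addn1.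
by apply: above_lty => //; exact: ltW.
Qed.

Lemma above_sum u t : 0 < u -> 0 < t ->
  (\sum_(0 <= n <oo) (above (1 + u) t n)%:E = (hurwitz_zeta (1 + u) t - t `^ (- (1 + u)))%:E)%E.
Proof.
move=> u0 t0; have H := hurwitz_series u0 t0; move: H.
rewrite [X in X = _ -> _]nneseries_recl//; last by move=> k _; rewrite lee_fin powR_ge0.
rewrite -(@nneseries_addn _ (fun k => ((k%:R + t) `^ (- (1 + u)))%:E) 1); last first.
  by move=> k; rewrite lee_fin powR_ge0.
under [X in (_ + X)%E = _ -> _]eq_eseriesr do rewrite addn1.
rewrite add0r -/(above _ _ _).
have -> : (\sum_(0 <= i <oo) ((i.+1%:R + t) `^ (- (1 + u)))%:E = \sum_(0 <= i <oo) (above (1 + u) t i)%:E)%E by [].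
have := above_lty u0 (ltW t0).
have : (0 <= \sum_(0 <= i <oo) (above (1 + u) t i)%:E)%E.
  by apply: nneseries_ge0 => n _ _; rewrite lee_fin above_ge0.
case: (\sum_(0 <= i <oo) (above (1 + u) t i)%:E)%E => [r||]// _ _.
by rewrite -EFinD => H; have {}H := EFin_inj H; congr EFin; lra.
Qed.

Lemma below_sum u t : 0 < u -> t < 1 ->
  (\sum_(0 <= n <oo) (below (1 + u) t n)%:E = (hurwitz_zeta (1 + u) (1 - t))%:E)%E.
Proof.
move=> u0 t1; rewrite -hurwitz_series ?subr_gt0//; apply: eq_eseriesr => n _.
by rewrite /below -natr1 addrA.
Qed.

(* zeta(s,t) + zeta(s,1-t) minus its singular term at t = 0. *)
Definition regular s t : R := hurwitz_zeta s t + hurwitz_zeta s (1 - t) - t `^ (- s).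

Lemma regular_sum u t : 0 < u -> 0 < t < 1 ->
  (\sum_(0 <= n <oo) (above (1 + u) t n + below (1 + u) t n)%:E = (regular (1 + u) t)%:E)%E.
Proof.
move=> u0 /andP[t0 t1].
under eq_eseriesr do rewrite EFinD.
rewrite nneseriesD; last 2 first.
- by move=> n _ _; rewrite lee_fin above_ge0.
- by move=> n _ _; rewrite lee_fin below_ge0.
by rewrite above_sum// below_sum// -EFinD /regular; congr EFin; ring.
Qed.

Lemma measurable_regular u : 0 < u -> measurable_fun D (regular (1 + u)).
Proof.
move=> u0; apply/measurable_EFinP.
apply: eq_measurable_fun (measurable_ab (1 + u)) => t; rewrite inE => /D_lt1 tI.
by rewrite regular_sum.
Qed.

Lemma integral_regular u : 0 < u -> (\int[mu]_(t in D) (regular (1 + u) t)%:E = (2 `^ u / u)%:E)%E.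
Proof.
move=> u0; rewrite -integral_above_below//; apply: eq_integral => t.
by rewrite inE => /D_lt1 tI; rewrite regular_sum.
Qed.

(** The E of the overview: a sum of second differences of x^-s at the positive integers, with step
    t. *)
Definition excess s t : R := regular s t - 2 * riemann_zeta s.

Lemma excess_sum u t : 0 < u -> 0 < t < 1 ->
  (\sum_(0 <= n <oo) (above (1 + u) t n + below (1 + u) t n - 2 * n.+1%:R `^ (- (1 + u)))%:E =
   (excess (1 + u) t)%:E)%E.
Proof.
move=> u0 tI; have := regular_sum u0 tI; have /andP[t0 t1] := tI.
have s0 : 0 <= 1 + u by rewrite addr_ge0// ltW.
have p0 n : (0 <= (above (1 + u) t n + below (1 + u) t n - 2 * n.+1%:R `^ (- (1 + u)))%:E)%E.
  by rewrite lee_fin subr_ge0 two_pow_le_above_below// (ltW t0).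
have -> : (\sum_(0 <= n <oo) (above (1 + u) t n + below (1 + u) t n)%:E =
  \sum_(0 <= n <oo) (above (1 + u) t n + below (1 + u) t n - 2 * n.+1%:R `^ (- (1 + u)))%:E +
  \sum_(0 <= n <oo) (2%:E * (n.+1%:R `^ (- (1 + u)))%:E))%E.
  rewrite -nneseriesD; last 2 first.
  - by move=> n _ _; exact: p0.
  - by move=> n _ _; rewrite -EFinM lee_fin mulr_ge0 ?powR_ge0.
  by apply: eq_eseriesr => n _; rewrite -EFinM -EFinD subrK.
rewrite nneseriesZl; last by move=> n _; rewrite lee_fin powR_ge0.
rewrite ezetaE//.
have : (0 <= \sum_(0 <= n <oo) (above (1 + u) t n + below (1 + u) t n - 2 * n.+1%:R `^ (- (1 + u)))%:E)%E.
  by apply: nneseries_ge0 => n _ _; exact: p0.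
case: (\sum_(0 <= n <oo) _)%E => [r||]// _.
by rewrite -EFinM -EFinD => H; have {}H := EFin_inj H; congr EFin; rewrite /excess; lra.
Qed.

Lemma excess_ge0 u t : 0 < u -> 0 < t < 1 -> 0 <= excess (1 + u) t.
Proof.
move=> u0 tI; rewrite -lee_fin -excess_sum//; apply: nneseries_ge0 => n _ _.
have /andP[t0 t1] := tI.
by rewrite lee_fin subr_ge0 two_pow_le_above_below ?(ltW t0)// addr_ge0// ltW.
Qed.

Lemma measurable_excess u : 0 < u -> measurable_fun D (excess (1 + u)).
Proof. by move=> u0; apply: measurable_funB => //; exact: measurable_regular. Qed.

Lemma integral_pow_excess u : 0 < u ->
  (\int[mu]_(t in D) (t `^ (- (1 + u)) * excess (1 + u) t)%:E =
   \sum_(0 <= k <oo) Nint (1 + u) k.+1%:R)%E.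
Proof.
move=> u0; have s0 : 0 <= 1 + u by rewrite addr_ge0// ltW.
rewrite /Nint -/D -integral_nneseries//; last 2 first.
- move=> n; apply/measurable_EFinP; apply: measurable_funM; first exact: measurable_powRl.
  apply: measurable_funB => //; apply: measurable_funD; first exact: measurable_powR_shift.
  exact: measurable_powR_refl.
- move=> n t /D_lt1 /andP[t0 t1]; rewrite lee_fin mulr_ge0 ?powR_ge0// n_integrand_ge0//.
  by rewrite (ltW t0) (lt_le_trans t1)// ler1n.
apply: eq_integral => t; rewrite inE => /D_lt1 tI; have /andP[t0 t1] := tI.
rewrite EFinM -excess_sum// -nneseriesZl; last first.
  by move=> n _; rewrite lee_fin subr_ge0 two_pow_le_above_below// (ltW t0).
by apply: eq_eseriesr => n _; rewrite -EFinM.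
Qed.

End ZetaSeries.

(** * Integral of the squared lattice sum, grouped by distance *)

Section SquareIntegral.
Context {R : realType}.
Implicit Types (a b c p x y u t v s : R).
Notation mu := (@lebesgue_measure R).

Let D : set R := `]0, 2^-1[%classic.
Let mD : measurable D. Proof. exact: measurable_itv. Qed.
Let D_lt t : D t -> 0 < t < 2^-1. Proof. by rewrite /D/= in_itv. Qed.
Let h21 : 2^-1 < 1 :> R. Proof. by rewrite invf_lt1// ltr1n. Qed.
Let D_lt1 t : D t -> 0 < t < 1.
Proof. by move=> /D_lt/andP[-> h]; rewrite (lt_trans h). Qed.

Lemma nneseries_sqr (a : nat -> R) r : (forall n, 0 <= a n) ->
  (\sum_(0 <= n <oo) (a n)%:E = r%:E)%E ->
  ((r * r)%:E = \sum_(0 <= n <oo) (a n * a n)%:E +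
    \sum_(0 <= k <oo) \sum_(0 <= n <oo) (2 * (a n * a (n + k.+1)%N))%:E)%E.
Proof.
move=> a0 ar.
have -> : ((r * r)%:E = \sum_(0 <= n <oo) \sum_(0 <= m <oo) (a n * a m)%:E)%E.
  rewrite EFinM -{2}ar -nneseriesZl; last by move=> n _; rewrite lee_fin.
  apply: eq_eseriesr => n _; rewrite muleC -ar -nneseriesZl; last by move=> m _; rewrite lee_fin.
  by apply: eq_eseriesr => m _; rewrite EFinM.
rewrite (@nneseries_square _ (fun n m => a n * a m)); last by move=> n m; rewrite mulr_ge0.
rewrite -addeA; congr (_ + _)%E; rewrite -nneseriesD; last 2 first.
- by move=> k _ _; apply: nneseries_ge0 => n _ _; rewrite lee_fin mulr_ge0.
- by move=> k _ _; apply: nneseries_ge0 => n _ _; rewrite lee_fin mulr_ge0.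
apply: eq_eseriesr => k _; rewrite -nneseriesD; last 2 first.
- by move=> n _ _; rewrite lee_fin mulr_ge0.
- by move=> n _ _; rewrite lee_fin mulr_ge0.
by apply: eq_eseriesr => n _; rewrite -EFinD; congr EFin; ring.
Qed.

Definition hker s (k : R) x : R := x `^ (- s) * (x + k) `^ (- s).
(** The indicator requires the partner k - x to exceed 1/2 as well, so that both points belong to
    the unfolded half line. *)
Definition gker s (k : R) x : R := x `^ (- s) * (k - x) `^ (- s) * \1_(`]-oo, k - 2^-1[%classic : set R) x.

Lemma hker_ge0 s k x : 0 <= hker s k x. Proof. by rewrite mulr_ge0 ?powR_ge0. Qed.
Lemma gker_ge0 s k x : 0 <= gker s k x.
Proof. by rewrite !mulr_ge0 ?powR_ge0// indicE. Qed.

Lemma measurable_hker s k (E : set R) : measurable_fun E (hker s k).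
Proof.
by apply: measurable_funM; [exact: measurable_powRl|exact: measurable_powR_shiftr].
Qed.

Lemma measurable_gker s k (E : set R) : measurable_fun E (gker s k).
Proof.
apply: measurable_funM; last by apply: measurable_indic; exact: measurable_itv.
by apply: measurable_funM; [exact: measurable_powRl|exact: measurable_powR_refl].
Qed.

Lemma gkerE s k x : gker s k x = if x < k - 2^-1 then x `^ (- s) * (k - x) `^ (- s) else 0.
Proof.
rewrite /gker indicE; case: ifPn => xk; first by rewrite mem_set ?mulr1//= in_itv.
by rewrite memNset ?mulr0//= in_itv/=; exact/negP.
Qed.

Definition unfolded (h : R -> R) t : \bar R :=
  (\sum_(0 <= n <oo) (h (n.+1%:R + t) + h (n.+1%:R - t))%:E)%E.

Lemma unfolded_ge0 (h : R -> R) t : (forall x, 0 <= h x) -> (0 <= unfolded h t)%E.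
Proof. by move=> h0; apply: nneseries_ge0 => n _ _; rewrite lee_fin addr_ge0. Qed.

Lemma measurable_unfolded (h : R -> R) : measurable_fun setT h -> (forall x, 0 <= h x) ->
  measurable_fun D (unfolded h).
Proof.
move=> mh h0; apply: measurable_nneseries => // [n|n x _]; last by rewrite lee_fin addr_ge0.
apply/measurable_EFinP; apply: measurable_funD; [exact: measurable_shift|exact: measurable_refl].
Qed.

Definition dker s x : R := x `^ (- s) * x `^ (- s).

Lemma dkerE u x : 0 < x -> dker (1 + u) x = x `^ (- (1 + (1 + 2 * u))).
Proof.
by move=> x0; rewrite /dker -powRD ?(gt_eqF x0) ?implybT//; congr (_ `^ _); ring.
Qed.

Lemma dker_ge0 s x : 0 <= dker s x. Proof. by rewrite mulr_ge0 ?powR_ge0. Qed.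

Lemma nneseries_mul (a b : nat -> R) r r' : (forall n, 0 <= a n) -> (forall n, 0 <= b n) ->
  (\sum_(0 <= n <oo) (a n)%:E = r%:E)%E -> (\sum_(0 <= n <oo) (b n)%:E = r'%:E)%E ->
  ((r * r')%:E = \sum_(0 <= k <oo) \sum_(0 <= n <oo)
     (if (n < k)%N then a n * b (k - n.+1)%N else 0)%:E)%E.
Proof.
by move=> a0 b0 ar br; rewrite EFinM -ar -br (nneseries_cauchy a0 b0 br).
Qed.

Lemma nneseries_foldD (f g : nat -> R) : (forall n, 0 <= f n) -> (forall n, 0 <= g n) ->
  (\sum_(0 <= n <oo) (f n)%:E + \sum_(0 <= n <oo) (g n)%:E =
   \sum_(0 <= n <oo) (f n + g n)%:E)%E.
Proof.
move=> f0 g0; rewrite -nneseriesD; last 2 first.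
- by move=> n _ _; rewrite lee_fin.
- by move=> n _ _; rewrite lee_fin.
by apply: eq_eseriesr => n _; rewrite EFinD.
Qed.

Lemma nneseries_foldDD (f g : nat -> nat -> R) : (forall k n, 0 <= f k n) -> (forall k n, 0 <= g k n) ->
  (\sum_(0 <= k <oo) \sum_(0 <= n <oo) (f k n)%:E + \sum_(0 <= k <oo) \sum_(0 <= n <oo) (g k n)%:E =
   \sum_(0 <= k <oo) \sum_(0 <= n <oo) (f k n + g k n)%:E)%E.
Proof.
move=> f0 g0; rewrite -nneseriesD; last 2 first.
- by move=> n _ _; apply: nneseries_ge0 => k _ _; rewrite lee_fin.
- by move=> n _ _; apply: nneseries_ge0 => k _ _; rewrite lee_fin.
by apply: eq_eseriesr => k _; rewrite nneseries_foldD.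
Qed.

(** With Q split into its [above] and [below] sums, their squares give the diagonal and the
    same-side pairs, and the two mixed products give the opposite-side pairs. Writing each group as
    an unfolded function makes it integrable term by term. *)
Lemma regular_sqr u t : 0 < u -> D t ->
  ((regular (1 + u) t ^+ 2)%:E = unfolded (dker (1 + u)) t +
    \sum_(0 <= k <oo) unfolded (fun x => 2 * hker (1 + u) k.+1%:R x)%R t +
    \sum_(0 <= k <oo) unfolded (gker (1 + u) k.+1%:R) t)%E.
Proof.
move=> u0 Dt; have /andP[t0 th] := D_lt Dt; have t1 : t < 1 by exact: lt_trans h21.
set s := 1 + u.
pose al := hurwitz_zeta s t - t `^ (- s); pose be := hurwitz_zeta s (1 - t).
have A : (\sum_(0 <= n <oo) (above s t n)%:E = al%:E)%E := above_sum u0 t0.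
have B : (\sum_(0 <= n <oo) (below s t n)%:E = be%:E)%E := below_sum u0 t1.
have a0 n : 0 <= above s t n by exact: above_ge0.
have b0 n : 0 <= below s t n by exact: below_ge0.
have -> : regular s t ^+ 2 = (al * al + be * be) + (al * be + be * al).
  by rewrite /regular /al /be; ring.
rewrite !EFinD (nneseries_sqr a0 A) (nneseries_sqr b0 B).
rewrite (nneseries_mul a0 b0 A B) (nneseries_mul b0 a0 B A).
have aa0 m n : 0 <= 2 * (above s t m * above s t n) by rewrite !mulr_ge0.
have bb0 m n : 0 <= 2 * (below s t m * below s t n) by rewrite !mulr_ge0.
have c1 (k n : nat) : 0 <= (if (n < k)%N then above s t n * below s t (k - n.+1)%N else 0).
  by case: ifP => // _; rewrite mulr_ge0.
have c2 (k n : nat) : 0 <= (if (n < k)%N then below s t n * above s t (k - n.+1)%N else 0).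
  by case: ifP => // _; rewrite mulr_ge0.
rewrite [X in (X + _)%E = _]addeACA (nneseries_foldDD (fun k n => aa0 n (n + k.+1)%N) (fun k n => bb0 n (n + k.+1)%N)).
rewrite (nneseries_foldDD c1 c2) nneseries_foldD; last 2 first.
- by move=> n; rewrite mulr_ge0.
- by move=> n; rewrite mulr_ge0.
apply: (f_equal2 adde); first apply: (f_equal2 adde).
- by apply: eq_eseriesr.
- apply: eq_eseriesr => k _; apply: eq_eseriesr => n _; congr EFin.
  rewrite -mulrDr -[RHS]mulrDr; congr (_ * (_ * _ + _ * _)).
    by rewrite /above -addSn natrD addrAC.
  by rewrite /below -addSn natrD addrAC.
- apply: eq_eseriesr => k _; apply: eq_eseriesr => n _; congr EFin.
  (* Because 0 < t < 1/2, the Cauchy condition n < k is exactly n + 1 + t < k + 1/2, and equally n +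
     1 - t < k + 1/2, which is the indicator of [gker] at distance k + 1. *)
  rewrite !gkerE; case: ltnP => nk.
    have nk' : n.+1%:R <= k%:R :> R by rewrite ler_nat.
    have E1 : n.+1%:R + t < k.+1%:R - 2^-1 by rewrite -[k.+1%:R]natr1; lra.
    have E2 : n.+1%:R - t < k.+1%:R - 2^-1 by rewrite -[k.+1%:R]natr1; lra.
    have EK : (k - n.+1).+1%:R = k%:R - n%:R :> R.
      by rewrite -subSn// subSS natrB// ltnW.
    have b1 : below s t (k - n.+1) = (k.+1%:R - (n.+1%:R + t)) `^ (- s).
      rewrite /below EK; apply: (f_equal (fun y : R => y `^ (- s))).
      by rewrite -[k.+1%:R]natr1 -[n.+1%:R]natr1; ring.
    have a1 : above s t (k - n.+1) = (k.+1%:R - (n.+1%:R - t)) `^ (- s).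
      rewrite /above EK; apply: (f_equal (fun y : R => y `^ (- s))).
      by rewrite -[k.+1%:R]natr1 -[n.+1%:R]natr1; ring.
    by rewrite E1 E2 b1 a1.
  have nk' : k%:R <= n%:R :> R by rewrite ler_nat.
  by rewrite !ifF ?addr0//; apply/negbTE; rewrite -leNgt -natr1 -[n.+1%:R]natr1; lra.
Qed.

Lemma integral_unfolded (h : R -> R) : measurable_fun setT h -> (forall x, 0 <= h x) ->
  (\int[mu]_(t in D) unfolded h t = \int[mu]_(x in `]2^-1%R, +oo[) (h x)%:E)%E.
Proof. exact: integral_unfold. Qed.

Lemma integral_unfolded_series (h : nat -> R -> R) : (forall k, measurable_fun setT (h k)) ->
  (forall k x, 0 <= h k x) ->
  (\int[mu]_(t in D) \sum_(0 <= k <oo) unfolded (h k) t =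
   \sum_(0 <= k <oo) \int[mu]_(x in `]2^-1%R, +oo[) (h k x)%:E)%E.
Proof.
move=> mh h0; rewrite integral_nneseries//; last 2 first.
- by move=> k; exact: measurable_unfolded.
- by move=> k x _; exact: unfolded_ge0.
by apply: eq_eseriesr => k _; rewrite integral_unfolded.
Qed.

(** The product is symmetric about k / 2, so (1/2, k - 1/2) contributes twice its left half; for k =
    1 both intervals are empty. *)
Lemma integral_gker s k : 0 <= s -> 1 <= k ->
  (\int[mu]_(x in `]2^-1%R, +oo[) (gker s k x)%:E = 2%:E * Gint s k)%E.
Proof.
move=> s0 k1.
have k0 : 0 < k by exact: lt_le_trans k1.
pose f x : R := x `^ (- s) * (k - x) `^ (- s).
have f0 x : 0 <= f x by rewrite mulr_ge0 ?powR_ge0.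
have mf (E : set R) : measurable_fun E f.
  by apply: measurable_funM; [exact: measurable_powRl|exact: measurable_powR_refl].
have -> : (\int[mu]_(x in `]2^-1%R, +oo[) (gker s k x)%:E =
  \int[mu]_(x in `]2^-1%R, (k - 2^-1)%R[) (f x)%:E)%E.
  rewrite [LHS]integral_mkcond [RHS]integral_mkcond; apply: eq_integral => x _.
  rewrite !patchE !mem_setE !in_itv/= andbT gkerE.
  by case: ifP => //= _; case: ifP.
have [->|k1'] := eqVneq k 1.
  have -> : 1 - 2^-1 = 2^-1 :> R by field.
  by rewrite /Gint div1r set_itvoo0 !integral_set0 mule0.
have kgt1 : 1 < k by rewrite lt_neqAle eq_sym k1'.
rewrite (@integral_oo_split _ f _ (k / 2))//; last 2 first.
- by rewrite -[X in X < _]div1r ltr_pM2r// invr_gt0.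
- by rewrite ler_pdivrMr//; lra.
rewrite -/(Gint s k) -[2%:E]/(2%:R%:E) mule_natl mule2n; congr (_ + _)%E.
rewrite (@ge0_integral_affine _ _ _ (-1) k)//; last 2 first.
- exact/measurable_EFinP.
- by move=> x _; rewrite lee_fin.
rewrite normrN1 mul1e.
have -> : (fun y => -1 * y + k) @^-1` `](k / 2), (k - 2^-1)[%classic = `]2^-1, (k / 2)[%classic :> set R.
  by apply/seteqP; split => x /=; rewrite !in_itv/= => /andP[? ?]; apply/andP; split; lra.
by apply: eq_integral => x _; congr EFin; rewrite /f mulrC; congr (_ `^ _ * _ `^ _); ring.
Qed.

Lemma integral_regular_sqr u : 0 < u ->
  (\int[mu]_(t in D) (regular (1 + u) t ^+ 2)%:E =
   (2 `^ (1 + 2 * u) / (1 + 2 * u))%:E +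
   \sum_(0 <= k <oo) (2%:E * Fint (1 + u) k.+1%:R + 2%:E * Gint (1 + u) k.+1%:R))%E.
Proof.
move=> u0; have s0 : 0 <= 1 + u by rewrite addr_ge0// ltW.
have u1 : 0 < 1 + 2 * u by rewrite addr_gt0// mulr_gt0.
have md (E : set R) : measurable_fun E (dker (1 + u)).
  by apply: measurable_funM; exact: measurable_powRl.
have mh k (E : set R) : measurable_fun E (fun x => 2 * hker (1 + u) k.+1%:R x).
  by apply: measurable_funM => //; exact: measurable_hker.
have h0 k x : 0 <= 2 * hker (1 + u) k.+1%:R x by rewrite mulr_ge0 ?hker_ge0.
have mg k (E : set R) : measurable_fun E (gker (1 + u) k.+1%:R) by exact: measurable_gker.
have -> : (\int[mu]_(t in D) (regular (1 + u) t ^+ 2)%:E =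
  \int[mu]_(t in D) (unfolded (dker (1 + u)) t +
    \sum_(0 <= k <oo) unfolded (fun x => 2 * hker (1 + u) k.+1%:R x)%R t +
    \sum_(0 <= k <oo) unfolded (gker (1 + u) k.+1%:R) t))%E.
  by apply: eq_integral => t; rewrite inE => Dt; rewrite regular_sqr.
have m1 : measurable_fun D (unfolded (dker (1 + u))).
  by apply: measurable_unfolded => // x; exact: dker_ge0.
have m2 : measurable_fun D (fun t => \sum_(0 <= k <oo) unfolded (fun x => 2 * hker (1 + u) k.+1%:R x)%R t)%E.
  apply: measurable_nneseries => // [n|n x _]; first exact: measurable_unfolded.
  exact: unfolded_ge0.
have m3 : measurable_fun D (fun t => \sum_(0 <= k <oo) unfolded (gker (1 + u) k.+1%:R) t)%E.
  apply: measurable_nneseries => // [n|n x _].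
    by apply: measurable_unfolded => // x; exact: gker_ge0.
  by apply: unfolded_ge0 => y; exact: gker_ge0.
have p1 x : (0 <= unfolded (dker (1 + u)) x)%E by apply: unfolded_ge0 => y; exact: dker_ge0.
have p2 x : (0 <= \sum_(0 <= k <oo) unfolded (fun x => 2 * hker (1 + u) k.+1%:R x)%R x)%E.
  by apply: nneseries_ge0 => n _ _; apply: unfolded_ge0.
have p3 x : (0 <= \sum_(0 <= k <oo) unfolded (gker (1 + u) k.+1%:R) x)%E.
  by apply: nneseries_ge0 => n _ _; apply: unfolded_ge0 => y; exact: gker_ge0.
rewrite ge0_integralD//; last 2 first.
- by move=> x _; rewrite adde_ge0.
- exact: emeasurable_funD.
rewrite ge0_integralD// integral_unfolded//; last by move=> x; exact: dker_ge0.
rewrite !integral_unfolded_series//; last by move=> k x; exact: gker_ge0.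
rewrite -addeA; congr (_ + _)%E.
  have -> : (\int[mu]_(x in `]2^-1%R, +oo[) (dker (1 + u) x)%:E =
    \int[mu]_(x in `]2^-1%R, +oo[) (x `^ (- (1 + (1 + 2 * u))))%:E)%E.
    apply: eq_integral => x; rewrite inE/= in_itv/= andbT => xh.
    by rewrite dkerE// (lt_trans _ xh)// invr_gt0.
  rewrite integral_pow_tail ?invr_gt0//; congr (_ / _)%:E.
  by rewrite -powR_inv1// -powRrM mulrNN mul1r.
rewrite -nneseriesD; last 2 first.
- by move=> k _ _; apply: integral_ge0 => x _; rewrite lee_fin.
- by move=> k _ _; apply: integral_ge0 => x _; rewrite lee_fin gker_ge0.
apply: eq_eseriesr => k _; rewrite integral_gker ?ler1n//; congr (_ + _)%E.
under eq_integral do rewrite EFinM.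
rewrite ge0_integralZl_EFin//.
- by move=> x _; rewrite lee_fin hker_ge0.
- by apply/measurable_EFinP; exact: measurable_hker.
Qed.

End SquareIntegral.

Lemma preimage_reflect (R : realType) :
  (fun y : R => -1 * y + 1) @^-1` `]2^-1, 1[%classic = `]0, 2^-1[%classic.
Proof. by apply/seteqP; split => x /=; rewrite !in_itv/= => /andP[? ?]; apply/andP; split; lra. Qed.

(** * Integral of the film density *)
Section FilmIntegral.
Context {R : realType}.
Implicit Types (a b c p x y u t v s : R).
Notation mu := (@lebesgue_measure R).
Notation Gam := (@gam R).
Notation zeta := (@riemann_zeta R).

Let D : set R := `]0, 2^-1[%classic.
Let mD : measurable D. Proof. exact: measurable_itv. Qed.
Let h20 : 0 < 2^-1 :> R. Proof. by rewrite invr_gt0. Qed.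
Let h21 : 2^-1 < 1 :> R. Proof. by rewrite invf_lt1// ltr1n. Qed.
Let D_lt t : D t -> 0 < t < 2^-1. Proof. by rewrite /D/= in_itv. Qed.
Let D_lt1 t : D t -> 0 < t < 1.
Proof. by move=> /D_lt/andP[-> h]; rewrite (lt_trans h). Qed.

Lemma fp_value_le0 u : 0 < u <= 1 -> fp_value u <= 0.
Proof.
move=> /andP[u0]; rewrite le_eqVlt => /orP[/eqP->|u1].
  by rewrite /fp_value mulr1 cospi subrr oppr0 mul0r.
rewrite /fp_value mulNr oppr_le0 mulr_ge0//.
have g1 : 0 < Gam (1 + 2 * u) by rewrite Gam_gt0// addr_gt0// mulr_gt0.
have g2 : 0 < Gam (1 - u) by rewrite Gam_gt0// subr_gt0.
have g3 : 0 < Gam (1 + u) by rewrite Gam_gt0// addr_gt0.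
by rewrite divr_ge0// mulr_ge0// ltW.
Qed.

Lemma zeta_ge0 u : 0 < u -> 0 <= zeta (1 + u).
Proof.
move=> u0; rewrite -lee_fin -ezetaE//; apply: nneseries_ge0 => n _ _.
by rewrite lee_fin powR_ge0.
Qed.

Lemma Fint_ge0 s (k : R) : (0 <= Fint s k)%E.
Proof. by apply: integral_ge0 => x _; rewrite lee_fin mulr_ge0 ?powR_ge0. Qed.

Lemma Gint_ge0 s (k : R) : (0 <= Gint s k)%E.
Proof. by apply: integral_ge0 => x _; rewrite lee_fin mulr_ge0 ?powR_ge0. Qed.

Lemma Nint_ge0 s (k : R) : 0 <= s -> 1 <= k -> (0 <= Nint s k)%E.
Proof.
move=> s0 k1; apply: integral_ge0 => x; rewrite -/D => /D_lt1/andP[x0 x1].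
by rewrite lee_fin mulr_ge0 ?powR_ge0// n_integrand_ge0// (ltW x0) (lt_le_trans x1).
Qed.

(** Since [fp_value] is nonpositive, its zeta series is carried to the left side, so that only
    series of nonnegative terms are added. *)
Lemma FGN_series u : 0 < u <= 1 ->
  (\sum_(0 <= k <oo) (Fint (1 + u) k.+1%:R + Gint (1 + u) k.+1%:R + Nint (1 + u) k.+1%:R) =
   (fp_value u * zeta (1 + 2 * u) + 2 * 2 `^ u / u * zeta (1 + u))%:E)%E.
Proof.
move=> uI; have /andP[u0 u1] := uI.
have s0 : 0 <= 1 + u by rewrite addr_ge0// ltW.
have u20 : 0 < 2 * u by rewrite mulr_gt0.
have k1 (k : nat) : (1 : R) <= k.+1%:R by rewrite ler1n.
pose x (k : nat) : R := k.+1%:R `^ (- (1 + 2 * u)).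
pose y (k : nat) : R := k.+1%:R `^ (- (1 + u)).
pose be := 2 * 2 `^ u / u.
have be0 : 0 <= be by rewrite divr_ge0 ?mulr_ge0 ?powR_ge0// ltW.
have x0 k : 0 <= x k by exact: powR_ge0.
have y0 k : 0 <= y k by exact: powR_ge0.
have E k : (Fint (1 + u) k.+1%:R + Gint (1 + u) k.+1%:R + Nint (1 + u) k.+1%:R =
  (fp_value u * x k + be * y k)%:E)%E by rewrite FGN_int_value.
have c0 k : (0 <= (fp_value u * x k + be * y k)%:E)%E.
  rewrite -E; apply: adde_ge0; last exact: Nint_ge0.
  by apply: adde_ge0; [exact: Fint_ge0|exact: Gint_ge0].
under eq_eseriesr do rewrite E.
have f0 : 0 <= - fp_value u by rewrite oppr_ge0 fp_value_le0.
have : (\sum_(0 <= k <oo) (fp_value u * x k + be * y k)%:E +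
  (- fp_value u)%:E * (zeta (1 + 2 * u))%:E = be%:E * (zeta (1 + u))%:E)%E.
  rewrite -!ezetaE// -!nneseriesZl; last 2 first.
  - by move=> n _; rewrite lee_fin powR_ge0.
  - by move=> n _; rewrite lee_fin powR_ge0.
  rewrite -nneseriesD; last 2 first.
  - by move=> n _ _; exact: c0.
  - by move=> n _ _; rewrite -EFinM lee_fin mulr_ge0// powR_ge0.
  by apply: eq_eseriesr => n _; rewrite -!EFinM -EFinD; congr EFin; rewrite /x /y; ring.
have : (0 <= \sum_(0 <= k <oo) (fp_value u * x k + be * y k)%:E)%E.
  by apply: nneseries_ge0 => n _ _; exact: c0.
case: (\sum_(0 <= k <oo) _)%E => [r||]// _.
by rewrite -!EFinM -EFinD => H; have {}H := EFin_inj H; congr EFin; rewrite -/be; lra.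
Qed.

(** The middle term comes from the diagonal of Q^2; subtracting the integral of (1 - t)^(-2s) will
    reduce it to 1 / (1 + 2u). *)
Definition energy_part u : R :=
  2 * zeta (1 + u) ^+ 2 + 2 `^ (1 + 2 * u) / (1 + 2 * u) + 2 * fp_value u * zeta (1 + 2 * u).

(** The term 2 t^-s E supplies 2N for every distance and Q^2 supplies 2F + 2G; only together do they
    form the groups evaluated in [FGN_series]. *)
Lemma integral_excess_energy u : 0 < u <= 1 ->
  (\int[mu]_(t in D) (2 * (t `^ (- (1 + u)) * excess (1 + u) t) + excess (1 + u) t ^+ 2)%:E =
   (energy_part u)%:E)%E.
Proof.
move=> uI; have /andP[u0 u1] := uI.
have s0 : 0 <= 1 + u by rewrite addr_ge0// ltW.
have z0 := zeta_ge0 u0.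
have k1 (k : nat) : (1 : R) <= k.+1%:R by rewrite ler1n.
have me := measurable_excess u0; have mr := measurable_regular u0.
have pe t : D t -> 0 <= t `^ (- (1 + u)) * excess (1 + u) t.
  by move=> /D_lt1 tI; rewrite mulr_ge0 ?powR_ge0// excess_ge0.
have mpe : measurable_fun D (fun t => t `^ (- (1 + u)) * excess (1 + u) t).
  by apply: measurable_funM => //; exact: measurable_powRl.
have mee : measurable_fun D (fun t => (excess (1 + u) t ^+ 2)%:E).
  by apply/measurable_EFinP; exact: measurable_funX.
have mrr : measurable_fun D (fun t => (regular (1 + u) t ^+ 2)%:E).
  by apply/measurable_EFinP; exact: measurable_funX.
have r0 t : D t -> 0 <= regular (1 + u) t.
  move=> /D_lt1 tI; rewrite -lee_fin -regular_sum//; apply: nneseries_ge0 => n _ _.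
  by rewrite lee_fin addr_ge0 ?powR_ge0.
(* E^2 = Q^2 - 4 zeta(s) Q + 4 zeta(s)^2 with the negative term moved to the left; the constant is
   halved by the length of the interval. *)
have HE : (\int[mu]_(t in D) (excess (1 + u) t ^+ 2)%:E + (4 * zeta (1 + u) * (2 `^ u / u))%:E =
  \int[mu]_(t in D) (regular (1 + u) t ^+ 2)%:E + (2 * zeta (1 + u) ^+ 2)%:E)%E.
  have -> : ((2 * zeta (1 + u) ^+ 2)%:E = \int[mu]_(t in D) cst (4 * zeta (1 + u) ^+ 2)%:E t)%E.
    rewrite integral_cst//= /D lebesgue_measure_itv/= lte_fin invr_gt0 ltr0n/= -EFinD subr0 -EFinM.
    by congr EFin; field.
  have c40 : 0 <= 4 * zeta (1 + u) by rewrite mulr_ge0.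
  rewrite EFinM -integral_regular// -/D -(ge0_integralZl_EFin _ _ _ _ c40)//; last exact/measurable_EFinP.
  rewrite -ge0_integralD//; last 3 first.
  - by move=> t _; rewrite lee_fin sqr_ge0.
  - by move=> t Dt; rewrite -EFinM lee_fin mulr_ge0// r0.
  - by apply: emeasurable_funM => //; exact/measurable_EFinP.
  rewrite -ge0_integralD//; last 2 first.
  - by move=> t _; rewrite lee_fin sqr_ge0.
  - by move=> t _; rewrite /cst lee_fin mulr_ge0// sqr_ge0.
  apply: eq_integral => t _; rewrite /cst -EFinM -!EFinD; congr EFin.
  by rewrite /excess; ring.
under eq_integral do rewrite EFinD EFinM.
rewrite ge0_integralD//; last 3 first.
- by move=> t Dt; rewrite -EFinM lee_fin mulr_ge0// pe.
- by apply: emeasurable_funM => //; exact/measurable_EFinP.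
- by move=> t _; rewrite lee_fin sqr_ge0.
rewrite ge0_integralZl_EFin//; last exact/measurable_EFinP.
rewrite integral_pow_excess//.
have SN0 : (0 <= \sum_(0 <= k <oo) Nint (1 + u) k.+1%:R)%E.
  by apply: nneseries_ge0 => n _ _; exact: Nint_ge0.
have ee0 : (0 <= \int[mu]_(t in D) (excess (1 + u) t ^+ 2)%:E)%E.
  by apply: integral_ge0 => t _; rewrite lee_fin sqr_ge0.
have : (2%:E * \sum_(0 <= k <oo) Nint (1 + u) k.+1%:R + \int[mu]_(t in D) (excess (1 + u) t ^+ 2)%:E
   + (4 * zeta (1 + u) * (2 `^ u / u))%:E =
  (2 `^ (1 + 2 * u) / (1 + 2 * u))%:E + 2%:E * (fp_value u * zeta (1 + 2 * u) + 2 * 2 `^ u / u * zeta (1 + u))%:E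
   + (2 * zeta (1 + u) ^+ 2)%:E)%E.
  rewrite -addeA HE integral_regular_sqr// -FGN_series// addeA; congr (_ + _)%E.
  rewrite addeCA; congr (_ + _)%E.
  have FG0 k : (0 <= Fint (1 + u) k.+1%:R + Gint (1 + u) k.+1%:R)%E by rewrite adde_ge0 ?Fint_ge0 ?Gint_ge0.
  rewrite -!nneseriesZl; last 2 first.
  - by move=> k _; rewrite adde_ge0// Nint_ge0.
  - by move=> k _; exact: Nint_ge0.
  rewrite -nneseriesD; last 2 first.
  - by move=> k _ _; rewrite mule_ge0// Nint_ge0.
  - by move=> k _ _; rewrite adde_ge0// mule_ge0// ?Fint_ge0 ?Gint_ge0.
  apply: eq_eseriesr => k _.
  by rewrite -ge0_muleDr ?Fint_ge0 ?Gint_ge0// -ge0_muleDr ?Nint_ge0// addeC.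
have : (0 <= 2%:E * \sum_(0 <= k <oo) Nint (1 + u) k.+1%:R + \int[mu]_(t in D) (excess (1 + u) t ^+ 2)%:E)%E.
  by rewrite adde_ge0// mule_ge0.
case: (_ + _)%E => [r||]// _.
rewrite -!EFinM -!EFinD => H; have {}H := EFin_inj H; congr EFin; rewrite /energy_part.
have -> : r = 2 `^ (1 + 2 * u) / (1 + 2 * u) + 2 * (fp_value u * zeta (1 + 2 * u) + 2 * 2 `^ u / u * zeta (1 + u)) +
  2 * zeta (1 + u) ^+ 2 - 4 * zeta (1 + u) * (2 `^ u / u) by rewrite -H addrK.
by ring.
Qed.

Lemma integral_pow_reflect u : 0 < u ->
  (\int[mu]_(t in D) ((1 - t) `^ (- (1 + u)))%:E = ((2 `^ u - 1) / u)%:E)%E.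
Proof.
move=> u0.
have := @integral_oy_split _ (fun x => x `^ (- (1 + u))) 2^-1 1 h21.
rewrite !integral_pow_tail// => H.
have mm : measurable_fun (`]2^-1, +oo[%classic : set R) (fun x => x `^ (- (1 + u))) by exact: measurable_powRl.
have {}H := H mm (fun x _ => powR_ge0 _ _).
rewrite (@ge0_integral_affine _ _ _ (-1) 1)// in H; last 2 first.
- by apply/measurable_EFinP; exact: measurable_powRl.
- by move=> x _; rewrite lee_fin powR_ge0.
move: H; rewrite normrN1 mul1e.
have -> : (fun y : R => -1 * y + 1) @^-1` `]2^-1, 1[%classic = D.
  exact: preimage_reflect.
have -> : (\int[mu]_(x in D) ((-1 * x + 1) `^ (- (1 + u)))%:E =
  \int[mu]_(t in D) ((1 - t) `^ (- (1 + u)))%:E)%E.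
  by apply: eq_integral => x _; rewrite mulN1r addrC.
have : (0 <= \int[mu]_(t in D) ((1 - t) `^ (- (1 + u)))%:E)%E.
  by apply: integral_ge0 => x _; rewrite lee_fin powR_ge0.
case: integral => [r||]// _.
rewrite -EFinD => H; have {}H := EFin_inj H; congr EFin.
rewrite mulrBl mul1r powR1 mul1r in H *.
have -> : 2 `^ u = 2^-1 `^ (- u) by rewrite -[2^-1]powR_inv1// -powRrM mulrNN mul1r.
by rewrite H addrK.
Qed.

(* The film propagator and integrand in the dimensionless variable t = z / L. *)
Definition bracket s t : R := 2 * zeta s - hurwitz_zeta s t - hurwitz_zeta s (1 - t).
Definition film_density s t : R :=
  bracket s t ^+ 2 - (t `^ (- s)) ^+ 2 - ((1 - t) `^ (- s)) ^+ 2.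

Lemma film_density_sym s t : film_density s (1 - t) = film_density s t.
Proof. by rewrite /film_density /bracket subKr; ring. Qed.

Lemma measurable_hurwitz u (E : set R) : measurable E -> 0 < u -> (forall x, E x -> 0 < x) ->
  measurable_fun E (hurwitz_zeta (1 + u)).
Proof.
move=> mE u0 E0; apply/measurable_EFinP.
apply: (@eq_measurable_fun _ _ _ _ E (fun x => \sum_(0 <= k <oo) ((k%:R + x) `^ (- (1 + u)))%:E)%E).
  by move=> x; rewrite inE => /E0 x0; rewrite hurwitz_series.
apply: measurable_nneseries => // [n|n x _]; last by rewrite lee_fin powR_ge0.
by apply/measurable_EFinP; exact: measurable_powR_shift.
Qed.

Lemma measurable_hurwitz_reflect u (E : set R) : measurable E -> 0 < u -> (forall x, E x -> x < 1) ->
  measurable_fun E (fun x => hurwitz_zeta (1 + u) (1 - x)).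
Proof.
move=> mE u0 E0; apply/measurable_EFinP.
apply: (@eq_measurable_fun _ _ _ _ E (fun x => \sum_(0 <= k <oo) ((k%:R + 1 - x) `^ (- (1 + u)))%:E)%E).
  move=> x; rewrite inE => /E0 x1; rewrite /= -hurwitz_series ?subr_gt0//.
  by apply: eq_eseriesr => k _; rewrite addrA.
apply: measurable_nneseries => // [n|n x _]; last by rewrite lee_fin powR_ge0.
by apply/measurable_EFinP; exact: measurable_powR_refl.
Qed.

Lemma measurable_film_density u : 0 < u -> measurable_fun (`]0, 1[%classic : set R) (film_density (1 + u)).
Proof.
move=> u0; have mb : measurable_fun (`]0, 1[%classic : set R) (bracket (1 + u)).
  apply: measurable_funB; first apply: measurable_funB => //.
  - by apply: measurable_hurwitz => // x; rewrite /= in_itv/= => /andP[].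
  - by apply: measurable_hurwitz_reflect => // x; rewrite /= in_itv/= => /andP[].
apply: measurable_funB; first apply: measurable_funB.
- exact: measurable_funX.
- by apply: measurable_funX; exact: measurable_powRl.
- by apply: measurable_funX; exact: measurable_powR_refl.
Qed.

Lemma ge0_integrable (E : set R) (f : R -> R) c : measurable E -> measurable_fun E f ->
  (forall x, E x -> 0 <= f x) -> (\int[mu]_(x in E) (f x)%:E = c%:E)%E ->
  mu.-integrable E (fun x => (f x)%:E).
Proof.
move=> mE mf f0 fc; apply/integrableP; split; first exact/measurable_EFinP.
rewrite (_ : (\int[mu]_(x in E) `|(f x)%:E|)%E = (\int[mu]_(x in E) (f x)%:E)%E).
  by rewrite fc ltry.
by apply: eq_integral => x; rewrite inE => /f0 fx; rewrite gee0_abs// lee_fin.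
Qed.

Lemma film_density_half u : 0 < u <= 1 ->
  mu.-integrable D (fun t => (film_density (1 + u) t)%:E) /\
  (\int[mu]_(t in D) (film_density (1 + u) t)%:E =
   (2 * zeta (1 + u) ^+ 2 + (1 + 2 * u)^-1 + 2 * fp_value u * zeta (1 + 2 * u))%:E)%E.
Proof.
move=> uI; have /andP[u0 u1] := uI.
pose f t := 2 * (t `^ (- (1 + u)) * excess (1 + u) t) + excess (1 + u) t ^+ 2.
pose g t : R := (1 - t) `^ (- (1 + (1 + 2 * u))).
have u20 : 0 < 1 + 2 * u by rewrite addr_gt0// mulr_gt0.
have Ef := integral_excess_energy uI.
have Eg := integral_pow_reflect u20.
have mf : measurable_fun D f.
  have me := measurable_excess u0.
  apply: measurable_funD; last exact: measurable_funX.
  by apply: measurable_funM => //; apply: measurable_funM => //; exact: measurable_powRl.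
have f0 t : D t -> 0 <= f t.
  by move=> /D_lt1 tI; rewrite addr_ge0 ?sqr_ge0// mulr_ge0// mulr_ge0 ?powR_ge0// excess_ge0.
have If := ge0_integrable mD mf f0 Ef.
have Ig : mu.-integrable D (fun x => (g x)%:E).
  apply: (ge0_integrable mD _ _ Eg); first exact: measurable_powR_refl.
  by move=> x _; exact: powR_ge0.
(* Here t^-2s disappears, pointwise; the (1 - t)^-2s kept in [g] is bounded on (0, 1/2). *)
have E t : D t -> film_density (1 + u) t = f t - g t.
  move=> /D_lt1/andP[t0 t1]; have y0 : 0 < 1 - t by rewrite subr_gt0.
  rewrite /film_density /f /g -(dkerE u y0) /dker /excess /regular /bracket; ring.
have EE : (\int[mu]_(t in D) (film_density (1 + u) t)%:E = \int[mu]_(t in D) ((f t)%:E - (g t)%:E))%E.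
  by apply: eq_integral => t; rewrite inE => Dt; rewrite E// EFinB.
split.
  apply: (@eq_integrable _ _ _ mu D mD (fun t => (f t)%:E - (g t)%:E)%E); last exact: integrableB.
  move=> t; rewrite inE => Dt.
  by rewrite /= E// EFinB.
rewrite EE integralB// Ef Eg -EFinB; congr EFin; rewrite /energy_part.
by field; rewrite gt_eqF.
Qed.

(** The signed form of [ge0_integral_affine], by positive and negative parts; finiteness of the
    negative part lets |a| distribute over their difference. *)
Lemma integrable_affine (E : set R) (f : R -> R) a b : a != 0 -> measurable E ->
  measurable_fun E f ->
  mu.-integrable ((fun y => a * y + b) @^-1` E) (fun x => (f (a * x + b))%:E) ->
  mu.-integrable E (fun x => (f x)%:E) /\
  (\int[mu]_(x in E) (f x)%:E =
   `|a|%:E * \int[mu]_(x in (fun y => (a * y + b)%R) @^-1` E) (f (a * x + b)%R)%:E)%E.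
Proof.
move=> a0 mE mf If.
have mfe : measurable_fun E (fun x => (f x)%:E) by exact/measurable_EFinP.
have mP : measurable ((fun y => a * y + b) @^-1` E).
  rewrite -[X in measurable X]setTI.
  have : measurable_fun setT (fun y : R => a * y + b).
    by apply: measurable_funD => //; apply: measurable_funM.
  by apply.
have If' : mu.-integrable E (fun x => (f x)%:E).
  apply/integrableP; split => //.
  rewrite (@ge0_integral_affine _ _ _ a b)//; last exact: measurableT_comp.
  have /integrableP[_ h] := If.
  by rewrite lte_mul_pinfty// ltry.
split => //.
rewrite [LHS]integralE [X in (_ * X)%E]integralE.
rewrite (@ge0_integral_affine _ _ _ a b)//; last exact: measurable_funepos.
rewrite (@ge0_integral_affine _ _ (funeneg _) a b)//; last exact: measurable_funeneg.
rewrite [RHS]muleBr//; last first.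
  apply: fin_num_adde_defl; rewrite fin_numN.
  exact: integrable_neg_fin_num If.
congr (_ * _ - _ * _)%E; apply: eq_integral => x _; first by rewrite !funeposE.
by rewrite !funenegE.
Qed.

Lemma film_density_int u : 0 < u <= 1 ->
  mu.-integrable `]0, 1[ (fun t => (film_density (1 + u) t)%:E) /\
  (\int[mu]_(t in `]0%R, 1%R[) (film_density (1 + u) t)%:E =
   (4 * (zeta (1 + u) ^+ 2 + fp_value u * zeta (1 + 2 * u)) + 2 / (1 + 2 * u))%:E)%E.
Proof.
move=> uI; have /andP[u0 u1] := uI.
have mf := measurable_film_density u0.
have mfe : measurable_fun (`]0, 1[%classic : set R) (fun t => (film_density (1 + u) t)%:E).
  exact/measurable_EFinP.
have [I1 E1] := film_density_half uI.
have PD : (fun y : R => -1 * y + 1) @^-1` `]2^-1, 1[%classic = D.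
  exact: preimage_reflect.
have fE x : film_density (1 + u) (-1 * x + 1) = film_density (1 + u) x.
  by rewrite mulN1r [- x + 1]addrC film_density_sym.
have S2 : `]2^-1, 1[%classic `<=` (`]0, 1[%classic : set R).
  by move=> x /=; rewrite !in_itv/= => /andP[h ->]; rewrite (lt_trans h20).
have m2 : measurable_fun (`]2^-1, 1[%classic : set R) (film_density (1 + u)).
  exact: measurable_funS mf.
have [] := @integrable_affine `]2^-1, 1[%classic (film_density (1 + u)) (-1) 1 _ _ m2 _ => //.
  by rewrite PD; apply: eq_integrable I1 => // x _; rewrite fE.
rewrite PD normrN1 mul1e => I2 E2.
have {}E2 : (\int[mu]_(t in `]2^-1%R, 1%R[) (film_density (1 + u) t)%:E =
    \int[mu]_(t in D) (film_density (1 + u) t)%:E)%E.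
  by rewrite E2; apply: eq_integral => x _; rewrite fE.
rewrite E1 in E2.
have U : (`]0, 1[%classic : set R) = D `|` `[2^-1, 1[%classic.
  rewrite /D; apply/seteqP; split => x /=; rewrite !in_itv/=.
    by move=> /andP[x0 x1]; have [h|h] := ltP x 2^-1; [left|right]; rewrite ?x0 ?x1.
  move=> [/andP[x0 x1]|/andP[x0 x1]]; apply/andP; split => //.
    exact: lt_trans h21.
  exact: lt_le_trans x0.
have dis : [disjoint D & `[2^-1, 1[%classic].
  apply/disj_setPS => x [] /=; rewrite !in_itv/= => /andP[_ h] /andP[h' _].
  by move: (lt_le_trans h h'); rewrite ltxx.
split.
  apply/integrableP; split => //.
  rewrite U integral_setU//; last by rewrite -U; exact: measurableT_comp.
  rewrite -integral_itv_obnd_cbnd; last by apply: measurableT_comp => //; exact/measurable_EFinP.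
  have /integrableP[_ h1] := I1; have /integrableP[_ h2] := I2.
  by rewrite lte_add_pinfty.
rewrite U integral_setU//; last by rewrite -U.
rewrite -integral_itv_obnd_cbnd; last exact/measurable_EFinP.
rewrite E1 E2 -EFinD; congr EFin.
by field; rewrite gt_eqF// addr_gt0// mulr_gt0.
Qed.

Lemma half_space_scale (eps L z : R) : 0 < L -> 0 < z ->
  half_space_propagator eps z ^+ 2 =
  (propagator_const eps * (2 * L) `^ (- (2 - eps))) ^+ 2 * ((z / L) `^ (- (2 - eps))) ^+ 2.
Proof.
move=> L0 z0; rewrite /half_space_propagator mulNr sqrrN -exprMn -[in RHS]mulrA.
rewrite -powRM ?mulr_ge0 ?invr_ge0 ?(ltW L0) ?(ltW z0)//.
have -> : 2 * L * (z / L) = 2 * z by field; rewrite gt_eqF.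
by rewrite opprB addrC.
Qed.

Lemma film_integrand_scale (eps L z : R) : 0 < L -> 0 < z < L ->
  film_integrand eps L z =
  (propagator_const eps * (2 * L) `^ (- (2 - eps))) ^+ 2 * film_density (2 - eps) (z / L).
Proof.
move=> L0 /andP[z0 zL].
rewrite /film_integrand (half_space_scale _ L0 z0) (half_space_scale _ L0 (_ : 0 < L - z)) ?subr_gt0//.
rewrite mulrBl mulfV ?gt_eqF// /film_density /film_propagator -/(bracket _ _).
have -> : -2 + eps = - (2 - eps) by ring.
by ring.
Qed.

End FilmIntegral.

(** * The limit of the second term *)
Section SecondTerm.
Context {R : realType}.
Implicit Types (a b x y u e : R).
Notation mu := (@lebesgue_measure R).
Notation Gam := (@gam R).
Notation zeta := (@riemann_zeta R).

Lemma powR_le_add t a x b : 0 < t -> a <= x <= b -> t `^ x <= t `^ a + t `^ b.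
Proof.
move=> t0 /andP[ax xb]; have [t1|t1] := leP t 1.
  by rewrite ler_wpDr ?powR_ge0// ger_powR// t0 t1.
by rewrite ler_wpDl ?powR_ge0// ler_powR// ltW.
Qed.

(** A local bound that stands in for continuity: the limit to be proved is 0, so it is enough that
    the gamma factors stay bounded. *)
Lemma Gam_le_add a x b : 0 < a -> a <= x <= b -> Gam x <= Gam a + Gam b.
Proof.
move=> a0 axb; have /andP[ax xb] := axb.
have x0 : 0 < x by exact: lt_le_trans ax.
have b0 : 0 < b by exact: lt_le_trans xb.
rewrite -lee_fin EFinD -!eGammaE// /eGamma -ge0_integralD//; last 4 first.
- by move=> t _; rewrite lee_fin gamma_integrand_ge0.
- exact: measurable_gamma_integrand.
- by move=> t _; rewrite lee_fin gamma_integrand_ge0.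
- exact: measurable_gamma_integrand.
apply: ge0_le_integral => //.
- by move=> t _; rewrite lee_fin gamma_integrand_ge0.
- exact: measurable_gamma_integrand.
- by apply: emeasurable_funD; exact: measurable_gamma_integrand.
move=> t; rewrite /= in_itv/= andbT => t0.
rewrite -EFinD lee_fin -mulrDl ler_wpM2r ?expR_ge0// powR_le_add//.
by rewrite !lerB.
Qed.

Lemma zeta_le u y : 0 < u <= y -> zeta (1 + y) <= zeta (1 + u).
Proof.
move=> /andP[u0 uy]; have y0 : 0 < y by exact: lt_le_trans uy.
rewrite -lee_fin -!ezetaE//; apply: lee_nneseries => n _.
  by rewrite lee_fin powR_ge0.
by rewrite lee_fin ler_powR ?ler1n// lerN2 lerD2l.
Qed.

Lemma GammaE x : 0 < x -> Gamma x = Gam x.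
Proof. by move=> x0; rewrite gam.unlock /Gamma x0. Qed.

Lemma Gamma_neg u : 0 < u < 1 -> Gamma (- u) = Gam (1 - u) / - u.
Proof.
move=> /andP[u0 u1]; rewrite gam.unlock /Gamma oppr_gt0 ltNge (ltW u0)/= opprK.
rewrite (@truncn_def _ u 0%N) ?(ltW u0)//.
by rewrite big_ord1 addr0 [- u + 1]addrC.
Qed.

(** For e > 0 the argument lies in (-1, 0) and the continuation takes one step; for e < 0 it lies in
    (-2, -1) and takes two. Both give the same quotient. *)
Lemma Gamma_neg1 e : e != 0 -> `|e| < 1 -> Gamma (- 1 + e) = Gam (1 + e) / ((e - 1) * e).
Proof.
move=> e0; rewrite ltr_norml => /andP[em e1]; have [ep|en] := ltP 0 e.
  have -> : -1 + e = - (1 - e) by ring.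
  rewrite Gamma_neg ?subr_gt0 ?e1 ?gtrBl// subKr [1 + e]addrC GamS//.
  by field; rewrite e0 subr_eq0 lt_eqF//= subr_eq0 gt_eqF.
have {}en : e < 0 by rewrite lt_neqAle e0.
have h : 0 < -1 + e = false by apply/negbTE; rewrite -leNgt; lra.
rewrite gam.unlock /Gamma h (@truncn_def _ _ 1%N); last by apply/andP; split; lra.
rewrite !big_ord_recl big_ord0 mulr1/= addr0.
have -> : -1 + e + 2 = 1 + e by ring.
have -> : -1 + e + (bump 0 0)%:R = e by rewrite /bump/=; ring.
by rewrite [-1 + e]addrC.
Qed.

(** Gamma(-u) = -Gamma(1 - u) / u supplies the sign and the factor 1/u of [fp_value]; 1 - cos(pi (1
    - u)) is its 1 + cos(pi u). *)
Lemma second_term_fp u : 0 < u < 1 ->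
  second_term (1 - u) = fp_value u * zeta (1 + 2 * u).
Proof.
move=> uI; have /andP[u0 u1] := uI; rewrite /second_term /Beta.
have -> : 3 - 2 * (1 - u) = 1 + 2 * u by ring.
have -> : -1 + (1 - u) = - u by ring.
have -> : 1 + 2 * u + - u = 1 + u by ring.
rewrite Gamma_neg// !GammaE ?addr_gt0 ?mulr_gt0//.
have -> : pi * (1 - u) = - (pi * u) + pi by ring.
rewrite cosDpi cosN /fp_value; congr (_ * _).
by field; rewrite !gt_eqF// Gam_gt0// addr_gt0.
Qed.

Lemma second_termE e : e != 0 -> `|e| < 1 -> second_term e =
  (1 - cos (pi * e)) * (Gam (3 - 2 * e) * (Gam (1 + e) / ((e - 1) * e)) / Gam (2 - e)) *
  zeta (1 + (2 - 2 * e)).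
Proof.
move=> e0 e1; have := e1; rewrite ltr_norml => /andP[em ep].
rewrite /second_term /Beta Gamma_neg1//.
have -> : 3 - 2 * e + (-1 + e) = 2 - e by ring.
rewrite !GammaE; [|lra|lra].
by congr (_ * zeta _); ring.
Qed.

Lemma Gam2 : Gam 2 = 1.
Proof. by rewrite -[2]/(1 + 1) GamS// Gam1 mul1r. Qed.

(** Log-convexity about 2, where the value is 1, bounds the reciprocal by Gam(2 + e), and 2 + e lies
    between 1 and 3. *)
Lemma Gam_inv_le e : `|e| < 1 -> (Gam (2 - e))^-1 <= Gam 1 + Gam 3.
Proof.
move=> e1; have := e1; rewrite ltr_norml => /andP[em ep].
have g0 : 0 < Gam (2 - e) by rewrite Gam_gt0//; lra.
rewrite -[leLHS]mul1r ler_pdivrMr//.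
apply: (@le_trans _ _ (Gam (2 + e) * Gam (2 - e))); last first.
  by rewrite ler_wpM2r ?(ltW g0)// Gam_le_add//; apply/andP; split; lra.
rewrite -[leLHS](expr1n _ 2) -[X in X ^+ 2]Gam2; have [e0|e0] := leP 0 e.
  by apply: Gam_midpoint; rewrite e0/=; lra.
have := @Gam_midpoint _ (- e) 2; rewrite opprK mulrC; apply.
by apply/andP; split; lra.
Qed.

Lemma second_term_le : exists K : R, forall e, e != 0 -> `|e| < 4^-1 ->
  `|second_term e| <= K * `|e|.
Proof.
(* For |e| < 1/4 the arguments 3 - 2e and 1 + e lie in [2, 4] and [1/2, 2], and 2 - 2e >= 1, so M
   bounds the gamma and zeta factors. The factor pi^2 is the pi^2/2 from 1 - cos(pi e) times the
   bound 2 for 1 / (1 - e). *)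
pose M := (Gam 2 + Gam 4) * (Gam 2^-1 + Gam 2) * (Gam 1 + Gam 3) * zeta (1 + 1).
exists (pi ^+ 2 * M) => e e0 e4.
have e1 : `|e| < 1 by apply: lt_trans e4 _; rewrite invf_lt1// ltr1n.
have := e4; rewrite ltr_norml => /andP[em ep].
have w0 : 0 < `|e| by rewrite normr_gt0.
have A0 : 0 <= 1 - cos (pi * e) by rewrite subr_ge0 cos_le1.
have A1 : 1 - cos (pi * e) <= pi ^+ 2 / 2 * `|e| * `|e|.
  have -> : cos (pi * e) = cos (pi * `|e|).
    by have [h|h] := leP 0 e; rewrite ?(ger0_norm h)// (ltr0_norm h) mulrN cosN.
  have -> : pi ^+ 2 / 2 * `|e| * `|e| = (pi * `|e|) ^+ 2 / 2 by ring.
  by rewrite one_sub_cos_le// mulr_ge0// pi_ge0.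
have A2 : (1 - cos (pi * e)) / `|e| <= pi ^+ 2 / 2 * `|e| by rewrite ler_pdivrMr.
have g1 : 0 < Gam (3 - 2 * e) by rewrite Gam_gt0//; lra.
have g2 : 0 < Gam (1 + e) by rewrite Gam_gt0//; lra.
have g3 : 0 < Gam (2 - e) by rewrite Gam_gt0//; lra.
have z0 : 0 <= zeta (1 + (2 - 2 * e)) by apply: zeta_ge0; lra.
have i0 : 0 < 1 - e by lra.
have i1 : (1 - e)^-1 <= 2 by rewrite -[leLHS]mul1r ler_pdivrMr//; lra.
rewrite second_termE//.
have -> : `|(1 - cos (pi * e)) * (Gam (3 - 2 * e) * (Gam (1 + e) / ((e - 1) * e)) / Gam (2 - e)) *
    zeta (1 + (2 - 2 * e))| =
  (1 - cos (pi * e)) / `|e| * (1 - e)^-1 * (Gam (3 - 2 * e) * Gam (1 + e) * (Gam (2 - e))^-1 *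
   zeta (1 + (2 - 2 * e))).
  rewrite !(normrM, normfV) (ger0_norm A0) (gtr0_norm g1) (gtr0_norm g2) (gtr0_norm g3) (ger0_norm z0).
  rewrite [`|e - 1|]distrC (gtr0_norm i0).
  by field; rewrite !gt_eqF.
have -> : pi ^+ 2 * M * `|e| = pi ^+ 2 / 2 * `|e| * 2 * M by field.
have B0 : 0 <= (1 - cos (pi * e)) / `|e| by rewrite divr_ge0.
have j0 : 0 <= (1 - e)^-1 by rewrite invr_ge0 ltW.
have k0 : 0 <= (Gam (2 - e))^-1 by rewrite invr_ge0 ltW.
have G10 := ltW g1; have G20 := ltW g2.
apply: ler_pM; rewrite ?mulr_ge0//; first exact: ler_pM.
rewrite /M; apply: ler_pM; rewrite ?mulr_ge0//; last first.
  by apply: zeta_le; apply/andP; split; lra.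
apply: ler_pM; rewrite ?mulr_ge0//; last exact: Gam_inv_le.
apply: ler_pM => //; apply: Gam_le_add; rewrite ?invr_gt0//; apply/andP; split; lra.
Qed.

Lemma second_term_cvg0 : second_term e @[e --> (0 : R)^'] --> (0 : R).
Proof.
have [K HK] := second_term_le.
apply: norm_cvg0.
apply: (@squeeze_cvgr _ _ _ _ (fun=> 0) (fun e => K * `|e|)); last 2 first.
- exact: cvg_cst.
- have : K * `|e| @[e --> (0 : R)^'] --> K * `|(0 : R)|.
    by apply: cvgMl_tmp; apply: cvg_norm; exact: cvg_within.
  by rewrite normr0 mulr0.
near=> e; rewrite normr_ge0/= HK//; first by near: e; exact: nbhs_dnbhs_neq.
by near: e; apply: dnbhs0_lt; rewrite invr_gt0.
Unshelve. all: by end_near.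
Qed.

End SecondTerm.

(** * First-order energy *)
Section Energy.
Context {R : realType}.
Implicit Types (eps L z u : R).
Notation mu := (@lebesgue_measure R).
Notation zeta := (@riemann_zeta R).

Definition energy_scale eps L : R := (propagator_const eps * (2 * L) `^ (- (2 - eps))) ^+ 2.

Lemma half_space_int u L : 0 < u -> 0 < L ->
  mu.-integrable `]L, +oo[ (fun z => (half_space_propagator (1 - u) z ^+ 2)%:E) /\
  \int[mu]_(z in `]L, +oo[) (half_space_propagator (1 - u) z ^+ 2) =
  energy_scale (1 - u) L * (L / (1 + 2 * u)).
Proof.
move=> u0 L0; have v0 : 0 < 1 + 2 * u by rewrite addr_gt0// mulr_gt0.
have P : (fun y : R => L * y + 0) @^-1` `]L, +oo[%classic = `]1, +oo[%classic.
  by apply/seteqP; split => y /=; rewrite !in_itv/= !andbT addr0 ltr_pMr.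
have E x : 0 < x -> half_space_propagator (1 - u) (L * x + 0) ^+ 2 =
    energy_scale (1 - u) L * x `^ (- (1 + (1 + 2 * u))).
  move=> x0; rewrite addr0 (half_space_scale _ L0)// ?mulr_gt0// [L * x]mulrC mulfK ?gt_eqF//.
  congr (_ * _); rewrite expr2 -powRD; last by rewrite (gt_eqF x0) implybT.
  by congr powR; ring.
have m1 : measurable_fun (`]1, +oo[%classic : set R) (fun x => x `^ (- (1 + (1 + 2 * u)))).
  exact: measurable_powRl.
have T1 : (\int[mu]_(x in `]1%R, +oo[) (x `^ (- (1 + (1 + 2 * u))))%:E = ((1 + 2 * u)^-1)%:E)%E.
  by rewrite integral_pow_tail// powR1 mul1r.
have I1 : mu.-integrable `]1, +oo[ (fun x : R => (x `^ (- (1 + (1 + 2 * u))))%:E).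
  by apply: (ge0_integrable _ m1 _ T1) => // x _; exact: powR_ge0.
have [] := @integrable_affine R `]L, +oo[%classic (fun z => half_space_propagator (1 - u) z ^+ 2) L 0.
- by rewrite gt_eqF.
- by [].
- apply: measurable_funX; rewrite /half_space_propagator.
  apply: measurable_funM => //; apply: measurable_funTS.
  apply: (@measurableT_comp _ _ _ _ _ _ (fun y : R => y `^ (- 2 + (1 - u)))).
    exact: measurable_powR.
  exact: measurable_funM.
- rewrite P; apply: (@eq_integrable _ _ _ mu _ _ (fun x =>
    (energy_scale (1 - u) L)%:E * (x `^ (- (1 + (1 + 2 * u))))%:E)%E) => //.
    by move=> x; rewrite inE /= in_itv/= andbT => x1; rewrite E ?EFinM// (lt_trans _ x1).
  exact: integrableZl.
rewrite P => I2 H; split => //.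
rewrite /Rintegral H.
have -> : (\int[mu]_(x in `]1%R, +oo[) (half_space_propagator (1 - u) (L * x + 0)%R ^+ 2)%:E =
   \int[mu]_(x in `]1%R, +oo[) ((energy_scale (1 - u) L)%:E * (x `^ (- (1 + (1 + 2 * u))))%:E))%E.
  apply: eq_integral => x; rewrite inE /= in_itv/= andbT => x1.
  by rewrite E ?EFinM// (lt_trans _ x1).
rewrite integralZl// T1 -!EFinM/= gtr0_norm//.
by ring.
Qed.

Lemma film_int u L : 0 < u <= 1 -> 0 < L ->
  mu.-integrable `]0, L[ (fun z => (film_integrand (1 - u) L z)%:E) /\
  \int[mu]_(z in `]0, L[) film_integrand (1 - u) L z =
  energy_scale (1 - u) L *
    (L * (4 * (zeta (1 + u) ^+ 2 + fp_value u * zeta (1 + 2 * u)) + 2 / (1 + 2 * u))).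
Proof.
move=> uI L0; have /andP[u0 u1] := uI.
have [I1 T1] := film_density_int uI.
have P : (fun y : R => L * y + 0) @^-1` `]0, L[%classic = `]0, 1[%classic.
  apply/seteqP; split => y /=; rewrite !in_itv/= addr0.
    by rewrite pmulr_rgt0// -ltr_pdivlMl// mulVf ?gt_eqF.
  by rewrite pmulr_rgt0// -ltr_pdivlMl// mulVf ?gt_eqF.
have s1 : 2 - (1 - u) = 1 + u by ring.
have S z : 0 < z < L -> film_integrand (1 - u) L z =
    energy_scale (1 - u) L * film_density (1 + u) (z / L).
  by move=> zI; rewrite film_integrand_scale// /energy_scale !s1.
have E x : 0 < x < 1 -> film_integrand (1 - u) L (L * x + 0) =
    energy_scale (1 - u) L * film_density (1 + u) x.
  move=> xI; rewrite addr0 S; first by rewrite [L * x]mulrC mulfK ?gt_eqF.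
  by rewrite pmulr_rgt0// -ltr_pdivlMl// mulVf ?gt_eqF.
have [] := @integrable_affine R `]0, L[%classic (film_integrand (1 - u) L) L 0.
- by rewrite gt_eqF.
- by [].
- apply: (@eq_measurable_fun _ _ _ _ _ (fun z => energy_scale (1 - u) L * film_density (1 + u) (z / L))).
    by move=> z; rewrite inE /= in_itv/= => /S ->.
  apply: measurable_funM => //.
  apply: (measurable_comp (F := (`]0, 1[%classic : set R)) (f := film_density (1 + u))
    (g := fun z : R => z / L)) => //.
  + move=> _ [z + <-]; rewrite /= !in_itv/= => /andP[z0 zL].
    by rewrite divr_gt0//= ltr_pdivrMr// mul1r.
  + exact: measurable_film_density.
  + exact: measurable_funM.
- rewrite P; apply: (@eq_integrable _ _ _ mu _ _ (fun x =>
    (energy_scale (1 - u) L)%:E * (film_density (1 + u) x)%:E)%E) => //.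
    by move=> x; rewrite inE /= in_itv/= => xI; rewrite E ?EFinM.
  exact: integrableZl.
rewrite P => I2 H; split => //.
rewrite /Rintegral H.
have -> : (\int[mu]_(x in `]0%R, 1%R[) (film_integrand (1 - u) L (L * x + 0)%R)%:E =
   \int[mu]_(x in `]0%R, 1%R[) ((energy_scale (1 - u) L)%:E * (film_density (1 + u) x)%:E))%E.
  by apply: eq_integral => x; rewrite inE /= in_itv/= => xI; rewrite E ?EFinM.
rewrite integralZl// T1 -!EFinM/= gtr0_norm//.
by ring.
Qed.

(** The 2 / (1 + 2u) left in the film integral cancels against twice the half-space tail beyond
    L. *)
Lemma energy_eq u L : 0 < u <= 1 -> 0 < L ->
  first_order_energy (1 - u) L =
  2^-1 * (energy_scale (1 - u) L * L) * (zeta (1 + u) ^+ 2 + fp_value u * zeta (1 + 2 * u)).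
Proof.
move=> uI L0; have /andP[u0 _] := uI.
have [_ E1] := film_int uI L0; have [_ E2] := half_space_int u0 L0.
rewrite /first_order_energy E1 E2; field.
by rewrite gt_eqF// addr_gt0// mulr_gt0.
Qed.

Lemma pow2N n : 2 `^ (- n%:R) = (2 ^+ n)^-1 :> R.
Proof. by rewrite powRN powR_mulrn. Qed.

Lemma energy_scaleE eps L : eps < 1 -> 0 < L ->
  energy_scale eps L * L = L `^ (- 3 + 2 * eps) * ((4 * pi) `^ (- 4 + eps) * Gamma (1 - eps / 2) ^+ 2).
Proof.
move=> e1 L0; have p0 := @pi_gt0 R.
have n2 : (2 : R) != 0 by [].
have p2 : 2 `^ eps != 0 :> R by rewrite gt_eqF// powR_gt0.
rewrite /energy_scale /propagator_const powRM ?(ltW L0)//.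
(* Split so that both sides become products of powers of 2, pi and L only, apart from the gamma
   factor. *)
have -> : 4 * pi = 2 * (2 * pi) :> R by ring.
rewrite [(2 * (2 * pi)) `^ _]powRM ?mulr_ge0 ?(ltW p0)// [(2 * pi) `^ _]powRM ?(ltW p0)//.
have -> : - (2 - eps) = - 2 + eps by ring.
rewrite [2 `^ (-2 + eps)]powRD ?n2 ?implybT// [2 `^ (-4 + eps)]powRD ?n2 ?implybT//.
rewrite !pow2N.
have -> : pi `^ (-4 + eps) = (pi `^ (-2 + eps / 2)) ^+ 2 :> R.
  by rewrite expr2 -powRD ?(gt_eqF p0) ?implybT//; congr powR; field.
have -> : L `^ (-3 + 2 * eps) = (L `^ (-2 + eps)) ^+ 2 * L.
  rewrite expr2 -powRD ?(gt_eqF L0) ?implybT// -[X in _ = _ * X]powRr1 ?(ltW L0)//.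
  by rewrite -powRD ?(gt_eqF L0) ?implybT//; congr powR; ring.
by field.
Qed.

End Energy.

(* The integrability and convergence clauses make the totalised integrals and
   limit in the last clause meaningful. *)
Theorem mainTheorem5 (R : realType) (eps : R) (eps_ge0 : 0 <= eps)
    (eps_lt1 : eps < 1) :
  [/\ forall L : R, 0 < L ->
        (@lebesgue_measure R).-integrable `]0, L[
          (fun z => (film_integrand eps L z)%:E) /\
        (@lebesgue_measure R).-integrable `]L, +oo[
          (fun z => (half_space_propagator eps z ^+ 2)%:E),
      cvg (second_term e @[e --> (0 : R)^']) &
      forall c1 : R,
        (forall L : R, 0 < L ->
           L `^ (- 3 + 2 * eps) * c1 = first_order_energy eps L)
        <-> c1 = c1_formula eps].
Proof.
pose u := 1 - eps.
have u0 : 0 < u by rewrite subr_gt0.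
have uI : 0 < u <= 1 by rewrite u0 gerBl.
have eu : eps = 1 - u by rewrite subKr.
have E L : 0 < L -> L `^ (- 3 + 2 * eps) * c1_formula eps = first_order_energy eps L.
  move=> L0; rewrite [in RHS]eu energy_eq// -eu energy_scaleE// /c1_formula.
  have -> : (if eps == 0 then lim (second_term e @[e --> (0 : R)^']) else second_term eps) =
      fp_value u * riemann_zeta (1 + 2 * u).
    (* At eps = 0 both sides are 0: the left one as a limit, the right one because u = 1 and 1 +
       cos(pi) = 0. *)
    have [e0|e0] := eqVneq eps 0.
      rewrite (cvg_lim _ (@second_term_cvg0 R))//.
      have -> : u = 1 by rewrite /u e0 subr0.
      by rewrite /fp_value [pi * 1]mulr1 cospi subrr oppr0 !mul0r.
    rewrite eu second_term_fp// u0 gtrBl lt_neqAle eq_sym e0.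
    exact: eps_ge0.
  have -> : 2 - eps = 1 + u by rewrite /u; ring.
  by ring.
split.
- move=> L L0; rewrite eu; split; first by case: (film_int uI L0).
  by case: (half_space_int u0 L0).
- by apply/cvg_ex; exists 0; exact: second_term_cvg0.
(* The plate separation L = 1 alone determines c1. *)
- move=> c1; split=> [/(_ 1 ltr01)|-> //].
  by rewrite -E// powR1 !mul1r.
Qed.
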